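(* Let $k$ be an algebraically closed field, let $f\in k[x_1^{\pm1},y^{\pm1}]$ define a smooth curve $C_0:f=0$ in $\mathbb G_m^2$, and let $$\cdots\xrightarrow{s_{n+1}}C_{n+1}\xrightarrow{s_n}C_n\xrightarrow{s_{n-1}}\cdots\xrightarrow{s_1}C_1$$ be a simple Baker's resolution of $C_0$, where $s_n$ is the morphism resolving $\mathcal S_n\subseteq\mathrm{Sing}(\bar C_{\alpha})$ for some $\alpha=\alpha_n\in\Sigma_n$. Suppose $\mathcal S_n\ne\varnothing$ for all $n\in\mathbb Z_+$ such that $C_n$ is not outer regular. Then there exists $h\in\mathbb Z_+$ such that for all $n\ge h$ the closed subschemes $\bar C_\gamma$ are regular for all $\gamma\in\Sigma_n$. In particular, the curve $C_h$ is an outer regular generalised Baker's model of the smooth completion of $C_0$.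
   Context: Conventions. A curve is a (not necessarily connected) scheme of finite type over the base field, equidimensional of dimension $1$; $\mathbb N=\mathbb Z_{\ge 0}$; $\mathrm{Reg}(X),\mathrm{Sing}(X)$ are the sets of regular and singular points of $X$. $f\in k[x_1^{\pm1},y^{\pm1}]$ is such that $C_0: f=0$ in $\mathbb G_m^2=\mathrm{Spec}\,k[x_1^{\pm1},y^{\pm1}]$ is a smooth curve. For $M=(a_{ij})\in \mathrm{SL}_r(\mathbb Z)$, $(X_1,\dots,X_r)\bullet M$ is the tuple with $j$-th entry $\prod_i X_i^{a_{ij}}$; $M$ is attached to a primitive vector $v$ if its last row is $v$. For primitive $v\in\mathbb Z^{m+1}$ and a nonzero Laurent polynomial $g$ in $x_1,\dots,x_m,y$, $\mathrm{ord}_v(g)$ is the minimum of the scalar product $v\cdot i$ over exponents $i$ of monomials of $g$. For an edge $\ell$ of an integral polygon $P$, its normal vector is the primitive $(a,b)\in\mathbb Z^2$ such that for some $c\in\mathbb Z$ the function $ai+bj+c$ vanishes on $\ell$ and is $\ge0$ on $P$; a segment $P$ is considered to have two edges, both equal to $P$, with opposite normal vectors. Charts. $\Omega_m$ is the set of pairs $\alpha=(v,(g_2,\dots,g_m))$ with $v\in\mathbb Z^{m+1}$ primitive and $g_i\in k[x_1^{\pm1},y^{\pm1}]$. For $\alpha\in\Omega_m$, $C_{0,\alpha}=D(g_2\cdots g_m)\subseteq C_0$, embedded in $\mathbb G_m^{m+1}=\mathrm{Spec}\,k[x_1^{\pm1},\dots,x_m^{\pm1},y^{\pm1}]$ by $x_i=g_i$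 $(i\ge2)$. $\Omega$ is the set of $\alpha\in\bigsqcup_m\Omega_m$ with $C_{0,\alpha}$ dense in $C_0$. For $\alpha\in\Omega\cap\Omega_m$ and $M$ attached to $v$, the substitution $(x_1,\dots,x_m,y)=(X_1,\dots,X_m,Y)\bullet M$ embeds $\mathbb G_m^{m+1}$ into $\mathbb T_v=\mathrm{Spec}\,k[X_1^{\pm1},\dots,X_m^{\pm1},Y]$; $C_\alpha$ is the closure of $C_{0,\alpha}$ in $\mathbb T_v$ and $\bar C_\alpha$ the scheme-theoretic intersection $C_\alpha\cap\{Y=0\}$ (independent of $M$ up to isomorphism). For $\alpha=0$ put $C_\alpha=C_{0,\alpha}=C_0$. The dense opens $C_{0,\alpha}$ of $C_\alpha$ and $C_0$ give natural birational maps $s_{\alpha\alpha'}:C_\alpha\dashrightarrow C_{\alpha'}$ for $\alpha,\alpha'\in\Omega\sqcup\{0\}$. Admissible sets. A finite $\Sigma\subset\Omega$ is admissible if each $\alpha=(v,(g_2,\dots,g_m))\in\Sigma$ is equipped with a matrix $M_\alpha$ attached to $v$, an index $j_\alpha\in\{1,\dots,m\}$ and $\mathcal F_\alpha\in k[X_{j_\alpha},Y]$, $Y\nmid\mathcal F_\alpha$, such that, with $\mathfrak a_\alpha$ the ideal of the closure in $\mathbb T_v$ (coordinates given by $M_\alpha$) of $\{x_i=g_i,\ 2\le i\le m\}\subset\mathbb G_m^{m+1}$ and $R_\alpha=k[X_1^{\pm1},\dots,X_m^{\pm1},Y]/\mathfrak a_\alpha$: $Y$ is not invertible in $R_\alpha$,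 there is an embedding $R_\alpha\hookrightarrow k(X_{j_\alpha},Y)$ with $X_{j_\alpha}\mapsto X_{j_\alpha}$, $Y\mapsto Y$, and $C_\alpha=\mathrm{Spec}\,R_\alpha/(\mathcal F_\alpha)$; and moreover the curve $\bigcup_{\alpha\in\Sigma}C_\alpha\cup C_0$, obtained by glueing $C_\alpha$ and $C_{\alpha'}$ along the largest opens on which $s_{\alpha\alpha'}$ is an open immersion, is projective, with $C_\alpha\cap C_{\alpha'}=C_{0,\alpha}\cap C_{0,\alpha'}$ for distinct $\alpha,\alpha'\in\Sigma\sqcup\{0\}$. Put $f|_\alpha(X_{j_\alpha})=\mathcal F_\alpha(X_{j_\alpha},0)$; then $\bar C_\alpha=\mathrm{Spec}\,D_\alpha/(f|_\alpha)$ where $D_\alpha=R_\alpha/(Y)$ is a localisation of $k[X_{j_\alpha}]$. Points of $\bar C_\alpha$ are regarded as points of the glued curve. First step. $\Sigma_1=\{(v_\ell,())\mid \ell\text{ an edge of the Newton polygon of }f\}$, $v_\ell$ the normal vector of $\ell$; for $\alpha=(v_\ell,())$, $M_\alpha$ is any matrix attached to $v_\ell$, $j_\alpha=1$, and $\mathcal F_\alpha\in k[X_1,Y]$, $Y\nmid\mathcal F_\alpha$, equals $f((X_1,Y)\bullet M_\alpha)$ up to a Laurent monomial. $C_1$ is the glued curve of $\Sigma_1$. Elementary step at $(\alpha,\mathcal S)$. Let $\Sigma_n$ be admissible with glued curve $C_n$, $\alpha=(v,(g_2,\dots,g_m))\in\Sigma_n$, $\mathcal S\subseteq\mathrm{Sing}(\bar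 C_\alpha)$; rename the variable $Y$ of the chart $\alpha$ to $\tilde Y$. For $p\in\mathcal S$ let $\bar{\mathcal G}_p=X_{j_\alpha}-X_{j_\alpha}(p)$ and choose $\tilde{\mathcal G}_p\in k[X_{j_\alpha},\tilde Y]$ with $\tilde{\mathcal G}_p-\bar{\mathcal G}_p\in\tilde Yk[\tilde Y]$ and $\tilde{\mathcal G}_p\nmid\mathcal F_\alpha$. Let $g_p\in k[x_1,\dots,x_m,y]$ be the polynomial divisible by no variable that equals $\tilde{\mathcal G}_p((x_1,\dots,x_m,y)\bullet M_\alpha^{-1})$ up to a Laurent monomial (coefficient $1$). Put $g_{\mathcal S}=\prod_{p\in\mathcal S} g_p$, $\tilde{\mathcal G}_{\mathcal S}=\prod_{p\in\mathcal S}\tilde{\mathcal G}_p$. For primitive $\beta=(\beta_1,\beta_2)\in\mathbb N\times\mathbb Z_+$ and $g\in k[x_1,\dots,x_m,y]$ put $\beta\circ_g\alpha=((v_1\beta_2,\dots,v_m\beta_2,\beta_1+\mathrm{ord}_v(g)\beta_2,v_{m+1}\beta_2),(g_2,\dots,g_m,g_{m+1}))$, $g_{m+1}=g(x_1,g_2,\dots,g_m,y)$. Let $\tilde\alpha=(0,1)\circ_{g_{\mathcal S}}\alpha$, with $j_{\tilde\alpha}=j_\alpha$, $\mathcal F_{\tilde\alpha}=\mathcal F_\alpha$ and $M_{\tilde\alpha}$ obtained from $M_\alpha$ by inserting a new $(m+1)$-th row $(0,\dots,0,1,0)$ and a new $(m+1)$-th column $(n_1,\dots,n_m,1,\mathrm{ord}_v(g_{\mathcal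 S}))$, where $g_{\mathcal S}=X_1^{n_1}\cdots X_m^{n_m}\tilde Y^{\mathrm{ord}_v(g_{\mathcal S})}\tilde{\mathcal G}_{\mathcal S}$ via $M_\alpha$. For $p\in\mathcal S$ define $M_{\alpha_p}$ in the same way from $g_p,\tilde{\mathcal G}_p$; write $\tilde{\mathcal G}_p=X_{j_\alpha}+c_p(\tilde Y)$ and $\mathcal F_{\alpha,p}(\tilde X_{m+1},\tilde Y)=\mathcal F_\alpha(\tilde X_{m+1}-c_p(\tilde Y),\tilde Y)$. Let $\Sigma_p=\{\gamma=\beta\circ_{g_p}\alpha\mid\beta\in\mathbb Z_+^2\text{ primitive},\ C_{0,\gamma}\subsetneq C_\gamma\}$ (equivalently, $\beta$ is the normal vector of an edge of the Newton polygon of $\mathcal F_{\alpha,p}$), with data, for a chosen matrix $M_\beta\in\mathrm{SL}_2(\mathbb Z)$ attached to $\beta$: $M_\gamma=(I_m\oplus M_\beta)M_{\alpha_p}$, $j_\gamma=m+1$, and $\mathcal F_\gamma\in k[X_{m+1},Y]$, $Y\nmid\mathcal F_\gamma$, equal to $\mathcal F_{\alpha,p}((X_{m+1},Y)\bullet M_\beta)$ up to a Laurent monomial. The step replaces $\alpha$ by $\{\tilde\alpha\}\cup\bigcup_{p\in\mathcal S}\Sigma_p$. Simple Baker's resolution. Starting from $\Sigma_1$, for every $n$ choose $\alpha_n\in\Sigma_n$ and $\mathcal S_n\subseteq\mathrm{Sing}(\bar C_{\alpha_n})$; $\Sigma_{n+1}$ is obtained from $\Sigma_n$ by the elementary step at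 $(\alpha_n,\mathcal S_n)$. Each $\Sigma_n$ is admissible; $C_n$ is its glued curve, and $s_n:C_{n+1}\to C_n$ (the morphism resolving $\mathcal S_n$) is the unique morphism extending the birational maps $s_{\gamma\alpha'}$, $\gamma\in\Sigma_{n+1}\sqcup\{0\}$, $\alpha'\in\Sigma_n\sqcup\{0\}$. $C_n$ is outer regular if $\bar C_\gamma$ is regular for all $\gamma\in\Sigma_n$. A smooth curve $\tilde C$ over the algebraically closed field $k$ is a generalised Baker's model of a smooth projective curve $C/k$ if there are a smooth curve $\tilde C_0\subset\mathbb G_m^2$ birational to $C$ and a simple Baker's resolution of $\tilde C_0$ with $\tilde C=C_n$ for some $n$ (and then $\tilde C\simeq C$); it is outer regular if this $C_n$ is. The smooth completion of $C_0$ is the unique smooth projective curve birational to it. *)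

(* Defs.v *)
(* Over the algebraically closed field k, reduced schemes of finite type are
   represented by their sets of closed points with the Zariski topology and the
   sheaf of k-valued regular functions.  The schemes \bar C_alpha, which need
   not be reduced, are represented by the ideals defining them. *)
From HB Require Import structures.
From Stdlib Require Import Relation_Operators.
From mathcomp Require Import all_boot all_order all_algebra finmap.
From mathcomp Require Import generic_quotient ring_quotient.
From mathcomp Require Import boolp classical_sets functions.
From mathcomp Require Import topology_structure quotient_topology sigT_topology.
From mathcomp Require Import mpoly.

Set Implicit Arguments.
Unset Strict Implicit.
Unset Printing Implicit Defensive.

Import GRing.Theory Num.Theory.
Local Open Scope classical_set_scope.
Local Open Scope quotient_scope.
Local Open Scope ring_scope.

Definition prime_ideal (A : comNzRingType) (P : {pred A}) : Prop :=
  idealr_closed P /\ prime_idealr_closed P.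

(* a chain of d + 1 primes of A containing I, ending at P *)
Definition prime_chain (A : comNzRingType) (I : set A) (P : {pred A})
    (d : nat) : Prop :=
  exists q : nat -> {pred A},
  [/\ forall i, (i <= d)%N -> prime_ideal (q i),
      forall a, I a -> a \in q 0%N,
      q d =i P
    & forall i, (i < d)%N -> {subset q i <= q i.+1} /\ ~ (q i =i q i.+1)].

(* The local ring (A / I)_P is regular: its maximal ideal has as many
   generators as its Krull dimension d.  Denominators are cleared, so that the
   generators come from A and s is a unit of the local ring. *)
Definition regular_at (A : comNzRingType) (I : set A) (P : {pred A}) : Prop :=
  exists d : nat,
  [/\ prime_chain I P d, ~ prime_chain I P d.+1
    & exists x : 'I_d -> A,
      (forall i, x i \in P) /\
      (forall a, a \in P ->
         exists (s : A) (c : 'I_d -> A),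
           s \notin P /\ I (s * a - \sum_(i < d) c i * x i))].

(* only the values of reg U phi inside the open set U are meaningful *)
Record kspace (k : closedFieldType) := KSpace {
  kpoints :> topologicalType;
  reg : set kpoints -> set (kpoints -> k) }.

Section Spaces.
Variable k : closedFieldType.
Implicit Types X Y : kspace k.

Definition morphism_on X Y (U : set X) (phi : X -> Y) : Prop :=
  forall V : set Y, open V ->
    open (U `&` phi @^-1` V) /\
    (forall h, reg V h -> reg (U `&` phi @^-1` V) (h \o phi)).

Definition open_immersion_on X Y (U : set X) (phi : X -> Y) : Prop :=
  [/\ open U, morphism_on U phi,
      forall x y, U x -> U y -> phi x = phi y -> x = y
    & forall V : set X, open V -> V `<=` U ->
        open (phi @` V) /\
        (forall h : Y -> k, reg V (h \o phi) -> reg (phi @` V) h)].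

Definition isomorphic X Y : Prop :=
  exists phi : X -> Y, open_immersion_on setT phi /\ range phi = setT.

Definition birational X Y : Prop :=
  exists (U : set X) (phi : X -> Y),
  [/\ open_immersion_on U phi, dense U & dense (phi @` U)].

(* Z with the topology and the regular functions induced from affine n-space;
   used for locally closed Z *)
Definition zar n (Z : set 'rV[k]_n) : Type := Z.
HB.instance Definition _ n (Z : set 'rV[k]_n) := Choice.on (zar Z).
HB.instance Definition _ n (Z : set 'rV[k]_n) :=
  isSubBaseTopological.Build (zar Z)
    (range (fun h : {mpoly k[n]} => [set x : zar Z | h.@[(\val x) 0] != 0]))
    id.

Definition zar_reg n (Z : set 'rV[k]_n) (U : set (zar Z)) : set (zar Z -> k) :=
  [set phi | forall x, U x -> exists a b : {mpoly k[n]},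
     b.@[(\val x) 0] != 0 /\
     (forall y, U y -> b.@[(\val y) 0] != 0 ->
        phi y = a.@[(\val y) 0] / b.@[(\val y) 0])].

Definition zspace n (Z : set 'rV[k]_n) : kspace k := KSpace (@zar_reg n Z).

Definition zero_locus n (H : set {mpoly k[n]}) : set 'rV[k]_n :=
  [set x | forall h, H h -> h.@[x 0] = 0].

Definition vanishing n (Z : set 'rV[k]_n) : set {mpoly k[n]} :=
  [set h | forall x, Z x -> h.@[x 0] = 0].

Definition pline N := {L : {vspace 'rV[k]_N.+1} | \dim L == 1%N}.

Definition pzar N (Z : set (pline N)) : Type := Z.
HB.instance Definition _ N (Z : set (pline N)) := Choice.on (pzar Z).

(* homogeneous coordinates of x *)
Definition pvec N (Z : set (pline N)) (x : pzar Z) : 'rV[k]_N.+1 :=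
  vpick (\val (\val x)).

Definition homog_pair n (a b : {mpoly k[n]}) : Prop :=
  exists d : nat, a \is d.-homog /\ b \is d.-homog.

HB.instance Definition _ N (Z : set (pline N)) :=
  isSubBaseTopological.Build (pzar Z)
    ((fun h : {mpoly k[N.+1]} => [set x : pzar Z | h.@[(pvec x) 0] != 0]) @`
       [set h | homog_pair h h])
    id.

Definition pzar_reg N (Z : set (pline N)) (U : set (pzar Z)) :
    set (pzar Z -> k) :=
  [set phi | forall x, U x -> exists a b : {mpoly k[N.+1]},
     [/\ homog_pair a b, b.@[(pvec x) 0] != 0
       & forall y, U y -> b.@[(pvec y) 0] != 0 ->
           phi y = a.@[(pvec y) 0] / b.@[(pvec y) 0]]].

Definition pspace N (Z : set (pline N)) : kspace k := KSpace (@pzar_reg N Z).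

Definition projective X : Prop :=
  exists (N : nat) (H : set {mpoly k[N.+1]}),
    (forall h, H h -> homog_pair h h) /\
    isomorphic X
      (pspace [set L : pline N | forall h, H h -> h.@[(vpick (\val L)) 0] = 0]).

(* The first clause says that being regular is a local property. *)
Definition prevariety X : Prop :=
  (forall (U : set X) (h : X -> k), open U ->
     (forall x, U x -> exists V, [/\ open V, V x, V `<=` U & reg V h]) ->
     reg U h) /\
  (exists (r : nat) (U : 'I_r -> set X),
     \bigcup_i U i = setT /\
     (forall i, exists (n : nat) (H : set {mpoly k[n]})
        (phi : zspace (zero_locus H) -> X),
        open_immersion_on setT phi /\ range phi = U i)).

Definition irreducible_closed (T : topologicalType) (Z : set T) : Prop :=
  [/\ closed Z, Z !=set0
    & forall A B : set T, closed A -> closed B ->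
        Z `<=` A `|` B -> Z `<=` A \/ Z `<=` B].

Definition closed_chain (T : topologicalType) (Z : set T) (d : nat) : Prop :=
  exists W : nat -> set T,
    (forall i, (i <= d)%N -> irreducible_closed (W i) /\ W i `<=` Z) /\
    (forall i, (i < d)%N -> W i `<` W i.+1).

Definition irreducible_component (T : topologicalType) (Z : set T) : Prop :=
  irreducible_closed Z /\
  (forall W, irreducible_closed W -> Z `<=` W -> W = Z).

Definition curve X : Prop :=
  prevariety X /\
  (forall Z : set X, irreducible_component Z ->
     closed_chain Z 1 /\ ~ closed_chain Z 2).

(* The local ring of the curve X, of Krull dimension 1, is regular at P: its
   maximal ideal is generated by the germ of t. *)
Definition regular_point X (P : X) : Prop :=
  exists (U : set X) (t : X -> k),
  [/\ open U, U P, reg U t, t P = 0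
    & forall (V : set X) (h : X -> k), open V -> V P -> reg V h -> h P = 0 ->
        exists (W : set X) (q : X -> k),
        [/\ open W, W P, W `<=` U `&` V, reg W q
          & forall x, W x -> h x = t x * q x]].

(* over the algebraically closed field k, smooth means regular *)
Definition smooth_curve X : Prop := curve X /\ (forall P : X, regular_point P).

End Spaces.

Notation laurent k n := {fsfun 'rV[int]_n -> k with 0}.

Section Laurent.
Variable k : closedFieldType.

Definition laurent_eval n (f : laurent k n) (x : 'rV[k]_n) : k :=
  \sum_(e <- finsupp f) f e * \prod_i x 0 i ^ e 0 i.

(* the value at x of the partial derivative of f in the variable l *)
Definition laurent_deriv_eval n (f : laurent k n) (l : 'I_n) (x : 'rV[k]_n) :
    k :=
  \sum_(e <- finsupp f)
     (f e *~ e 0 l) * \prod_i x 0 i ^ (e 0 i - (i == l)%:Z).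

Definition torus n : set 'rV[k]_n := [set x | forall i, x 0 i != 0].

Definition C0_set (f : laurent k 2) : set 'rV[k]_2 :=
  torus (n := 2) `&` [set q | laurent_eval f q = 0].

(* the scheme f = 0 in G_m^2 is a curve, smooth by the Jacobian criterion *)
Definition smooth_plane_curve (f : laurent k 2) : Prop :=
  (exists e, f e != 0) /\
  (forall q, C0_set f q -> exists l, laurent_deriv_eval f l q != 0).

Definition C0 (f : laurent k 2) : kspace k := zspace (C0_set f).

Definition bullet n (x : 'rV[k]_n) (M : 'M[int]_n) : 'rV[k]_n :=
  \row_j \prod_i x 0 i ^ M i j.

(* the coefficients of a polynomial regarded as a Laurent polynomial *)
Definition lcoef n (h : {mpoly k[n]}) (e : 'rV[int]_n) : k :=
  if [forall i, 0 <= e 0 i] then h@_[multinom absz (e ord0 i) | i < n] else 0.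

(* g((X_1,...,X_n) bullet M) = X^c G, in terms of the coefficients of g, for M
   in SL_n(Z): the substitution turns the exponent e into M e. *)
Definition monomial_subst n (g : 'rV[int]_n -> k) (M : 'M[int]_n)
    (c : 'rV[int]_n) (G : {mpoly k[n]}) : Prop :=
  forall e, g e = lcoef G (e *m M^T - c).

Definition mdivides n (g h : {mpoly k[n]}) : Prop :=
  exists u : {mpoly k[n]}, h = u * g.

Definition idot n (v e : 'rV[int]_n) : int := \sum_i v 0 i * e 0 i.

Definition mexp n (m : 'X_{1..n}) : 'rV[int]_n := \row_i (m i)%:Z.

(* ord_v(g), for g nonzero *)
Definition ordv n (v : 'rV[int]_n) (g : {mpoly k[n]}) : int :=
  \big[Num.min/idot v (mexp (mlead g))]_(m <- msupp g) idot v (mexp m).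

End Laurent.

Definition primitive n (v : 'rV[int]_n) : Prop :=
  forall d : int, (forall i, (d %| v ord0 i)%Z) -> (d %| 1)%Z.

Definition attached n (M : 'M[int]_n.+1) (v : 'rV[int]_n.+1) : Prop :=
  \det M = 1 /\ row ord_max M = v.

(* A pair alpha = (v, (g_2, ..., g_m)) equipped with M_alpha, j_alpha and
   F_alpha.  Here m = ng + 1, and the variables x_1, ..., x_m, y (and likewise
   X_1, ..., X_m, Y) have the indices 0, ..., ng, ord_max.  F_alpha is a
   polynomial in X_(j_alpha), of index 0, and Y, of index 1.  In a simple
   Baker's resolution the g_i are polynomials in x_1 and y. *)
Record chart (k : closedFieldType) := Chart {
  ng : nat;
  vec : 'rV[int]_ng.+2;
  gs : ng.-tuple {mpoly k[2]};
  mat : 'M[int]_ng.+2;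
  jdx : 'I_ng.+1;
  charteq : {mpoly k[2]} }.

HB.instance Definition _ (k : closedFieldType) := gen_eqMixin (chart k).
HB.instance Definition _ (k : closedFieldType) := gen_choiceMixin (chart k).

Section Charts.
Variables (k : closedFieldType) (f : laurent k 2).
Implicit Type al : chart k.

Definition xj al : 'I_(ng al).+2 := widen_ord (leqnSn _) (jdx al).

Definition C0_chart al : set 'rV[k]_2 :=
  C0_set f `&` [set q | all (fun g : {mpoly k[2]} => g.@[q 0] != 0) (gs al)].

(* the point (x_1, g_2, ..., g_m, y), in the coordinates X_1, ..., X_m, Y *)
Definition chart_coord al (q : 'rV[k]_2) : 'rV[k]_(ng al).+2 :=
  bullet
    (\row_i nth 0 (rcons (q 0 0 :: [seq g.@[q 0] | g : {mpoly k[2]} <- gs al])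
                         (q 0 1)) i)
    (invmx (mat al)).

(* the image of C_(0,alpha) in T_v *)
Definition C0_image al : set 'rV[k]_(ng al).+2 :=
  chart_coord al @` C0_chart al.
Arguments C0_image : clear implicits.

(* The closure C_alpha of C_(0,alpha) in T_v.  Up to units, functions on T_v
   are polynomials. *)
Definition C_set al : set 'rV[k]_(ng al).+2 :=
  [set x : 'rV[k]_(ng al).+2 | forall i, i != ord_max -> x 0 i != 0] `&`
  zero_locus (vanishing (C0_image al)).
Arguments C_set : clear implicits.

Definition C_chart al : kspace k := zspace (C_set al).

(* The ideal of \bar C_alpha, contracted to k[X_1, ..., X_m, Y]; the local
   rings at the points of T_v are not affected by the contraction. *)
Definition Cbar_ideal al : set {mpoly k[(ng al).+2]} :=
  [set h | exists a b, vanishing (C0_image al) a /\ h = a + b * 'X_ord_max].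
Arguments Cbar_ideal : clear implicits.

Definition Cbar_points al : set 'rV[k]_(ng al).+2 :=
  C_set al `&` [set p : 'rV[k]_(ng al).+2 | p 0 ord_max = 0].
Arguments Cbar_points : clear implicits.

Definition max_ideal n (p : 'rV[k]_n) : {pred {mpoly k[n]}} :=
  [pred h | h.@[p 0] == 0].

Definition Cbar_regular_at al (p : 'rV[k]_(ng al).+2) : Prop :=
  regular_at (Cbar_ideal al) (max_ideal p).

Definition Cbar_regular al : Prop :=
  forall p, Cbar_points al p -> Cbar_regular_at p.

Definition Sing_Cbar al : set 'rV[k]_(ng al).+2 :=
  Cbar_points al `&` [set p | ~ Cbar_regular_at p].
Arguments Sing_Cbar : clear implicits.

Definition outer_regular (Sigma : set (chart k)) : Prop :=
  forall al, Sigma al -> Cbar_regular al.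

(* an element of Omega or 0; None stands for 0 *)
Definition dim0 (a : option (chart k)) : nat :=
  if a is Some al then (ng al).+2 else 2.

Definition space0 (a : option (chart k)) : kspace k :=
  if a is Some al then C_chart al else C0 f.

(* x is the point of C_a given by the point q of C_0, where q lies in
   C_(0,a) *)
Definition marks (a : option (chart k)) : 'rV[k]_2 -> space0 a -> Prop :=
  match a with
  | Some al => fun q x => C0_chart al q /\ \val x = chart_coord al q
  | None => fun q x => \val x = q
  end.

(* phi : V -> C_b extends the birational map s_(ab) : C_a --> C_b *)
Definition extends_s (a b : option (chart k)) (V : set (space0 a))
    (phi : space0 a -> space0 b) : Prop :=
  forall q x y, V x -> marks q x -> marks q y -> phi x = y.

(* x lies in the largest open of C_a on which s_(ab) is an open immersion, and
   s_(ab) sends x to y *)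
Definition glue (a b : option (chart k)) (x : space0 a) (y : space0 b) : Prop :=
  exists (V : set (space0 a)) (phi : space0 a -> space0 b),
  [/\ open_immersion_on V phi, extends_s V phi, V x & phi x = y].

Section Glueing.
Variable Sigma : set (chart k).

Definition index0 : set (option (chart k)) := None |` Some @` Sigma.

Definition pieces := {a : index0 & space0 (\val a)}.

Definition glue_step (u w : pieces) : Prop := glue (projT2 u) (projT2 w).

Definition glue_eq (u w : pieces) : bool :=
  `[< clos_refl_sym_trans pieces glue_step u w >].

Lemma glue_eq_refl : reflexive glue_eq.
Proof. by move=> u; apply/asboolP; apply: rst_refl. Qed.

Lemma glue_eq_sym : ssrbool.symmetric glue_eq.
Proof. by move=> u w; apply/asboolP/asboolP; apply: rst_sym. Qed.

Lemma glue_eq_trans : transitive glue_eq.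
Proof.
by move=> w u z /asboolP uw /asboolP wz; apply/asboolP; apply: rst_trans uw wz.
Qed.

Canonical glue_equiv := EquivRel glue_eq glue_eq_refl glue_eq_sym glue_eq_trans.

Definition glued_space := quotient_topology {eq_quot glue_equiv}.

Definition glued_incl (a : index0) (x : space0 (\val a)) : glued_space :=
  \pi_glued_space (existT _ a x).

Definition glued_reg (U : set glued_space) : set (glued_space -> k) :=
  [set h : glued_space -> k | forall a : index0,
     reg ((@glued_incl a) @^-1` U) (h \o (@glued_incl a))].

Definition glued_curve : kspace k := KSpace glued_reg.

End Glueing.

(* the unique morphism extending all the maps s_(ab), a in Sigma' or 0, b in
   Sigma or 0 *)
Definition resolving_morphism (Sigma' Sigma : set (chart k))
    (s : glued_curve Sigma' -> glued_curve Sigma) : Prop :=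
  morphism_on setT s /\
  (forall (a : index0 Sigma') (b : index0 Sigma) q
     (x : space0 (\val a)) (y : space0 (\val b)),
     marks q x -> marks q y -> s (glued_incl x) = glued_incl y).

(* v . e + c vanishes on an edge (it vanishes at two distinct points of the
   polygon) and is >= 0 on the polygon; it suffices to test the latter on the
   exponents of f, whose convex hull is the polygon *)
Definition edge_normal (v : 'rV[int]_2) : Prop :=
  primitive v /\
  (exists c : int,
     (forall e, f e != 0 -> 0 <= idot v e + c) /\
     (exists e e' : 'rV[int]_2,
        [/\ e != e', f e != 0, f e' != 0,
            idot v e + c = 0 & idot v e' + c = 0])).

Definition first_step (Sigma : set (chart k)) : Prop :=
  exists (M : 'rV[int]_2 -> 'M[int]_2) (F : 'rV[int]_2 -> {mpoly k[2]}),
    (forall v, edge_normal v ->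
       [/\ attached (M v) v, ~ mdivides 'X_1 (F v)
         & exists c, monomial_subst f (M v) c (F v)]) /\
    Sigma =
      [set @Chart k 0 v [tuple] (M v) ord0 (F v) | v in edge_normal].

Definition y_poly (c : {poly k}) : {mpoly k[2]} :=
  (map_poly (@mpolyC 2 k) c).['X_1].

(* tilde G_p = X_(j_alpha) + c_p(tilde Y) *)
Definition tG (c : {poly k}) : {mpoly k[2]} := 'X_0 + y_poly c.

(* F_(alpha,p) *)
Definition shift_eqn al (c : {poly k}) : {mpoly k[2]} :=
  charteq al \mPo [tuple 'X_0 - y_poly c; 'X_1].

(* k[X_(j_alpha), tilde Y] in k[X_1, ..., X_m, tilde Y] *)
Definition in_chart al (h : {mpoly k[2]}) : {mpoly k[(ng al).+2]} :=
  h \mPo [tuple 'X_(xj al); 'X_ord_max].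

(* the index of the new variable x_(m+1), between x_m and y *)
Definition newpos r : 'I_r.+3 := inord r.+1.

(* insertion of the new row (0, ..., 0, 1, 0) and the new column
   (n_1, ..., n_m, 1, n_(m+1)) *)
Definition insert_mat r (M : 'M[int]_r.+2) (n : 'rV[int]_r.+2) :
    'M[int]_r.+3 :=
  \matrix_(i, j)
    match unlift (newpos r) i, unlift (newpos r) j with
    | Some i', Some j' => M i' j'
    | Some i', None => n 0 i'
    | None, Some _ => 0
    | None, None => 1
    end.

(* the vector of beta o_g alpha *)
Definition circ_vec al (be : 'rV[int]_2) (g : {mpoly k[(ng al).+2]}) :
    'rV[int]_(ng al).+3 :=
  \row_i
    if unlift (newpos (ng al)) i is Some i' then vec al 0 i' * be 0 1
    else be 0 0 + ordv (vec al) g * be 0 1.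

(* (g_2, ..., g_m, g_(m+1)) with g_(m+1) = g(x_1, g_2, ..., g_m, y) *)
Definition circ_gs al (g : {mpoly k[(ng al).+2]}) :
    (ng al).+1.-tuple {mpoly k[2]} :=
  [tuple of rcons (gs al) (g \mPo [tuple of rcons ('X_0 :: gs al) 'X_1])].

Definition dsum_mat r (Mb : 'M[int]_2) : 'M[int]_r.+3 :=
  castmx (addn2 r.+1, addn2 r.+1) (block_mx (1%:M : 'M_r.+1) 0 0 Mb).

Definition tilde_chart al (g : {mpoly k[(ng al).+2]})
    (n : 'rV[int]_(ng al).+2) : chart k :=
  @Chart k (ng al).+1 (circ_vec (\row_(i < 2) (i == 1)%:Z) g) (circ_gs g)
    (insert_mat (mat al) n) (xj al) (charteq al).

Definition circ_chart al (be : 'rV[int]_2) (g : {mpoly k[(ng al).+2]})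
    (n : 'rV[int]_(ng al).+2) (Mb : 'M[int]_2) (Fb : {mpoly k[2]}) : chart k :=
  @Chart k (ng al).+1 (circ_vec be g) (circ_gs g)
    (dsum_mat (ng al) Mb *m insert_mat (mat al) n) ord_max Fb.

Definition pos_primitive (be : 'rV[int]_2) : Prop :=
  [/\ 0 < be 0 0, 0 < be 0 1 & primitive be].

(* g((x_1, ..., x_m, y)) = X_1^(n_1) ... X_m^(n_m) tY^(ord_v(g)) G via
   M_alpha, with n_(m+1) = ord_v(g) *)
Definition chart_subst al (g : {mpoly k[(ng al).+2]})
    (n : 'rV[int]_(ng al).+2) (G : {mpoly k[2]}) : Prop :=
  monomial_subst (lcoef g) (mat al) n (in_chart al G) /\
  n 0 ord_max = ordv (vec al) g.

(* For each p in the list S: c p is c_p, g p is g_p, n p is the vector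
   (n_1, ..., n_m, ord_v(g_p)); nS is the corresponding vector for the
   product g_S; Mb p beta and Fb p beta are M_beta and F_gamma. *)
Definition elementary_step (Sigma : set (chart k)) al
    (S : seq 'rV[k]_(ng al).+2) (Sigma' : set (chart k)) : Prop :=
  exists (c : 'rV[k]_(ng al).+2 -> {poly k})
    (g : 'rV[k]_(ng al).+2 -> {mpoly k[(ng al).+2]})
    (n : 'rV[k]_(ng al).+2 -> 'rV[int]_(ng al).+2)
    (nS : 'rV[int]_(ng al).+2)
    (Mb : 'rV[k]_(ng al).+2 -> 'rV[int]_2 -> 'M[int]_2)
    (Fb : 'rV[k]_(ng al).+2 -> 'rV[int]_2 -> {mpoly k[2]}),
  let gS := \prod_(p <- S) g p in
  let gamma p be := circ_chart be (g p) (n p) (Mb p be) (Fb p be) in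
  [/\ forall p, p \in S ->
        [/\ (c p).[0] = - p 0 (xj al),
            ~ mdivides (tG (c p)) (charteq al),
            forall i, ~ mdivides 'X_i (g p)
          & chart_subst (g p) (n p) (tG (c p))],
      chart_subst gS nS (\prod_(p <- S) tG (c p)),
      forall p be, p \in S -> pos_primitive be ->
        [/\ attached (Mb p be) be,
            ~ mdivides 'X_1 (Fb p be)
          & exists e, monomial_subst (lcoef (shift_eqn al (c p))) (Mb p be) e
                        (Fb p be)]
    & Sigma' =
        (Sigma `\ al) `|` [set tilde_chart gS nS] `|`
        [set ga | exists p be,
           [/\ p \in S, pos_primitive be, ga = gamma p be
             & C0_image (gamma p be) `<` C_set (gamma p be)]]].

End Charts.

Arguments C0_image {k} f al _.
Arguments C_set {k} f al _.
Arguments Cbar_ideal {k} f al _.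
Arguments Cbar_points {k} f al _.
Arguments Sing_Cbar {k} f al _.

(* The terms of the sequences of index 0 are not used. *)
Definition simple_Baker_resolution (k : closedFieldType) (f : laurent k 2)
    (Sigma : nat -> set (chart k)) (al : nat -> chart k)
    (S : forall n, seq 'rV[k]_(ng (al n)).+2)
    (s : forall n, glued_curve f (Sigma n.+1) -> glued_curve f (Sigma n)) :
    Prop :=
  first_step f (Sigma 1%N) /\
  (forall n, (0 < n)%N ->
     [/\ Sigma n (al n),
         uniq (S n) /\ (forall p, p \in S n -> Sing_Cbar f (al n) p),
         elementary_step f (Sigma n) (S n) (Sigma n.+1)
       & resolving_morphism (s n)]).

Definition outer_regular_generalised_Baker_model (k : closedFieldType)
    (Ct C : kspace k) : Prop :=
  [/\ smooth_curve Ct, smooth_curve C, projective C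
    & exists f : laurent k 2,
      [/\ smooth_plane_curve f, birational (C0 f) C
        & exists Sigma al S s n,
          [/\ @simple_Baker_resolution k f Sigma al S s, (0 < n)%N,
              isomorphic Ct (glued_curve f (Sigma n))
            & outer_regular f (Sigma n)]]].

Definition smooth_completion (k : closedFieldType) (f : laurent k 2)
    (C : kspace k) : Prop :=
  [/\ smooth_curve C, projective C & birational (C0 f) C].

(* Main.v *)
(* Let p be a point of some \bar C_alpha, let r be the multiplicity of the root
   X_j(p) of f|_alpha, and let N be such that Y^N lies, up to a unit, in the
   jacobian ideal of F_alpha at (X_j(p), 0).  It exists in the first step, since
   C_0 is smooth and Y does not divide F_alpha.  An elementary step replaces p
   by finitely many points, the roots of the edge polynomials of F_(alpha,p).
   At a root for the edge with normal vector beta, the multiplicity r' satisfies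
   beta_2 r' <= r, and if r' = r > 1, then beta_2 = 1 and N can be replaced by
   N - beta_1 (r - 1).  So the multiset of the pairs (r, N) with r > 1 decreases
   at every step with nonempty S_n, and from some step on all roots are simple,
   which means that the \bar C_gamma are regular.

   For the smoothness of C_h: every piece C_gamma contains a cofinite open
   subset of C_0 and has finitely many points with Y = 0, at which Y is a
   uniformiser.  A map between pieces is determined outside of any finite set,
   so the glueing relation is transitive, the pieces are open in the glued
   curve, and the dimension can be read off from C_0. *)
Require Import Defs.
From Stdlib Require Import Relation_Operators.
From mathcomp Require Import all_boot all_order all_algebra finmap.
From mathcomp Require Import generic_quotient.
From mathcomp Require Import boolp classical_sets functions cardinality.
From mathcomp Require Import topology_structure quotient_topology sigT_topology.
From mathcomp Require Import mpoly ring zify.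

Set Implicit Arguments.
Unset Strict Implicit.
Unset Printing Implicit Defensive.

Import Order.TTheory GRing.Theory Num.Theory.
Local Open Scope classical_set_scope.
Local Open Scope ring_scope.

(** Both derivatives enter the jacobian bound because in characteristic p the one in X may vanish
    identically, as for X^p - Y. To follow the bound through M_beta, the relation for F_(alpha,p) is
    multiplied by the product of its two variables. The derivatives then become logarithmic ones,
    which an integral monomial substitution transforms linearly and with determinant 1, whatever the
    characteristic. Comparing powers of Y yields the new bound beta_2 (N + 1) + beta_1 - d -
    min(beta_1, beta_2), where d is the weight of the edge. It can exceed N when the multiplicity
    drops, so the pairs are ordered lexicographically; and as one point may be replaced by many,
    lists of pairs are compared as multisets. Some bound is carried along for each point, not the
    least one.

    Regularity at the end is obtained without examining roots: when the list can no longer decrease,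
    every later S_n is empty, and the assumption on S_n gives outer regularity. A step with empty
    S_n changes a chart but no pair. *)

Section ClosedFieldPoly.
Variable k : closedFieldType.

Lemma closed_field_infinite (s : seq k) : exists x, x \notin s.
Proof.
have p0 : \prod_(a <- s) ('X - a%:P) != 0 :> {poly k}.
  by rewrite monic_neq0 ?monic_prod_XsubC.
have /closed_nonrootP[x hx] := p0.
by exists x; rewrite -root_prod_XsubC.
Qed.

Lemma infinite_closed_field : infinite_set [set: k].
Proof.
move=> /finite_seqP[s hs]; have [x hx] := closed_field_infinite s.
by have : [set: k] x by []; rewrite hs /= (negbTE hx).
Qed.

Lemma finite_roots (p : {poly k}) : p != 0 -> finite_set [set x | p.[x] = 0].
Proof.
move=> p0; have [rs hp] := closed_field_poly_normal p.
apply: sub_finite_set (finite_seq rs) => x /= /eqP.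
by rewrite hp hornerZ mulf_eq0 lead_coef_eq0 (negbTE p0) /= -root_prod_XsubC.
Qed.

Lemma finite_roots_eq0 (p : {poly k}) (A : set k) :
  infinite_set A -> (forall x, A x -> p.[x] = 0) -> p = 0.
Proof.
move=> infA pA; apply/eqP/negPn/negP => p0; apply: infA.
exact: sub_finite_set (finite_roots p0).
Qed.

Lemma closed_root (p : {poly k}) : (1 < size p)%N -> exists x, p.[x] = 0.
Proof.
move=> hp; have /closed_rootP[x /rootP hx] : size p != 1%N by case: ltngtP hp.
by exists x.
Qed.

End ClosedFieldPoly.

(** * Polynomials in two variables *)

Section Bivariate.
Variable k : closedFieldType.
Implicit Types (p q c : {poly k}) (A B F G H v w : {poly {poly k}}).

(* the outer variable is X, the inner one is Y *)
Definition spec (y : k) : {rmorphism {poly {poly k}} -> {poly k}} :=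
  map_poly (horner_eval y).

Definition evb F x y := (spec y F).[x].

Lemma specZ y c F : spec y (c *: F) = c.[y] *: spec y F.
Proof. by rewrite -[c *: F]mul_polyC rmorphM /= map_polyC /= mul_polyC. Qed.

Lemma specC y c : spec y c%:P = c.[y]%:P.
Proof. by rewrite /= map_polyC. Qed.

Lemma specX y : spec y 'X = 'X.
Proof. by rewrite /= map_polyX. Qed.

Lemma coef_spec y F i : (spec y F)`_i = (F`_i).[y].
Proof. by rewrite coef_map. Qed.

Lemma evbM F G x y : evb (F * G) x y = evb F x y * evb G x y.
Proof. by rewrite /evb rmorphM hornerM. Qed.
Lemma evbD F G x y : evb (F + G) x y = evb F x y + evb G x y.
Proof. by rewrite /evb rmorphD hornerD. Qed.
Lemma evbZ c F x y : evb (c *: F) x y = c.[y] * evb F x y.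
Proof. by rewrite /evb specZ hornerZ. Qed.
Lemma evbC c x y : evb c%:P x y = c.[y].
Proof. by rewrite /evb specC hornerC. Qed.

(** Primitivity over k[Y]: as [k] is algebraically closed, a nonconstant content would have a root
    [a], at which all coefficients of [G] vanish. *)
Definition primitiveb G := forall a, spec a G != 0.

Lemma spec_eq0_factor a G : spec a G = 0 -> exists G1, G = ('X - a%:P) *: G1.
Proof.
move=> hG; exists (\poly_(i < size G) (G`_i %/ ('X - a%:P))).
apply/polyP => i; rewrite coefZ coef_poly.
case: ltnP => hi; last by rewrite mulr0 nth_default.
have : root G`_i a by rewrite rootE -coef_spec hG coef0.
by rewrite -dvdp_XsubCl => /divpK; rewrite mulrC => ->.
Qed.

Lemma size_scalep c F : c != 0 -> size (c *: F) = size F.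
Proof. by move=> c0; rewrite size_scale. Qed.

Lemma scalep_inj c : c != 0 -> injective (fun F => c *: F).
Proof.
move=> c0 F G /=; rewrite -!mul_polyC; apply: mulfI.
by rewrite polyC_eq0.
Qed.

Lemma content_primitive F : F != 0 ->
  exists c F1, [/\ c != 0, primitiveb F1 & F = c *: F1].
Proof.
have [n] := ubnP (size (lead_coef F)); elim: n F => // n IH F hn F0.
have [[a ha]|hp] := pselect (exists a, spec a F = 0); last first.
  exists 1, F; rewrite oner_eq0 scale1r; split=> // a; apply/eqP => e.
  by apply: hp; exists a.
have [G eG] := spec_eq0_factor ha.
have G0 : G != 0 by apply: contra_neq F0 => e; rewrite eG e scaler0.
have [|c [F1 [c0 hF1 e]]] := IH G _ G0.
  have := hn; rewrite eG lead_coefZ size_mul ?polyXsubC_eq0 ?lead_coef_eq0 //.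
  by rewrite size_XsubC.
exists (('X - a%:P) * c), F1; split=> //.
  by rewrite mulf_neq0 ?polyXsubC_eq0.
by rewrite eG e scalerA.
Qed.

(* Gauss' lemma; as k is algebraically closed, it suffices to remove linear
   factors of c one at a time. *)
Lemma gauss_factor c A G H : c != 0 -> c *: A = G * H ->
  exists G' H' c1 c2,
    [/\ c1 != 0, c2 != 0, G = c1 *: G', H = c2 *: H' & A = G' * H'].
Proof.
have [n] := ubnP (size c); elim: n c G H => // n IH c G H hn c0 e.
have [hc|/closed_root[a ha]] := leqP (size c) 1.
  have /size_poly1P[d d0 ed] : size c == 1%N.
    by rewrite eqn_leq hc lt0n size_poly_eq0.
  exists (d^-1%:P *: G), H, d%:P, 1; split=> //.
  - by rewrite polyC_eq0.
  - exact: oner_neq0.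
  - by rewrite scalerA -polyCM mulfV // scale1r.
  - by rewrite scale1r.
  - by rewrite -scalerAl -e ed scalerA -polyCM mulVf // scale1r.
have /factor_theorem[c' ec] : root c a by apply/rootP.
have c'0 : c' != 0 by apply: contra_neq c0 => e'; rewrite ec e' mul0r.
have sc' : (size c' < n)%N.
  have := hn; rewrite ec size_mul ?polyXsubC_eq0 // size_XsubC addn2 /=.
  by rewrite ltnS.
have : spec a G * spec a H = 0.
  by rewrite -rmorphM -e specZ ha scale0r.
have X0 : 'X - a%:P != 0 by rewrite polyXsubC_eq0.
move=> /eqP; rewrite mulf_eq0 => /orP[] /eqP /spec_eq0_factor[G1 eG].
- have e1 : c' *: A = G1 * H.
    apply: (scalep_inj X0).
    by rewrite scalerA scalerAl -eG -e ec mulrC.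
  have [G' [H' [c1 [c2 [h1 h2 h3 h4 h5]]]]] := IH _ _ _ sc' c'0 e1.
  exists G', H', (('X - a%:P) * c1), c2; split=> //; first exact: mulf_neq0.
  by rewrite eG h3 scalerA.
- have e1 : c' *: A = G * G1.
    apply: (scalep_inj X0).
    by rewrite scalerA scalerAr -eG -e ec mulrC.
  have [G' [H' [c1 [c2 [h1 h2 h3 h4 h5]]]]] := IH _ _ _ sc' c'0 e1.
  exists G', H', c1, (('X - a%:P) * c2); split=> //; first exact: mulf_neq0.
  by rewrite eG h4 scalerA.
Qed.

(** Divisibility descends from k(Y)[X] to k[Y][X] by Gauss' lemma: a root of the factor [c1] split
    off from [F] would annihilate a specialisation of [F], so [c1] is a constant. *)
Lemma primitive_dvd c F v u : primitiveb F -> c != 0 -> c *: v = F * u ->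
  exists u', v = F * u'.
Proof.
move=> pF c0 e; have [G' [H' [c1 [c2 [c10 _ eF _ ->]]]]] := gauss_factor c0 e.
have [hc|/closed_root[a ha]] := leqP (size c1) 1; last first.
  by have := pF a; rewrite eF specZ ha scale0r eqxx.
have /size_poly1P[d d0 ed] : size c1 == 1%N.
  by rewrite eqn_leq hc lt0n size_poly_eq0.
exists (d^-1%:P *: H').
by rewrite eF ed -scalerAl -scalerAr scalerA -polyCM mulfV // scale1r.
Qed.

Lemma primitive_neq0 F : primitiveb F -> F != 0.
Proof. by move=> /(_ 0); apply: contra_neq => ->; rewrite rmorph0. Qed.

(** A Bezout relation over the field k(Y); clearing its denominators leaves a nonzero element of
    k[Y] on the right. *)
Lemma coprime_bezout F v : coprimep F v ->
  exists q A B, q != 0 /\ A * F + B * v = q%:P.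
Proof.
rewrite coprimep_def => /size_poly1P[d d0 ed].
have [[A B] /= /Pdiv.Idomain.eqpP[[c1 c2] /= /andP[h1 h2]]] :=
  Pdiv.Idomain.Bezoutp F v.
rewrite ed => e; exists (c2 * d), (c1 *: A), (c1 *: B).
split; first exact: mulf_neq0.
by rewrite -!scalerAl -scalerDr e -mul_polyC polyCM.
Qed.

(** The three cases are those of the gcd of [F] and [v] over k(Y): a unit, [F] up to a unit, or a
    proper factor of [F]. Gauss' lemma removes the denominators. *)
Lemma primitive_trichotomy F v : primitiveb F ->
  [\/ exists q A B, q != 0 /\ A * F + B * v = q%:P,
      exists u, v = F * u
    | exists G H, [/\ F = G * H, (size G < size F)%N & (size H < size F)%N]].
Proof.
move=> pF; have F0 := primitive_neq0 pF.
have [|] := boolP (coprimep F v); first by move=> /coprime_bezout; constructor 1.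
rewrite coprimep_def => hs.
have /Pdiv.Idomain.dvdpP[[c H0] /= c0] := Pdiv.Idomain.dvdp_gcdl F v.
rewrite mulrC => e.
have [G [H [c1 [c2 [c10 c20 eG eH eF]]]]] := gauss_factor c0 e.
have G0 : G != 0 by apply: contra_neq F0 => z; rewrite eF z mul0r.
have H0' : H != 0 by apply: contra_neq F0 => z; rewrite eF z mulr0.
have sG : (1 < size G)%N.
  have : size G != 1%N by rewrite -(size_scalep _ c10) -eG.
  by have := size_poly_eq0 G; rewrite (negbTE G0); case: (size G) => [|[|]].
have sF : size F = (size G + size H).-1 by rewrite eF size_mul.
have [hH|hH] := leqP (size H) 1; last first.
  have aux a b : (1 < a -> 1 < b -> (a < (a + b).-1) /\ (b < (a + b).-1))%N by lia.
  by have [? ?] := aux _ _ sG hH; constructor 3; exists G, H; rewrite sF.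
have /size_poly1P[d d0 ed] : size H == 1%N.
  by rewrite eqn_leq hH lt0n size_poly_eq0.
constructor 2.
have /Pdiv.Idomain.dvdpP[[c' w] /= c'0 ew] := Pdiv.Idomain.dvdp_gcdr F v.
apply: (@primitive_dvd (d * c') F v (c1 *: w)) => //; first exact: mulf_neq0.
by rewrite -scalerA ew eG eF ed -!mul_polyC; ring.
Qed.

Definition zerob F : set (k * k) := [set z | evb F z.1 z.2 = 0].

Lemma zerobM F G : zerob (F * G) = zerob F `|` zerob G.
Proof.
apply/seteqP; split=> z; rewrite /zerob /= evbM.
  by move=> /eqP; rewrite mulf_eq0 => /orP[] /eqP; [left|right].
by move=> [] ->; rewrite ?mul0r ?mulr0.
Qed.

Lemma finite_vertical F q : primitiveb F -> q != 0 ->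
  finite_set (zerob F `&` [set z | q.[z.2] = 0]).
Proof.
move=> pF q0.
have h : finite_set (\bigcup_(y in [set y | q.[y] = 0])
    ((fun x => (x, y)) @` [set x | (spec y F).[x] = 0])).
  apply: bigcup_finite => [|y _]; first exact: finite_roots.
  by apply: finite_image; apply: finite_roots.
by apply: sub_finite_set h => -[x y] [/= h1 h2]; exists y => //; exists x.
Qed.

Lemma infinite_zerob F : (1 < size F)%N -> infinite_set (zerob F).
Proof.
move=> sF hfin; have F0 : lead_coef F != 0.
  by rewrite lead_coef_eq0 -size_poly_gt0; apply: leq_trans sF.
have := finite_image snd hfin.
have : infinite_set ([set: k] `\` [set y | (lead_coef F).[y] = 0]).
  by apply: infinite_setD; [exact: infinite_closed_field|exact: finite_roots].
apply: contra_not; apply: sub_finite_set => y [_ /= hy].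
have [|x hx] := @closed_root _ (spec y F); last by exists (x, y).
suff -> : size (spec y F) = size F by [].
by rewrite size_poly_eq //; apply/eqP.
Qed.

(** Irreducibility and dimension one of a plane curve, expressed through its points only. *)
Definition minimal_curve (B : set (k * k)) : Prop :=
  infinite_set B /\
  forall v, B `<=` zerob v \/ finite_set (B `&` zerob v).

Lemma line_minimal a : minimal_curve (zerob ('X - a%:P)%:P).
Proof.
have ha x y : evb ('X - a%:P)%:P x y = 0 <-> y = a.
  rewrite evbC hornerXsubC; split=> [/eqP|->]; last by rewrite subrr.
  by rewrite subr_eq0 => /eqP.
split.
  move=> /(finite_image fst); apply: contra_not (@infinite_closed_field k) => h.
  by apply: sub_finite_set h => x _; exists (x, a); rewrite //= /zerob /= ha.
move=> v; have [e|ne] := eqVneq (spec a v) 0.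
  by left=> -[x y]; rewrite /zerob /= ha => ->; rewrite /evb e horner0.
right; have h := finite_image (fun x => (x, a)) (finite_roots ne).
apply: sub_finite_set h => -[x y] /=; rewrite /zerob /= ha => -[-> hx].
by exists x.
Qed.

(** Induction on the degree in X. If the primitive part is not minimal, a polynomial [v] witnessing
    this excludes the first two cases of [primitive_trichotomy], so that a proper factorisation
    remains. The content contributes the lines on which Y is constant. *)
Lemma curve_decomposition F : F != 0 ->
  exists s : seq {poly {poly k}},
    (forall P, P \in s -> minimal_curve (zerob P)) /\
    (forall z, zerob F z <-> exists2 P, P \in s & zerob P z).
Proof.
have [n] := ubnP (size F); elim: n F => // n IH F hn F0.
have [c [F1 [c0 pF1 eF]]] := content_primitive F0.
have s1 : size F1 = size F by rewrite eF size_scalep.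
have [s2 [h1 h2]] : exists s : seq {poly {poly k}},
    (forall P, P \in s -> minimal_curve (zerob P)) /\
    (forall z, zerob F1 z <-> exists2 P, P \in s & zerob P z).
  have [hs|hs] := leqP (size F1) 1.
    have /size_poly1P[d d0 ed] : size F1 == 1%N.
      by rewrite eqn_leq hs lt0n size_poly_eq0 primitive_neq0.
    exists [::]; split=> // z; split=> [|[]//].
    rewrite /zerob /= ed evbC => h; have := pF1 z.2.
    by rewrite ed specC h eqxx.
  have [hv|] := pselect (forall v, zerob F1 `<=` zerob v \/
                           finite_set (zerob F1 `&` zerob v)).
    exists [:: F1]; split=> [P|z].
      rewrite inE => /eqP ->; split=> //; exact: infinite_zerob.
    by split=> [h|[P]]; [exists F1; rewrite ?inE|rewrite inE => /eqP ->].
  move=> /existsNP[v /not_orP[nv nf]].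
  have [[q [A [B [q0 e]]]]|[u e]|[G [H [eG sG sH]]]] :=
    primitive_trichotomy v pF1.
  - case: nf; apply: sub_finite_set (finite_vertical pF1 q0) => z [z1 z2].
    split=> //=; rewrite -(evbC q z.1) -e evbD !evbM.
    by rewrite (z1 : _ = 0) (z2 : _ = 0) !mulr0 addr0.
  - by case: nv => z h; rewrite /zerob /= e evbM (h : _ = 0) mul0r.
  have G0 : G != 0.
    by apply: contra_neq (primitive_neq0 pF1) => z; rewrite eG z mul0r.
  have H0 : H != 0.
    by apply: contra_neq (primitive_neq0 pF1) => z; rewrite eG z mulr0.
  have [|sg [g1 g2]] := IH G _ G0; first by rewrite -s1 in hn; lia.
  have [|sh [k1 k2]] := IH H _ H0; first by rewrite -s1 in hn; lia.
  exists (sg ++ sh); split=> [P|z].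
    by rewrite mem_cat => /orP[/g1|/k1].
  rewrite eG zerobM; split.
    by move=> [/g2[P hP h]|/k2[P hP h]]; exists P; rewrite // mem_cat hP ?orbT.
  move=> [P]; rewrite mem_cat => /orP[] hP h; [left; apply/g2|right; apply/k2];
    by exists P.
have [rs hc] := closed_field_poly_normal c.
exists ([seq ('X - a%:P)%:P | a <- rs] ++ s2); split=> [P|z].
  by rewrite mem_cat => /orP[/mapP[a _ ->]|/h1//]; exact: line_minimal.
rewrite {1}/zerob /= eF evbZ; split.
  move=> /eqP; rewrite mulf_eq0 => /orP[|/eqP/h2[P hP h]]; last first.
    by exists P; rewrite // mem_cat hP orbT.
  rewrite hc hornerZ mulf_eq0 lead_coef_eq0 (negbTE c0) /= => h.
  exists ('X - z.2%:P)%:P.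
    rewrite mem_cat; apply/orP; left; apply/mapP; exists z.2 => //.
    by rewrite -root_prod_XsubC.
  by rewrite /zerob /= evbC hornerXsubC subrr.
move=> [P]; rewrite mem_cat => /orP[/mapP[a ha ->]|hP h].
  rewrite /zerob /= evbC hornerXsubC => /eqP; rewrite subr_eq0 => /eqP h.
  suff -> : c.[z.2] = 0 by rewrite mul0r.
  apply/eqP; rewrite hc hornerZ mulf_eq0; apply/orP; right.
  by rewrite -/(root _ _) root_prod_XsubC h.
by have /h2 e : exists2 P, P \in s2 & zerob P z by [exists P];
  rewrite (e : _ = 0) mulr0.
Qed.

(* A common factor of three polynomials, none of them divisible by X, would
   have infinitely many zeros in the torus. *)
Lemma bezout_three F A B : ~ (exists u, F = 'X * u) ->
  (forall x y, x != 0 -> y != 0 ->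
     ~ [/\ evb F x y = 0, evb A x y = 0 & evb B x y = 0]) ->
  exists q a b e, q != 0 /\ a * F + b * A + e * B = q%:P.
Proof.
move=> nX nz.
have F0 : F != 0.
  by apply/eqP => e; apply: nX; exists 0; rewrite e mulr0.
set g := gcdp A B; set G := gcdp F g.
have [hs|hs] := eqVneq (size G) 1%N.
  have [|q [a [b [q0 e]]]] := @coprime_bezout F g; first by rewrite coprimep_def hs.
  have [[u1 u2] /= /Pdiv.Idomain.eqpP[[c1 c2] /= /andP[h1 h2] e']] :=
    Pdiv.Idomain.Bezoutp A B.
  exists (c2 * q), (c2 *: a), (b * (c1 *: u1)), (b * (c1 *: u2)).
  split; first exact: mulf_neq0.
  rewrite -addrA -!mulrA -mulrDr -!scalerAl -scalerDr e' -/g.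
  by rewrite -scalerAr -scalerDr e -mul_polyC polyCM.
have G0 : G != 0 by rewrite gcdp_eq0 negb_and F0.
have [c [G1 [c0 pG1 eG]]] := content_primitive G0.
have sG1 : (1 < size G1)%N.
  have := size_poly_eq0 G; rewrite (negbTE G0) eG size_scalep //.
  by move: hs; rewrite eG size_scalep //; case: (size G1) => [|[|]].
have dv v : G %| v -> exists u, v = G1 * u.
  move=> /Pdiv.Idomain.dvdpP[[d w] /= d0 ew].
  apply: (@primitive_dvd d G1 v (c *: w)) => //.
  by rewrite ew eG -!mul_polyC; ring.
have [uF eF] := dv _ (Pdiv.Idomain.dvdp_gcdl F g).
have [uA eA] : exists u, A = G1 * u.
  apply: dv; have := Pdiv.Idomain.dvdp_gcdl A B.
  by apply: Pdiv.Idomain.dvdp_trans; apply: Pdiv.Idomain.dvdp_gcdr.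
have [uB eB] : exists u, B = G1 * u.
  apply: dv; have := Pdiv.Idomain.dvdp_gcdr A B.
  by apply: Pdiv.Idomain.dvdp_trans; apply: Pdiv.Idomain.dvdp_gcdr.
exfalso; apply: nX.
(* By assumption a zero of [G1] with y nonzero has x = 0. So the constant term in X vanishes at all
   but finitely many y, and X divides [G1], hence [F]. *)
suff e0 : G1`_0 = 0.
  have /factor_theorem[u eu] : root G1 0 by apply/rootP; rewrite horner_coef0.
  by exists (u * uF); rewrite eF eu subr0; ring.
have lG : lead_coef G1 != 0.
  by rewrite lead_coef_eq0 -size_poly_gt0; apply: leq_trans sG1.
apply: (@finite_roots_eq0 _ _ ([set: k] `\`
    ([set y | (lead_coef G1).[y] = 0] `|` [set 0]))).
  apply: infinite_setD; first exact: infinite_closed_field.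
  by rewrite finite_setU; split; [exact: finite_roots|exact: finite_set1].
move=> y [_ /= /not_orP[hy /eqP y0]].
have [|x hx] := @closed_root _ (spec y G1).
  suff -> : size (spec y G1) = size G1 by [].
  by rewrite size_poly_eq //; apply/eqP.
have [x0|x0] := eqVneq x 0; first by move: hx; rewrite x0 horner_coef0 coef_spec.
have z : evb G1 x y = 0 by [].
by case: (nz x y x0 y0); rewrite eF eA eB !evbM z !mul0r.
Qed.

End Bivariate.

Lemma mpoly_ring_ind n (R : nzRingType) (P : {mpoly R[n]} -> Prop) :
  (forall c, P c%:MP) -> (forall i, P 'X_i) ->
  (forall p q, P p -> P q -> P (p + q)) ->
  (forall p q, P p -> P q -> P (p * q)) -> forall p, P p.
Proof.
move=> hC hX hD hM p; rewrite (mpolyE p).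
have hM' (I : Type) (r : seq I) (F : I -> {mpoly R[n]}) :
    (forall i, P (F i)) -> P (\prod_(i <- r) F i).
  by move=> h; elim/big_rec: _ => [|i q _ hq]; [rewrite -mpolyC1|apply: hM].
elim/big_rec: _ => [|m q _ hq]; first by rewrite -mpolyC0; apply: hC.
apply: (hD) => //; rewrite -mul_mpolyC; apply: (hM) => //.
rewrite mpolyXE_id; apply: hM' => i.
by elim: (m i) => [|d IH]; [rewrite expr0 -mpolyC1|rewrite exprS; apply: hM].
Qed.

(** * Functions with a power of a fixed polynomial as denominator *)

Section Denominators.
Variable k : closedFieldType.

(* phi is a regular function on D(b) *)
Definition regular_over n (b : {mpoly k[n]}) (phi : 'rV[k]_n -> k) : Prop :=
  exists (N : nat) (a : {mpoly k[n]}),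
    forall y : 'rV[k]_n, b.@[y 0] != 0 -> phi y * b.@[y 0] ^+ N = a.@[y 0].

Variables (n : nat) (b : {mpoly k[n]}).
Implicit Types phi psi : 'rV[k]_n -> k.

Lemma regular_over_poly (a : {mpoly k[n]}) :
  regular_over b (fun y : 'rV[k]_n => a.@[y 0]).
Proof. by exists 0%N, a => y _; rewrite expr0 mulr1. Qed.

Lemma regular_over_const c : regular_over b (fun=> c).
Proof. by exists 0%N, c%:MP => y _; rewrite expr0 mulr1 mevalC. Qed.

Lemma regular_over_coord i : regular_over b (fun y => y 0 i).
Proof. by exists 0%N, 'X_i => y _; rewrite expr0 mulr1 mevalXU. Qed.

Lemma regular_overD phi psi : regular_over b phi -> regular_over b psi ->
  regular_over b (fun y => phi y + psi y).
Proof.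
move=> [N [a ha]] [M [c hc]]; exists (N + M)%N, (a * b ^+ M + c * b ^+ N).
move=> y hy; rewrite mevalD !mevalM -ha // -hc // !rmorphXn /= exprD.
by ring.
Qed.

Lemma regular_overM phi psi : regular_over b phi -> regular_over b psi ->
  regular_over b (fun y => phi y * psi y).
Proof.
move=> [N [a ha]] [M [c hc]]; exists (N + M)%N, (a * c).
by move=> y hy; rewrite mevalM -ha // -hc // exprD; ring.
Qed.

Lemma regular_overB phi psi : regular_over b phi -> regular_over b psi ->
  regular_over b (fun y => phi y - psi y).
Proof.
move=> hphi hpsi.
have [N [a h]] := regular_overD hphi (regular_overM (regular_over_const (-1)) hpsi).
by exists N, a => y hy; rewrite -h // mulN1r.
Qed.

Lemma eq_regular_over phi psi : (forall y : 'rV[k]_n, b.@[y 0] != 0 -> phi y = psi y) ->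
  regular_over b phi -> regular_over b psi.
Proof. by move=> e [N [a h]]; exists N, a => y hy; rewrite -e // h. Qed.

Lemma regular_overX phi m : regular_over b phi ->
  regular_over b (fun y => phi y ^+ m).
Proof.
move=> h; elim: m => [|m IH]; first exact: regular_over_const.
by apply: eq_regular_over (regular_overM h IH) => y _; rewrite exprS.
Qed.

Lemma regular_over_inv phi (c : {mpoly k[n]}) :
  (forall y : 'rV[k]_n, b.@[y 0] != 0 -> phi y * c.@[y 0] = b.@[y 0]) ->
  regular_over b (fun y => (phi y)^-1).
Proof.
move=> h; exists 1%N, c => y hy; have e := h _ hy.
have p0 : phi y != 0 by apply: contra_neq hy => z; rewrite -e z mul0r.
by rewrite expr1 -e mulKf.
Qed.

Lemma regular_overXz phi (z : int) : regular_over b phi ->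
  regular_over b (fun y => (phi y)^-1) -> regular_over b (fun y => phi y ^ z).
Proof.
move=> h h'; case: z => m; first exact: regular_overX.
apply: eq_regular_over (regular_overX m.+1 h') => y _.
by rewrite NegzE -exprnN exprVn.
Qed.

Lemma regular_over_coordX i (z : int) : 0 <= z ->
  regular_over b (fun y => y 0 i ^ z).
Proof. by case: z => // z _; apply: regular_overX; apply: regular_over_coord. Qed.

Lemma regular_over_prod (I : Type) (r : seq I) (F : I -> 'rV[k]_n -> k) :
  (forall i, regular_over b (F i)) ->
  regular_over b (fun y => \prod_(i <- r) F i y).
Proof.
move=> h; elim: r => [|i r IH].
  by apply: eq_regular_over (regular_over_const 1) => y _; rewrite big_nil.
by apply: eq_regular_over (regular_overM (h i) IH) => y _; rewrite big_cons.
Qed.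

Lemma regular_over_comp m (h : {mpoly k[m]}) (F : 'I_m -> 'rV[k]_n -> k) :
  (forall i, regular_over b (F i)) ->
  regular_over b (fun y => h.@[fun i => F i y]).
Proof.
move=> hF; elim/mpoly_ring_ind: h => [c|i|p q hp hq|p q hp hq].
- by apply: eq_regular_over (regular_over_const c) => y _; rewrite mevalC.
- by apply: eq_regular_over (hF i) => y _; rewrite mevalXU.
- by apply: eq_regular_over (regular_overD hp hq) => y _; rewrite mevalD.
- by apply: eq_regular_over (regular_overM hp hq) => y _; rewrite mevalM.
Qed.

End Denominators.

Lemma regular_over_coordXz (k : closedFieldType) n (i : 'I_n) (z : int) :
  regular_over ('X_i : {mpoly k[n]}) (fun y => y 0 i ^ z).
Proof.
apply: regular_overXz; first exact: regular_over_coord.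
by apply: (@regular_over_inv _ _ _ _ 1) => y _; rewrite meval1 mulr1 mevalXU.
Qed.

(** The shape of the entries of (X, Y) bullet M_beta: since beta has nonnegative entries, only X has
    to be inverted. *)
Lemma regular_over_coord2 (k : closedFieldType) n (i j : 'I_n) (z w : int) :
  0 <= w ->
  regular_over ('X_i : {mpoly k[n]}) (fun y => y 0 i ^ z * y 0 j ^ w).
Proof.
by move=> w0; apply: regular_overM (regular_over_coordX _ _ w0);
  exact: regular_over_coordXz.
Qed.

(** * Glueing of affine pieces *)

Section Zariski.
Variable k : closedFieldType.

(** A finite intersection of principal opens is principal, given by the product, so the subbase
    defining the topology is a basis. *)
Lemma zar_openP n (Z : set 'rV[k]_n) (U : set (zar Z)) :
  open U <-> (forall x, U x -> exists e : {mpoly k[n]},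
    e.@[(\val x) 0] != 0 /\ forall y : zar Z, e.@[(\val y) 0] != 0 -> U y).
Proof.
pose B e := [set x : zar Z | e.@[(\val x) 0] != 0].
split=> [[D' hD' <-] x [A hA Ax]|h].
  have [fs hfs eA] := hD' _ hA.
  have key (s : seq (set (zar Z))) : (forall j, j \in s -> range B j) ->
      exists e, forall y, B e y <-> forall j, j \in s -> j y.
    elim: s => [|i s IH] hs.
      by exists 1 => y; rewrite /B /= meval1 oner_neq0.
    have [|e he] := IH; first by move=> j hj; apply: hs; rewrite inE hj orbT.
    have [d _ hd] := hs i (mem_head _ _).
    exists (d * e) => y; rewrite /B /= mevalM mulf_eq0 negb_or; split.
      move=> /andP[h1 h2] j; rewrite inE => /orP[/eqP ->|hj]; first by rewrite -hd.
      exact: (he y).1 h2 j hj.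
    move=> H; apply/andP; split.
      by have := H i (mem_head _ _); rewrite -hd.
    by apply: (he y).2 => j hj; apply: H; rewrite inE hj orbT.
  have [|e he'] := key fs; first by move=> j hj; apply/set_mem/hfs.
  have he : A = B e.
    by rewrite -eA; apply/seteqP; split=> y; [move=> h; apply/he'|move/he'].
  exists e; split; first by have := Ax; rewrite he.
  by move=> y hy; exists A => //; rewrite he.
have H x : exists e, U x -> e.@[(\val x) 0] != 0 /\ B e `<=` U.
  have [/h[e he]|nU] := pselect (U x); last by exists 0.
  by exists e.
have [E hE] := choice H.
have -> : U = \bigcup_(x in U) B (E x).
  apply/seteqP; split=> y; first by move=> Uy; exists y => //; case: (hE y Uy).
  by move=> [x Ux]; case: (hE x Ux) => _; apply.
apply: bigcup_open => x _; exists [set B (E x)].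
  move=> _ ->; exists [fset B (E x)]%fset.
    by move=> j; rewrite in_fset1 => /eqP ->; apply/mem_set; exists (E x).
  apply/seteqP; split=> y h'; first by apply: (h' (B (E x))); rewrite /= in_fset1.
  by move=> j; rewrite /= in_fset1 => /eqP ->.
by rewrite bigcup_set1.
Qed.

Lemma zar_open_basic n (Z : set 'rV[k]_n) (e : {mpoly k[n]}) :
  open [set x : zar Z | e.@[(\val x) 0] != 0].
Proof. by apply/zar_openP => x hx; exists e. Qed.

(* The properties of a piece that are used in the glueing.  Regular functions
   separate points; together with the last clause this makes a morphism
   determined by its values outside of a finite set. *)
Record sheaf_like (X : kspace k) : Prop := SheafLike {
  reg_sub : forall (U V : set X) h, V `<=` U -> reg U h -> reg V h;
  reg_ext : forall (U : set X) h h', (forall x, U x -> h x = h' x) ->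
    reg U h -> reg U h';
  reg_loc : forall (U : set X) h,
    (forall x, U x -> exists V, [/\ open V, V x, V `<=` U & reg V h]) ->
    reg U h;
  reg_opp : forall (U : set X) h g, reg U h -> reg U g ->
    reg U (fun x => h x - g x);
  reg_open : forall (U : set X) h, open U -> reg U h ->
    open (U `&` [set x | h x != 0]);
  reg_sep : forall x y : X, x <> y -> exists h, reg setT h /\ h x <> h y;
  reg_const : forall (U : set X) c, reg U (fun=> c) }.

Lemma zspace_sheaf_like n (Z : set 'rV[k]_n) : sheaf_like (zspace Z).
Proof.
split.
- move=> U V h VU hU x /VU/hU[a [b [b0 e]]]; exists a, b; split=> // y /VU.
  exact: e.
- move=> U h h' e hU x Ux; have [a [b [b0 ab]]] := hU x Ux; exists a, b.
  by split=> // y Uy hy; rewrite -e // ab.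
- move=> U h H x Ux; have [V [oV Vx VU hV]] := H x Ux.
  have [a [b [b0 ab]]] := hV x Vx.
  have [e [e0 eV]] := (zar_openP V).1 oV x Vx.
  (* Expanding the fraction by [e] confines its domain to [V], where it represents [h]. *)
  exists (a * e), (b * e); split; first by rewrite mevalM mulf_neq0.
  move=> y Uy; rewrite !mevalM mulf_eq0 negb_or => /andP[by0 ey0].
  by rewrite ab //; [rewrite -mulf_div divff // mulr1|apply: eV].
- move=> U h g hU gU x Ux.
  have [a [b [b0 ab]]] := hU x Ux; have [c [d [d0 cd]]] := gU x Ux.
  exists (a * d - c * b), (b * d); split; first by rewrite mevalM mulf_neq0.
  move=> y Uy; rewrite mevalB !mevalM mulf_eq0 negb_or => /andP[by0 dy0].
  by rewrite ab // cd // -mulNr addf_div // mulNr.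
- move=> U h oU hU; apply/zar_openP => x [Ux /= hx].
  have [a [b [b0 ab]]] := hU x Ux.
  have [e [e0 eU]] := (zar_openP U).1 oU x Ux.
  exists (a * b * e); split.
    rewrite !mevalM !mulf_neq0 //; apply: contra_neq hx => z.
    by rewrite ab // z mul0r.
  move=> y; rewrite !mevalM !mulf_eq0 !negb_or -andbA => /and3P[ay0 by0 ey0].
  by split; [apply: eU|rewrite /= ab ?mulf_neq0 ?invr_eq0 //; apply: eU].
- move=> x y nxy; apply: contrapT => H; apply: nxy; apply: val_inj.
  apply/rowP => i; apply: contrapT => nxy; apply: H.
  exists (fun z : zspace Z => (\val (z : zar Z) : 'rV[k]_n) 0 i).
  split=> // z _.
  exists 'X_i, 1; rewrite meval1 oner_neq0; split=> // w _ _.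
  by rewrite meval1 mevalXU divr1.
- move=> U c x _; exists c%:MP, 1; rewrite meval1 oner_neq0.
  by split=> // y _ _; rewrite mevalC meval1 divr1.
Qed.

Lemma sub_morphism_on (X Y : kspace k) (U V : set X) (phi : X -> Y) :
  sheaf_like X -> open V -> V `<=` U -> morphism_on U phi -> morphism_on V phi.
Proof.
move=> sX oV VU mphi W oW; have [oUW rUW] := mphi W oW.
have e : V `&` phi @^-1` W = V `&` (U `&` phi @^-1` W).
  by rewrite setIA (setIidl VU).
split; first by rewrite e; apply: openI.
move=> h /rUW; apply: (reg_sub sX); rewrite e; exact: subIsetr.
Qed.

Lemma comp_morphism_on (X Y T : kspace k) (U : set X) (V : set Y)
    (phi : X -> Y) (psi : Y -> T) :
  morphism_on U phi -> morphism_on V psi ->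
  morphism_on (U `&` phi @^-1` V) (psi \o phi).
Proof.
move=> mphi mpsi W oW; have [o1 r1] := mpsi W oW; have [o2 r2] := mphi _ o1.
have -> : U `&` phi @^-1` V `&` (psi \o phi) @^-1` W =
          U `&` phi @^-1` (V `&` psi @^-1` W).
  by rewrite preimage_setI setIA.
by split=> // h /r1/r2.
Qed.

Lemma id_morphism_on (X : kspace k) (U : set X) :
  sheaf_like X -> open U -> morphism_on U (id : X -> X).
Proof.
move=> sX oU W oW; split; first exact: openI.
move=> h; apply: (reg_sub sX); exact: subIsetr.
Qed.

(** Substituting the components into a polynomial gives again a fraction with a power of [b] as
    denominator. As [b] has no zero on [U], fractions pull back to fractions and principal opens to
    opens. *)
Lemma morphism_on_zspace m n (Z : set 'rV[k]_m) (Z' : set 'rV[k]_n)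
    (U : set (zspace Z)) (phi : zspace Z -> zspace Z') (b : {mpoly k[m]})
    (F : 'I_n -> 'rV[k]_m -> k) :
  open U -> (forall i, regular_over b (F i)) ->
  (forall x : zspace Z, U x -> b.@[(\val x) 0] != 0) ->
  (forall x i, U x -> (\val (phi x)) 0 i = F i (\val x)) ->
  morphism_on U phi.
Proof.
move=> oU hF hb hphi.
have key (h : {mpoly k[n]}) : exists (N : nat) (a : {mpoly k[m]}),
    forall x, U x -> h.@[(\val (phi x)) 0] * b.@[(\val x) 0] ^+ N = a.@[(\val x) 0].
  have [N [a ha]] := regular_over_comp h hF.
  exists N, a => x Ux; rewrite -ha ?hb //; congr (_ * _).
  by apply: meval_eq => i; rewrite hphi.
move=> W oW; split.
  apply/zar_openP => x [Ux /= Wx].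
  have [e [e0 eW]] := (zar_openP W).1 oW _ Wx.
  have [d [d0 dU]] := (zar_openP U).1 oU _ Ux.
  have [N [a ha]] := key e.
  exists (a * d); split.
    by rewrite mevalM mulf_neq0 // -ha // mulf_neq0 // expf_neq0 // hb.
  move=> y; rewrite mevalM mulf_eq0 negb_or => /andP[ay0 dy0].
  have Uy := dU y dy0; split=> //=; apply: eW.
  by apply: contra_neq ay0 => z; rewrite -ha // z mul0r.
move=> h hW x [Ux /= Wx]; have [p [q [q0 pq]]] := hW _ Wx.
have [N [a ha]] := key p; have [M [c hc]] := key q.
exists (a * b ^+ M), (c * b ^+ N); rewrite mevalM rmorphXn /=; split.
  by rewrite mulf_neq0 ?expf_neq0 ?hb // -hc // mulf_neq0 // expf_neq0 // hb.
move=> y [Uy Wy]; rewrite !mevalM !rmorphXn /= => nz.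
have qy0 : q.@[(\val (phi y)) 0] != 0.
  by apply: contra_neq nz => z; rewrite -hc // z !mul0r.
rewrite pq // -ha // -hc //.
have : b.@[(\val y) 0] != 0 by exact: hb.
by move: (b.@[_]) qy0 => z h1 h2; field; rewrite h1 !expf_neq0.
Qed.

Lemma open_immersion_of_inverse (X Y : kspace k) (U : set X) (V : set Y)
    (phi : X -> Y) (psi : Y -> X) :
  sheaf_like X -> sheaf_like Y -> open U -> open V ->
  morphism_on U phi -> morphism_on V psi ->
  (forall x, U x -> V (phi x) /\ psi (phi x) = x) ->
  (forall y, V y -> U (psi y) /\ phi (psi y) = y) ->
  open_immersion_on U phi.
Proof.
move=> sX sY oU oV mphi mpsi UV VU; split=> //.
  by move=> x y Ux Uy e; rewrite -(UV x Ux).2 -(UV y Uy).2 e.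
move=> W oW WU; have [o1 r1] := mpsi W oW.
have e : phi @` W = V `&` psi @^-1` W.
  apply/seteqP; split=> [_ [x Wx <-]|y [Vy Wy]].
    by have [? e] := UV x (WU x Wx); split; rewrite //= e.
  by exists (psi y); rewrite // (VU y Vy).2.
rewrite e; split=> // h /r1; apply: (reg_ext sY) => y [Vy Wy] /=.
by rewrite (VU y Vy).2.
Qed.

Lemma sub_open_immersion_on (X Y : kspace k) (U V : set X) (phi : X -> Y) :
  sheaf_like X -> open V -> V `<=` U ->
  open_immersion_on U phi -> open_immersion_on V phi.
Proof.
move=> sX oV VU [oU mphi iphi ophi]; split=> //.
- exact: sub_morphism_on mphi.
- by move=> x y /VU Ux /VU Uy; apply: iphi.
- by move=> W oW WV; apply: ophi => // x /WV/VU.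
Qed.

Lemma open_immersion_inverse (X Y : kspace k) (U : set X) (phi : X -> Y)
    (psi : Y -> X) : sheaf_like X ->
  open_immersion_on U phi -> (forall x, U x -> psi (phi x) = x) ->
  morphism_on (phi @` U) psi.
Proof.
move=> sX [oU mphi iphi ophi] psiK W oW.
have e : phi @` U `&` psi @^-1` W = phi @` (U `&` W).
  apply/seteqP; split=> [_ [[x Ux <-] /= Wx]|_ [x [Ux Wx] <-]].
    by exists x; rewrite // -{2}(psiK x).
  by split; [exists x|rewrite /= psiK].
have [h1 h2] := ophi (U `&` W) (openI oU oW) (@subIsetl _ _ _).
rewrite e; split=> // h hW; apply: h2; apply: (reg_ext sX) (_ : reg _ h).
  by move=> x [Ux Wx] /=; rewrite psiK.
by apply: (reg_sub sX) hW; exact: subIsetr.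
Qed.

Lemma comp_open_immersion_on (X Y T : kspace k) (U : set X) (V : set Y)
    (phi : X -> Y) (psi : Y -> T) : sheaf_like X ->
  open_immersion_on U phi -> open_immersion_on V psi ->
  open_immersion_on (U `&` phi @^-1` V) (psi \o phi).
Proof.
move=> sX [oU mphi iphi ophi] [oV mpsi ipsi opsi].
have [oUV _] := mphi V oV.
split=> //; first exact: comp_morphism_on.
  move=> x y [Ux Vx] [Uy Vy] /= e; apply: iphi => //; exact: ipsi.
move=> W oW WUV.
have WU : W `<=` U by move=> x /WUV[].
have WV : phi @` W `<=` V by move=> _ [x /WUV[_ Vx] <-].
have [o1 r1] := ophi W oW WU; have [o2 r2] := opsi _ o1 WV.
rewrite image_comp in o2 r2; split=> // h hW.
by rewrite -image_comp; rewrite -image_comp in r2; apply: r2; apply: r1.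
Qed.

End Zariski.

(** * The glueing relation between the pieces *)

Section Glueing.
Variables (k : closedFieldType) (f : laurent k 2) (Sigma : set (chart k)).

Lemma left_inverse_on (A B : Type) (U : set A) (phi : A -> B) (x0 : A) :
  (forall x y, U x -> U y -> phi x = phi y -> x = y) ->
  exists psi : B -> A, forall x, U x -> psi (phi x) = x.
Proof.
move=> inj; have H y : exists x, (exists2 x, U x & phi x = y) ->
    U x /\ phi x = y.
  have [[x Ux e]|n] := pselect (exists2 x, U x & phi x = y); first by exists x.
  by exists x0.
have [psi hpsi] := choice H.
exists psi => x Ux; have [|h1 h2] := hpsi (phi x); first by exists x.
exact: inj.
Qed.

Lemma sheaf_like_T1 (X : kspace k) (x0 : X) : sheaf_like X ->
  open [set x : X | x <> x0].
Proof.
move=> sX.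
have H x : x <> x0 -> exists h, reg [set: X] h /\ h x <> h x0.
  by move=> /(reg_sep sX).
rewrite (_ : [set x | x <> x0] = \bigcup_(h in [set h : X -> k | reg setT h])
   (setT `&` [set x | h x - h x0 != 0])).
  apply: bigcup_open => h hr; apply: (reg_open sX (h := fun x => h x - h x0)).
    exact: openT.
  by apply: (reg_opp sX) hr _; apply: (reg_const sX).
apply/seteqP; split=> x.
  move=> /= /H[h [hr hx]]; exists h => //; split=> //=.
  by rewrite subr_eq0; apply/eqP.
by move=> [h _ [_ /=]]; rewrite subr_eq0 => /eqP nh e; apply: nh; rewrite e.
Qed.

Definition has_infinite_opens (X : topologicalType) : Prop :=
  forall U : set X, open U -> U !=set0 -> infinite_set U.

(** If [phi] and [psi] differ at [x], a regular function [h] separates the two values. The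
    difference of its pullbacks is then nonzero on a nonempty open set contained in the finite
    exceptional set, whereas nonempty opens are infinite. *)
Lemma identity_principle (X Y : kspace k) (V : set X) (phi psi : X -> Y) :
  sheaf_like X -> sheaf_like Y -> has_infinite_opens X -> open V ->
  morphism_on V phi -> morphism_on V psi ->
  finite_set (V `&` [set x | phi x <> psi x]) ->
  forall x, V x -> phi x = psi x.
Proof.
move=> sX sY iX oV mphi mpsi hfin x Vx; apply: contrapT => /(reg_sep sY)[h [hr hx]].
have r1 := (mphi setT openT).2 h hr; have r2 := (mpsi setT openT).2 h hr.
rewrite !preimage_setT setIT in r1 r2.
apply: (iX _ (reg_open sX oV (reg_opp sX r1 r2))).
  by exists x; split; rewrite //= subr_eq0; apply/eqP.
apply: sub_finite_set hfin => y [Vy /= hy]; split=> //= e; move: hy.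
by rewrite e subrr eqxx.
Qed.

(* U is C_(0,a), and iota its inclusion in C_a. *)
Record atlas : Prop := Atlas {
  atlas_sheaf : forall a, index0 Sigma a -> sheaf_like (space0 f a);
  atlas_inf : forall a, index0 Sigma a -> has_infinite_opens (space0 f a);
  atlas_chart : forall a, index0 Sigma a ->
    exists (U : set (C0 f)) (iota : C0 f -> space0 f a),
    [/\ finite_set (~` U), open_immersion_on U iota,
        finite_set (~` (iota @` U))
      & forall q x, marks q x <->
          exists p : C0 f, [/\ U p, \val (p : zar (C0_set f)) = q & iota p = x]] }.

Hypothesis at_ : atlas.
Implicit Types a b c : option (chart k).

Let None_in : index0 Sigma None.
Proof. by left. Qed.

Lemma marks_functional a q q' (x : space0 f a) : index0 Sigma a ->
  marks q x -> marks q' x -> q = q'.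
Proof.
move=> ha; have [U [iota [_ [_ _ inj _] _ hm]]] := atlas_chart at_ ha.
by move=> /hm[p [Up <- <-]] /hm[p' [Up' <- e]]; rewrite (inj p p').
Qed.

Definition overlap a b : set (space0 f a) :=
  [set x | exists q (y : space0 f b), marks q x /\ marks q y].

Lemma finite_overlapC a b : index0 Sigma a -> index0 Sigma b ->
  finite_set (~` (@overlap a b)).
Proof.
move=> ha hb; have [U [iota [fU _ fI hm]]] := atlas_chart at_ ha.
have [U' [iota' [fU' _ fI' hm']]] := atlas_chart at_ hb.
have : finite_set (~` (iota @` U) `|` iota @` (~` U')).
  by rewrite finite_setU; split=> //; apply: finite_image.
apply: sub_finite_set => x nx.
have [[p Up e]|] := pselect ((iota @` U) x); last by left.
right; exists p => // U'p; apply: nx; exists (\val (p : zar (C0_set f))), (iota' p).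
by split; [apply/hm; exists p|apply/hm'; exists p].
Qed.

(** On the overlap s_(ab) is the inverse of the open immersion [iota] of C_(0,a), followed by the
    inclusion [iota'] of C_(0,b). *)
Lemma overlap_immersion a b (x : space0 f a) : index0 Sigma a ->
  index0 Sigma b -> overlap b x ->
  exists phi : space0 f a -> space0 f b,
    open_immersion_on (@overlap a b) phi /\ extends_s (@overlap a b) phi.
Proof.
move=> ha hb [q0 [y0 [mx my]]].
have [U [iota [fU oi fI hm]]] := atlas_chart at_ ha.
have [U' [iota' [fU' oi' fI' hm']]] := atlas_chart at_ hb.
have [p0 [Up0 ep0 _]] := (hm _ _).1 mx.
have sa := atlas_sheaf at_ ha; have s0 := atlas_sheaf at_ None_in.
have [oU miota inj opn] := oi.
have [psi hpsi] := left_inverse_on p0 inj.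
have opsi : open_immersion_on (iota @` U) psi.
  apply: (open_immersion_of_inverse sa s0 (V := U) (psi := iota)) => //.
  - by have [] := opn U oU (fun _ h => h).
  - exact: open_immersion_inverse hpsi.
  - by move=> _ [p Up <-]; rewrite hpsi.
  - by move=> p Up; rewrite hpsi //; split=> //; exists p.
have e : @overlap a b = iota @` U `&` psi @^-1` U'.
  apply/seteqP; split=> z.
    move=> [q [y [/hm[p [Up ep <-]] /hm'[p' [Up' ep' _]]]]].
    split; first by exists p.
    rewrite /= hpsi //; suff -> : p = p' by [].
    by apply: val_inj; rewrite ep ep'.
  move=> [[p Up <-]]; rewrite /= hpsi // => U'p.
  exists (\val (p : zar (C0_set f))), (iota' p).
  by split; [apply/hm; exists p|apply/hm'; exists p].
exists (iota' \o psi); split.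
  by rewrite e; apply: (comp_open_immersion_on sa opsi oi').
move=> q z y _ /hm[p [Up ep <-]] /hm'[p' [Up' ep' <-]] /=.
rewrite hpsi //; congr iota'.
by apply: val_inj; rewrite ep ep'.
Qed.

Definition agrees a b (phi : space0 f a -> space0 f b) : set (space0 f a) :=
  [set x | exists q, marks q x /\ marks q (phi x)].

(** Inverses and composites of glueing maps visibly agree with s_(ab) only outside a finite set.
    Comparison with the map of [overlap_immersion] by the identity principle removes the
    exceptions. *)
Lemma extends_of_cofinite a b (V : set (space0 f a)) phi :
  index0 Sigma a -> index0 Sigma b -> open V -> morphism_on V phi ->
  finite_set (V `\` @agrees a b phi) -> extends_s V phi.
Proof.
move=> ha hb oV mphi hfin q x y Vx mx my.
have Ox : overlap b x by exists q, y.
have [sg [[oO msg _ _] ext]] := overlap_immersion ha hb Ox.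
have <- : sg x = y by apply: ext mx my.
have sa := atlas_sheaf at_ ha; have sb := atlas_sheaf at_ hb.
have oVO : open (V `&` @overlap a b) by apply: openI.
apply: (identity_principle sa sb (atlas_inf at_ ha) oVO) => //.
- by apply: sub_morphism_on mphi => //; exact: subIsetl.
- by apply: sub_morphism_on msg => //; exact: subIsetr.
apply: sub_finite_set hfin => z [[Vz Oz] /= ne]; split=> // -[q' [m1 m2]].
by apply: ne; rewrite (ext q' _ _ Oz m1 m2).
Qed.

Lemma extends_cofinite a b (V : set (space0 f a)) phi :
  index0 Sigma a -> index0 Sigma b -> extends_s V phi ->
  finite_set (V `\` @agrees a b phi).
Proof.
move=> ha hb ext; apply: sub_finite_set (finite_overlapC ha hb) => x [Vx nx].
move=> [q [y [m1 m2]]]; apply: nx; exists q; split=> //.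
by rewrite (ext q x y).
Qed.

(** s_(aa) is the identity on a cofinite set, so by the identity principle each of its extensions is
    the identity: no piece is glued to itself. *)
Lemma glue_same a (x y : space0 f a) : index0 Sigma a -> Defs.glue x y -> x = y.
Proof.
move=> ha [V [phi [[oV mphi _ _] ext Vx <-]]].
have sa := atlas_sheaf at_ ha.
apply/esym; apply: (identity_principle sa sa (atlas_inf at_ ha) oV mphi) Vx.
  exact: id_morphism_on.
apply: sub_finite_set (extends_cofinite ha ha ext) => z [Vz ne]; split=> //.
by move=> [q [m1 m2]]; apply: ne; apply: (ext q z z).
Qed.

Lemma id_open_immersion_on (X : kspace k) : sheaf_like X ->
  open_immersion_on setT (id : X -> X).
Proof.
move=> sX.
by apply: (open_immersion_of_inverse sX sX openT openT (psi := id)) => //;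
  apply: id_morphism_on => //; exact: openT.
Qed.

Lemma glue_refl a (x : space0 f a) : index0 Sigma a -> Defs.glue x x.
Proof.
move=> ha; exists setT, id; split=> //.
  exact: id_open_immersion_on (atlas_sheaf at_ ha).
move=> q z y _; have [U [iota [_ [_ _ inj _] _ hm]]] := atlas_chart at_ ha.
move=> /hm[p [Up e <-]] /hm[p' [Up' e' <-]]; congr iota.
by apply: val_inj; rewrite e e'.
Qed.

Lemma glue_sym a b (x : space0 f a) (y : space0 f b) :
  index0 Sigma a -> index0 Sigma b -> Defs.glue x y -> Defs.glue y x.
Proof.
move=> ha hb [V [phi [oi ext Vx <-]]].
have [oV mphi inj opn] := oi.
have sa := atlas_sheaf at_ ha; have sb := atlas_sheaf at_ hb.
have [psi hpsi] := left_inverse_on x inj.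
have oV' : open (phi @` V) by have [] := opn V oV (fun _ h => h).
have mpsi := open_immersion_inverse sa oi hpsi.
exists (phi @` V), psi; split.
- apply: (open_immersion_of_inverse sb sa (V := V) (psi := phi)) => //.
    by move=> _ [p Up <-]; rewrite hpsi.
  by move=> p Up; rewrite hpsi //; split=> //; exists p.
- apply: extends_of_cofinite => //.
  apply: sub_finite_set (finite_image phi (extends_cofinite ha hb ext)).
  move=> _ [[z Vz <-] nz]; exists z => //; split=> // -[q [m1 m2]].
  by apply: nz; exists q; rewrite hpsi.
- by exists x.
- exact: hpsi.
Qed.

Lemma glue_trans a b c (x : space0 f a) (y : space0 f b) (z : space0 f c) :
  index0 Sigma a -> index0 Sigma b -> index0 Sigma c ->
  Defs.glue x y -> Defs.glue y z -> Defs.glue x z.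
Proof.
move=> ha hb hc [V [phi [oi ext Vx <-]]] [W [psi [oi' ext' Wy <-]]].
have sa := atlas_sheaf at_ ha.
have oi2 := comp_open_immersion_on sa oi oi'.
exists (V `&` phi @^-1` W), (psi \o phi); split=> //.
have [oV2 m2 _ _] := oi2; have [_ _ inj _] := oi.
apply: extends_of_cofinite => //.
have [g hg] := left_inverse_on x inj.
(* The composite can fail to agree with s_(ac) only where [phi] does with s_(ab), or at a point that
   [phi] sends to an exception of [psi]; [g] inverts [phi] on [V]. *)
have : finite_set ((V `\` agrees phi) `|` g @` (W `\` agrees psi)).
  rewrite finite_setU; split; first exact: extends_cofinite.
  by apply: finite_image; apply: extends_cofinite.
apply: sub_finite_set => w [[Vw Ww] nw].
have [[q [q1 q2]]|] := pselect (agrees phi w); last by left.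
right; exists (phi w); last exact: hg.
split=> // -[q' [q1' q2']]; apply: nw; exists q; split=> //.
by rewrite (marks_functional hb q2 q1').
Qed.


End Glueing.

(** * The glued space as a curve *)

Section GluedCurve.
Local Open Scope quotient_scope.
Variables (k : closedFieldType) (f : laurent k 2) (Sigma : set (chart k)).
Hypothesis at_ : atlas f Sigma.
Local Notation X := (glued_curve f Sigma).
Local Notation incl := (@glued_incl k f Sigma).

Lemma index0P (a : index0 Sigma) : index0 Sigma (\val a).
Proof. exact: set_mem (valP a). Qed.

(** The generated equivalence identifies nothing more than [glue] does, because [glue] is already
    reflexive, symmetric and transitive. *)
Lemma glued_inclP (a b : index0 Sigma) (x : space0 f (\val a))
    (y : space0 f (\val b)) :
  incl x = incl y <-> Defs.glue x y.
Proof.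
have clos (u w : pieces f Sigma) :
    clos_refl_sym_trans _ (@glue_step k f Sigma) u w ->
    Defs.glue (projT2 u) (projT2 w).
  elim=> [//|v|v w' _ IH|u' v w' _ IH1 _ IH2].
  - by apply: (glue_refl at_); apply: index0P.
  - by apply: (glue_sym at_) IH; apply: index0P.
  - by apply: (glue_trans at_) IH1 IH2; apply: index0P.
split=> [/eqmodP /= /asboolP /clos //|h].
by apply/eqmodP/asboolP/rst_step.
Qed.

Lemma glued_surj (z : X) : exists (a : index0 Sigma) (x : space0 f (\val a)),
  incl x = z.
Proof.
have e := @reprK _ {eq_quot glue_equiv f Sigma} z.
by case: (repr z) e => a x e; exists a, x.
Qed.

Lemma glued_open (V : set X) :
  open V <-> forall a : index0 Sigma, open ((@incl a) @^-1` V).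
Proof. exact: sigT_openP. Qed.

Lemma glued_incl_inj (a : index0 Sigma) (x y : space0 f (\val a)) :
  incl x = incl y -> x = y.
Proof. by move=> /glued_inclP; apply: (glue_same at_ (index0P a)). Qed.

(** Seen from another piece, the image of an open [U] is covered by the images of glueing maps
    restricted to [U]. These are open, and regularity of a function is checked on this cover. *)
Lemma glued_incl_immersion (a : index0 Sigma) :
  @open_immersion_on k (space0 f (\val a)) X setT (@incl a).
Proof.
have key (U : set (space0 f (\val a))) (b : index0 Sigma) y :
    open U -> (incl (a:=b) @^-1` (@incl a @` U)) y ->
    exists V (phi : space0 f (\val a) -> space0 f (\val b)),
    [/\ open V, V `<=` U, open_immersion_on V phi, (phi @` V) y &
        forall x, V x -> incl (phi x) = incl x].
  move=> oU [x Ux /glued_inclP[V [phi [oi ext Vx e]]]].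
  have [oV _ _ _] := oi.
  exists (V `&` U), phi; split=> //.
  - exact: openI.
  - apply: sub_open_immersion_on oi; first exact: atlas_sheaf (index0P a).
      exact: openI.
    exact: subIsetl.
  - by exists x.
  - move=> z [Vz _]; apply/esym/glued_inclP; exists V, phi.
    by split.
have img (U : set (space0 f (\val a))) : open U -> open (@incl a @` U : set X).
  move=> oU; apply/glued_open => b.
  rewrite (_ : _ @^-1` _ = \bigcup_(W in [set W | open W /\
     W `<=` incl (a:=b) @^-1` (@incl a @` U)]) W).
    by apply: bigcup_open => W [].
  apply/seteqP; split=> y; last by move=> [W [_ sW] /sW].
  move=> /(key _ _ _ oU)[V [phi [oV VU [_ _ _ opn] Vy ephi]]].
  exists (phi @` V) => //; split; first by have [] := opn V oV (fun _ h => h).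
  by move=> _ [x Vx <-]; exists x; [apply: VU|rewrite ephi].
split=> //.
- exact: openT.
- move=> V /glued_open oV; rewrite setTI; split; first exact: oV.
  by move=> h; apply.
- by move=> x y _ _; apply: glued_incl_inj.
- move=> U oU _; split; first exact: img.
  move=> h hU b; have sb := atlas_sheaf at_ (index0P b).
  have sa := atlas_sheaf at_ (index0P a).
  apply: (reg_loc sb) => y /(key _ _ _ oU)[V [phi [oV VU [_ _ _ opn] Vy ephi]]].
  have [o1 r1] := opn V oV (fun _ h => h).
  exists (phi @` V); split=> //.
    by move=> _ [x Vx <-]; exists x; [apply: VU|rewrite ephi].
  apply: r1; apply: (reg_ext sa) (reg_sub sa VU hU) => x Vx /=.
  by rewrite ephi.
Qed.

Lemma glued_locality (U : set X) (h : X -> k) :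
  (forall x, U x -> exists V, [/\ open V, V x, V `<=` U & reg V h]) -> reg U h.
Proof.
move=> H a; apply: (reg_loc (atlas_sheaf at_ (index0P a))) => x Ux.
have [V [/glued_open oV Vx VU hV]] := H _ Ux.
by exists ((@incl a) @^-1` V); split=> // z /VU.
Qed.

Lemma regular_point_immersion (Y Z : kspace k) (U0 : set Y) (phi : Y -> Z)
    (P : Y) :
  sheaf_like Y -> open_immersion_on U0 phi -> U0 P -> regular_point P ->
  regular_point (phi P).
Proof.
move=> sY [oU0 mphi iphi ophi] U0P [U [t [oU UP rt t0 H]]].
have [psi hpsi] := left_inverse_on P iphi.
have tr (W : set Y) (g : Y -> k) : open W -> W `<=` U0 -> reg W g ->
    open (phi @` W) /\ reg (phi @` W) (g \o psi).
  move=> oW WU rg; have [o1 r1] := ophi W oW WU.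
  split=> //; apply: r1; apply: (reg_ext sY) rg => x Wx /=; rewrite hpsi //.
  exact: WU.
have rt' : reg (U `&` U0) t by apply: (reg_sub sY) rt; exact: subIsetl.
have [o1 r1] := tr (U `&` U0) t (openI oU oU0) (@subIsetr _ _ _) rt'.
exists (phi @` (U `&` U0)), (t \o psi); split=> //; [by exists P|by rewrite /= hpsi|].
move=> V h oV VP rh h0; have [oV' rV'] := mphi V oV.
have [W [q [oW WP WUV rq hq]]] := H _ _ oV' (conj U0P VP) (rV' h rh) h0.
have WU0 : W `<=` U0 by move=> x /WUV[_ []].
have [o2 r2] := tr W q oW WU0 rq.
exists (phi @` W), (q \o psi); split=> //.
- by move=> _ [x Wx <-]; have [Ux [U0x Vx]] := WUV x Wx; split=> //; exists x.
- move=> _ [x Wx <-] /=; have e := hpsi x (WU0 x Wx).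
  by rewrite e; apply: hq.
Qed.

(* A space of dimension one in every point, with finitely many irreducible
   components, the sets in s. *)
Definition curve_like (T : topologicalType) (s : seq (set T)) : Prop :=
  (forall x, exists2 B, B \in s & B x) /\
  forall B, B \in s -> [/\ closed B, infinite_set B
    & forall W, closed W -> B `<=` W \/ finite_set (B `&` W)].

Lemma closed_finite_bigcup (T : topologicalType) (s : seq (set T)) :
  (forall B, B \in s -> closed B) -> closed (\bigcup_(B in [set` s]) B).
Proof.
elim: s => [|A s IH] h.
  by rewrite set_nil bigcup_set0; exact: closed0.
have -> : \bigcup_(B in [set` A :: s]) B = A `|` \bigcup_(B in [set` s]) B.
  apply/seteqP; split=> x.
    move=> [B /=]; rewrite inE => /orP[/eqP ->|hB] Bx; first by left.
    by right; exists B.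
  move=> [Ax|[B hB Bx]]; first by exists A; rewrite //= mem_head.
  by exists B; rewrite //= inE hB orbT.
by apply: closedU; [apply: h; rewrite mem_head|apply: IH => B hB; apply: h;
  rewrite inE hB orbT].
Qed.

Lemma irreducible_sub_bigcup (T : topologicalType) (s : seq (set T)) Z :
  irreducible_closed Z -> (forall B, B \in s -> closed B) ->
  Z `<=` \bigcup_(B in [set` s]) B -> exists2 B, B \in s & Z `<=` B.
Proof.
move=> [cZ [z0 Zz0] irr]; elim: s => [|A s IH] h sub.
  by have [B] := sub _ Zz0.
have [|||ZA|ZB] := irr A (\bigcup_(B in [set` s]) B).
- by apply: h; rewrite mem_head.
- by apply: closed_finite_bigcup => B hB; apply: h; rewrite inE hB orbT.
- move=> z /sub[B /=]; rewrite inE => /orP[/eqP ->|hB] Bz; first by left.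
  by right; exists B.
- by exists A; rewrite ?mem_head.
have [|//|B hB ZB'] := IH; first by move=> B hB; apply: h; rewrite inE hB orbT.
by exists B; rewrite // inE hB orbT.
Qed.

Lemma closed_set1_T1 (T : topologicalType) (x : T) :
  open [set y | y <> x] -> closed [set x].
Proof.
by move=> h; rewrite -openC (_ : ~` _ = [set y | y <> x]).
Qed.

Lemma finite_irreducible (T : topologicalType) (W : set T) x :
  (forall x : T, closed [set x]) -> finite_set W -> irreducible_closed W ->
  W x -> W = [set x].
Proof.
move=> T1 fW iW Wx; apply/seteqP; split=> [|_ -> //].
have /finite_seqP[s es] := fW.
have [||B] := irreducible_sub_bigcup (s := [seq [set y] | y <- s]) iW.
- by move=> B /mapP[y _ ->]; exact: T1.
- move=> y; rewrite {1}es /= => ys; exists [set y] => //=.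
  by apply/mapP; exists y.
move=> /mapP[y _ ->] hy; have -> := hy _ Wx.
exact: hy.
Qed.

(** A component is one of the sets in [s], and a point below it gives a chain of length 1. In a
    chain of length 2 the middle term is a proper closed subset, hence finite, hence a single point,
    and nothing fits below it. *)
Lemma curve_like_components (T : topologicalType) (s : seq (set T)) (Z : set T) :
  (forall x : T, closed [set x]) -> curve_like s -> irreducible_component Z ->
  closed_chain Z 1 /\ ~ closed_chain Z 2.
Proof.
move=> T1 [cov hs] [iZ maxZ].
have irrB B : B \in s -> irreducible_closed B.
  move=> /hs[cB iB hB]; split=> //; first exact: infinite_setN0.
  move=> A C cA cC sub; have [|fA] := hB A cA; first by left.
  have [|fC] := hB C cC; first by right.
  exfalso; apply: iB.
  suff : finite_set ((B `&` A) `|` (B `&` C)).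
    by apply: sub_finite_set => x Bx; have [?|?] := sub x Bx; [left|right].
  by rewrite finite_setU.
have [||B Bs ZB] := irreducible_sub_bigcup (s := s) iZ.
- by move=> B /hs[].
- by move=> x _; have [B ? ?] := cov x; exists B.
have eB := maxZ B (irrB B Bs) ZB; subst B.
have [cZ infZ hZ] := hs _ Bs.
have irr1 (x : T) : irreducible_closed [set x].
  split; [exact: T1|by exists x|].
  by move=> A B _ _ /(_ x erefl)[] h; [left|right] => _ ->.
split.
  have [x Zx] := infinite_setN0 infZ.
  exists (fun i => if i == 0%N then [set x] else Z); split.
    by case=> [|[|i]] // _ /=; split=> // _ ->.
  case=> [|i] // _ /=; split=> [_ -> //|e].
  by apply: infZ; apply: (sub_finite_set e); exact: finite_set1.
move=> [W [hW lt]].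
have [iW0 _] := hW 0%N isT; have [iW1 W1Z] := hW 1%N isT.
have [_ W2Z] := hW 2%N isT.
have [s01 n10] := lt 0%N isT; have [s12 n21] := lt 1%N isT.
have [cW1 _ _] := iW1.
have [ZW|fW] := hZ _ cW1; first by apply: n21 => z /W2Z/ZW.
have fW1 : finite_set (W 1%N).
  by apply: sub_finite_set fW => z Wz; split=> //; apply: W1Z.
have [_ [x W0x] _] := iW0.
apply: n10; rewrite (finite_irreducible T1 fW1 iW1 (s01 _ W0x)).
by move=> _ ->.
Qed.

Let a0 : index0 Sigma := exist _ None (mem_set (or_introl erefl)).

Lemma glued_T1 (z : X) : closed [set z].
Proof.
apply: closed_set1_T1; apply/glued_open => b.
have [[y ey]|n] := pselect (exists y : space0 f (\val b), incl y = z).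
  rewrite (_ : _ @^-1` _ = [set y' | y' <> y]).
    exact: sheaf_like_T1 (atlas_sheaf at_ (index0P b)).
  apply/seteqP; split=> y' /= h e; apply: h; first by rewrite e.
  by apply: glued_incl_inj; rewrite e ey.
rewrite (_ : _ @^-1` _ = setT); first exact: openT.
by apply/seteqP; split=> // y' _ /= e; apply: n; exists y'.
Qed.

Lemma glued_infinite_opens : has_infinite_opens X.
Proof.
move=> U /glued_open oU [z Uz]; have [b [x ex]] := glued_surj z; subst z.
have := atlas_inf at_ (index0P b) (oU b) (ex_intro _ x Uz).
apply: contra_not => fU.
have [g hg] := left_inverse_on (U := setT) x (fun x y _ _ => @glued_incl_inj b x y).
apply: sub_finite_set (finite_image g fU) => y Uy.
by exists (incl y); rewrite ?hg.
Qed.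

Hypothesis finSigma : finite_set Sigma.

Lemma finite_index0 : exists s : seq (index0 Sigma), forall a, a \in s.
Proof.
have : finite_set (index0 Sigma).
  by rewrite finite_setU; split; [exact: finite_set1|exact: finite_image].
move=> /finite_seqP[s es].
exists (pmap insub s) => a.
rewrite mem_pmap_sub.
suff sub : index0 Sigma `<=` [set` s] by apply: sub (index0P a).
by rewrite es.
Qed.

Lemma finite_outside : finite_set (~` (range (@incl a0))).
Proof.
have [s hs] := finite_index0.
have : finite_set (\bigcup_(b in [set` s]) (@incl b @` (~` (@overlap k f (\val b) None)))).
  apply: bigcup_finite => [|b _]; first exact: finite_seq.
  by apply: finite_image; apply: (finite_overlapC at_); [apply: index0P|left].
apply: sub_finite_set => z nz; have [b [x ex]] := glued_surj z.
exists b; first exact: hs.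
exists x => // Ox; apply: nz.
have [phi [oi ext]] := overlap_immersion at_ (index0P b) (or_introl erefl) Ox.
exists (phi x) => //; rewrite -ex; apply/esym.
apply/(@glued_inclP b a0); exists (@overlap k f (\val b) None), phi.
by split.
Qed.

(** The components are the closures of those of C_0. They cover everything because C_0 has a finite
    complement and nonempty opens are infinite. *)
Lemma glued_curve_like (s0 : seq (set (C0 f))) :
  curve_like s0 -> exists s : seq (set X), curve_like s.
Proof.
move=> [cov h0]; pose i0 := @incl a0 : C0 f -> X.
have [oT mi ii oi] := glued_incl_immersion a0.
exists [seq closure (i0 @` B) | B <- s0].
have fO := finite_outside.
have oO : open (range i0) by have [] := oi setT openT (fun _ _ => I).
split.
  move=> x.
  have : closure (range i0) x.
    move=> U; rewrite nbhsE => -[V [oV Vx] VU].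
    have infV := glued_infinite_opens oV (ex_intro _ x Vx).
    apply: contrapT => n; apply: infV; apply: sub_finite_set fO => z Vz Oz.
    by apply: n; exists z; split=> //; apply: VU.
  have cl : closed (\bigcup_(B in [set` [seq closure (i0 @` B) | B <- s0]]) B).
    by apply: closed_finite_bigcup => B /mapP[B' _ ->]; exact: closed_closure.
  have sub : range i0 `<=` \bigcup_(B in [set` [seq closure (i0 @` B) | B <- s0]]) B.
    move=> _ [y _ <-]; have [B Bs By] := cov y.
    exists (closure (i0 @` B)); first by apply/mapP; exists B.
    by apply: subset_closure; exists y.
  move=> /(closureS sub); rewrite -((closure_id _).1 cl) => -[B ? ?].
  by exists B.
move=> _ /mapP[B Bs ->]; have [cB infB hB] := h0 B Bs.
split.
- exact: closed_closure.
- have [x0 _] := infinite_setN0 infB; apply: contra_not infB => fB.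
  have [g hg] := left_inverse_on x0 ii.
  apply: sub_finite_set (finite_image g fB) => x Bx; exists (i0 x); last exact: hg.
  by apply: subset_closure; exists x.
move=> W cW.
have cW0 : closed (i0 @^-1` W).
  rewrite -openC; have := (glued_open (~` W)).1; rewrite openC => /(_ cW a0).
  by [].
have [sub|fin] := hB _ cW0.
  left; rewrite [W]((closure_id _).1 cW); apply: closureS => _ [x Bx <-].
  exact: sub.
right; suff : finite_set (i0 @` (B `&` i0 @^-1` W) `|` ~` range i0).
  apply: sub_finite_set => x [clx Wx].
  have [Ox|] := pselect (range i0 x); last by right.
  left; case: Ox clx Wx => y _ <- cly Wy; exists y => //; split=> //.
  (* [B] is closed in C_0 and C_0 is open, so its closure contains no further point of C_0. *)
  apply: contrapT => nB.
  have oB : open (~` B) by rewrite openC.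
  have [oB' _] := oi (~` B) oB (fun _ _ => I).
  have : nbhs (i0 y) (i0 @` (~` B)).
    by apply: open_nbhs_nbhs; split=> //; exists y.
  move=> /cly[z [[w Bw <-] [w' nBw' e]]].
  by apply: nBw'; rewrite (ii w' w _ _ e).
by rewrite finite_setU; split=> //; exact: finite_image.
Qed.

Lemma glued_smooth_curve (s0 : seq (set (C0 f))) :
  curve_like s0 ->
  (forall a, index0 Sigma a -> exists n (H : set {mpoly k[n]})
     (phi : zspace (zero_locus H) -> space0 f a),
     open_immersion_on setT phi /\ range phi = setT) ->
  (forall a, index0 Sigma a -> forall P : space0 f a, regular_point P) ->
  smooth_curve X.
Proof.
move=> cl0 aff regp; split; last first.
  move=> z; have [a [x <-]] := glued_surj z.
  apply: (regular_point_immersion _ (glued_incl_immersion a)) => //.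
    exact: atlas_sheaf (index0P a).
  exact: regp (index0P a) x.
split; last first.
  have [s hs] := glued_curve_like cl0 => Z.
  by apply: curve_like_components hs; exact: glued_T1.
split=> [U h _|]; first exact: glued_locality.
have [s hs] := finite_index0.
exists (size s), (fun i => range (@incl (tnth (in_tuple s) i))); split.
  apply/seteqP; split=> // z _; have [a [x ex]] := glued_surj z; subst z.
  have /tnthP[i ei] : a \in in_tuple s by apply: hs.
  exists i => //; rewrite -ei; exact: imageT.
move=> i; set a := tnth _ i; have [n [H [phi [ophi rphi]]]] := aff _ (index0P a).
exists n, H, (@incl a \o phi); split.
  have := comp_open_immersion_on (zspace_sheaf_like _) ophi (glued_incl_immersion a).
  by rewrite preimage_setT setIT.
apply/seteqP; split=> [_ [x _ <-]|_ [y _ <-]]; first by exists (phi x).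
have [x _ <-] : range phi y by rewrite rphi.
by exists x.
Qed.

End GluedCurve.

Section Finite.

Lemma finite_of_inj (T U : Type) (A : set T) (B : set U) (g : T -> U) :
  (forall x, A x -> B (g x)) ->
  (forall x y, A x -> A y -> g x = g y -> x = y) ->
  finite_set B -> finite_set A.
Proof.
move=> AB inj fB; have [[x0 _]|n] := pselect (A !=set0); last first.
  have -> : A = set0 by apply/seteqP; split=> // x Ax; apply: n; exists x.
  exact: finite_set0.
have [h hK] := left_inverse_on x0 inj.
apply: sub_finite_set (finite_image h fB) => x Ax.
by exists (g x); [apply: AB|apply: hK].
Qed.

Lemma big_support (T : eqType) (V : nmodType) (s1 s2 : seq T) (F : T -> V) :
  uniq s1 -> uniq s2 -> (forall x, F x != 0 -> (x \in s1) && (x \in s2)) ->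
  \sum_(x <- s1) F x = \sum_(x <- s2) F x.
Proof.
move=> u1 u2 h.
have e (s : seq T) : \sum_(x <- s) F x = \sum_(x <- s | F x != 0) F x.
  by rewrite [RHS]big_mkcond; apply: eq_bigr => x _; case: eqVneq.
rewrite e [RHS]e -big_filter -[RHS]big_filter; apply: perm_big.
apply: uniq_perm; rewrite ?filter_uniq // => x; rewrite !mem_filter.
by case: eqVneq => //= /h/andP[-> ->].
Qed.

End Finite.

(** * Monomial substitutions *)

Section Monomials.
Variables (k : closedFieldType) (n : nat).
Implicit Types (x : 'rV[k]_n) (e : 'rV[int]_n) (M N : 'M[int]_n).

Definition xmon x e : k := \prod_i x 0 i ^ e 0 i.

Lemma xmon_neq0 x e : torus x -> xmon x e != 0.
Proof. by move=> tx; apply/prodf_neq0 => i _; rewrite expfz_neq0 // tx. Qed.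

Lemma xmonD x e e' : torus x -> xmon x (e + e') = xmon x e * xmon x e'.
Proof.
move=> tx; rewrite /xmon -big_split /=; apply: eq_bigr => i _.
by rewrite mxE expfzDr // tx.
Qed.

Lemma xmon_bullet x M e : torus x -> xmon (bullet x M) e = xmon x (e *m M^T).
Proof.
move=> tx; rewrite /xmon.
transitivity (\prod_j \prod_i x 0 i ^ (M i j * e 0 j)).
  apply: eq_bigr => j _; rewrite mxE.
  have h (I : Type) (r : seq I) (F : I -> k) z :
      (\prod_(i <- r) F i) ^ z = \prod_(i <- r) F i ^ z.
    by elim/big_rec2: _ => [|i a b _ <-]; rewrite ?exp1rz // expfzMl.
  by rewrite h; apply: eq_bigr => i _; rewrite exprz_exp.
rewrite exchange_big; apply: eq_bigr => i _ /=.
rewrite mxE; have h (r : seq 'I_n) (F : 'I_n -> int) :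
    \prod_(j <- r) x 0 i ^ F j = x 0 i ^ (\sum_(j <- r) F j).
  by elim/big_rec2: _ => [|j a b _ ->]; rewrite ?expr0z // expfzDr // tx.
by rewrite h; congr (_ ^ _); apply: eq_bigr => j _; rewrite !mxE mulrC.
Qed.

Lemma bulletE x M j : bullet x M 0 j = xmon x (\row_i M i j).
Proof. by rewrite mxE; apply: eq_bigr => i _; rewrite mxE. Qed.

Lemma torus_bullet x M : torus x -> torus (bullet x M).
Proof. by move=> tx j; rewrite bulletE xmon_neq0. Qed.

Lemma bulletM x M N : torus x -> bullet (bullet x M) N = bullet x (M *m N).
Proof.
move=> tx; apply/rowP => j; rewrite !bulletE xmon_bullet //; congr xmon.
by apply/rowP => i; rewrite !mxE; apply: eq_bigr => l _; rewrite !mxE mulrC.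
Qed.

Lemma bullet1 x : bullet x 1%:M = x.
Proof.
apply/rowP => j; rewrite mxE (bigD1 j) //= mxE eqxx expr1z big1 ?mulr1 // => i.
by move=> /negbTE ni; rewrite mxE ni expr0z.
Qed.

Lemma lcoef_mexp (G : {mpoly k[n]}) m : lcoef G (mexp m) = G@_m.
Proof.
rewrite /lcoef ifT; last by apply/forallP => i; rewrite mxE.
by congr (_@__); apply/mnmP => i; rewrite mnmE mxE.
Qed.

Lemma lcoef_support (G : {mpoly k[n]}) e :
  lcoef G e != 0 -> exists2 m, m \in msupp G & e = mexp m.
Proof.
rewrite /lcoef; case: ifP => [/forallP h|_]; last by rewrite eqxx.
move=> nz; exists [multinom `|e ord0 i|%N | i < n]; first by rewrite mcoeff_msupp.
by apply/rowP => i; rewrite mxE mnmE gez0_abs.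
Qed.

Lemma mexp_inj : injective (@mexp n).
Proof.
move=> m m' /rowP h; apply/mnmP => i; have := h i; rewrite !mxE.
by move=> [].
Qed.

Lemma meval_xmon (G : {mpoly k[n]}) x :
  G.@[x 0] = \sum_(m <- msupp G) G@_m * xmon x (mexp m).
Proof.
rewrite mevalE; apply: eq_bigr => m _; congr (_ * _).
by rewrite /xmon; apply: eq_bigr => i _; rewrite mxE.
Qed.

(** One evaluation for Laurent polynomials, polynomials, and their coefficients weighted by
    exponents; [s] is any finite list containing the support. *)
Definition coef_eval (g : 'rV[int]_n -> k) (s : seq 'rV[int]_n) x : k :=
  \sum_(e <- s) g e * xmon x e.

Lemma meval_coef_eval (G : {mpoly k[n]}) x :
  G.@[x 0] = coef_eval (lcoef G) [seq mexp m | m <- msupp G] x.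
Proof.
rewrite meval_xmon /coef_eval [RHS]big_map; apply: eq_bigr => m _.
by rewrite lcoef_mexp.
Qed.

(** As [M] is invertible over the integers, the map of exponents is a bijection, so the terms of
    both sides correspond to each other. *)
Lemma monomial_subst_eval g s M c (G : {mpoly k[n]}) x :
  M \in unitmx -> uniq s -> (forall e, g e != 0 -> e \in s) -> torus x ->
  monomial_subst g M c G ->
  coef_eval g s (bullet x M) = xmon x c * G.@[x 0].
Proof.
move=> uM us hs tx hG.
have uMT : M^T \in unitmx by rewrite unitmx_tr.
pose phi e : 'rV[int]_n := e *m M^T - c.
pose phi' e : 'rV[int]_n := (e + c) *m invmx M^T.
have phiK : cancel phi phi' by move=> e; rewrite /phi /phi' subrK mulmxK.
have phi'K : cancel phi' phi by move=> e; rewrite /phi /phi' mulmxKV // addrK.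
rewrite meval_coef_eval mulr_sumr.
transitivity (\sum_(e <- [seq phi e | e <- s]) xmon x c * (lcoef G e * xmon x e)).
  rewrite [RHS]big_map; apply: eq_bigr => e _; rewrite hG xmon_bullet //.
  rewrite mulrCA -xmonD //; congr (_ * xmon _ _).
  by rewrite /phi addrC subrK.
apply: big_support.
- by rewrite map_inj_uniq //; apply: can_inj phiK.
- by rewrite map_inj_uniq ?msupp_uniq //; apply: mexp_inj.
move=> e nz; have nG : lcoef G e != 0.
  by apply: contra_neq nz => ->; rewrite mul0r mulr0.
have [m hm em] := lcoef_support nG; apply/andP; split; last first.
  by apply/mapP; exists m.
apply/mapP; exists (phi' e); last by rewrite phi'K.
by apply: hs; rewrite hG -/(phi _) phi'K.
Qed.

Lemma lcoefD (F G : {mpoly k[n]}) e : lcoef (F + G) e = lcoef F e + lcoef G e.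
Proof. by rewrite /lcoef; case: ifP; rewrite ?addr0 // mcoeffD. Qed.

Lemma lcoefZ a (G : {mpoly k[n]}) e : lcoef (a *: G) e = a * lcoef G e.
Proof. by rewrite /lcoef; case: ifP; rewrite ?mulr0 // mcoeffZ. Qed.

Lemma mcoeff_euler (G : {mpoly k[n]}) (i : 'I_n) m :
  ('X_i * G^`M(i))@_m = G@_m *+ m i.
Proof.
have eX m' : 'X_i * ('X_[m'] : {mpoly k[n]})^`M(i) = (m' i)%:R *: 'X_[m'].
  rewrite mderivX -scalerAr; have [->|h] := posnP (m' i).
    by rewrite !scale0r.
  rewrite -mpolyXD addmC submK //; apply/mnm_lepP => j; rewrite mnm1E.
  by case: eqP => // <-.
elim/mpolyind: G => [|a m' p _ _ IH].
  by rewrite mderiv0 mulr0 !mcoeff0 mul0rn.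
rewrite mderivD mulrDr mderivZ -scalerAr eX !mcoeffD IH !mcoeffZ mcoeffX.
rewrite mulrnDl; congr (_ + _); case: eqP => [->|_]; last by rewrite !mulr0 mul0rn.
by rewrite !mulr1 mulr_natr.
Qed.

Lemma lcoef_euler (G : {mpoly k[n]}) (i : 'I_n) e :
  lcoef ('X_i * G^`M(i)) e = lcoef G e *~ e 0 i.
Proof.
rewrite /lcoef; case: ifP => [/forallP h|_]; last by rewrite mul0rz.
by rewrite mcoeff_euler mnmE pmulrn gez0_abs.
Qed.

(** The chain rule for logarithmic derivatives: X_i d/dX_i is the combination of the x_l d/dx_l with
    coefficients [M i l]. Applied to X^c G, it gives X^c times the sum of X_i G_i and c_i G. *)
Lemma euler_subst g s M c (G : {mpoly k[n]}) x i :
  M \in unitmx -> uniq s -> (forall e, g e != 0 -> e \in s) -> torus x ->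
  monomial_subst g M c G ->
  xmon x c * (x 0 i * (G^`M(i)).@[x 0] + (G.@[x 0]) *~ c 0 i) =
  \sum_l (coef_eval (fun e => g e *~ e 0 l) s (bullet x M)) *~ M i l.
Proof.
move=> uM us hs tx hG.
(* Weighting each coefficient by the i-th entry of its new exponent turns the Euler operator into
   another substitution with the same [M] and [c]. *)
have h : monomial_subst (fun e => g e *~ (e *m M^T) 0 i) M c
    ('X_i * G^`M(i) + (c 0 i)%:~R *: G).
  move=> e; rewrite lcoefD lcoef_euler lcoefZ -hG mulrzl -mulrzDr; congr (_ *~ _).
  by rewrite !mxE subrK.
have hs' e : g e *~ (e *m M^T) 0 i != 0 -> e \in s.
  by move=> nz; apply: hs; apply: contra_neq nz => ->; rewrite mul0rz.
have := monomial_subst_eval uM us hs' tx h.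
rewrite mevalD mevalM mevalXU mevalZ mulrzl => <-.
rewrite /coef_eval; under [RHS]eq_bigr do rewrite -mulrzr big_distrl.
rewrite [RHS]exchange_big; apply: eq_bigr => e _ /=.
transitivity (\sum_l (g e *~ (e 0 l * M i l)) * xmon (bullet x M) e).
  rewrite -mulr_suml; congr (_ * _); rewrite mxE -mulrz_sumr.
  by apply: congr1; apply: eq_bigr => l _; rewrite !mxE.
apply: eq_bigr => l _; rewrite mulrzr -!mulrzAl.
by rewrite mulrzA.
Qed.

End Monomials.

(** * Plane curves *)

Lemma ord2P (i : 'I_2) : i = 0 \/ i = 1.
Proof. by case: i => [[|[|//]] hi]; [left|right]; apply: val_inj. Qed.

Section TwoVariables.
Variable k : closedFieldType.
Implicit Types P F : {mpoly k[2]}.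

Definition pt2 (R : Type) (x y : R) : 'rV[R]_2 :=
  \row_(i < 2) if i == 0 then x else y.

Lemma pt2_0 (R : Type) (x y : R) : pt2 x y 0 0 = x.
Proof. by rewrite mxE. Qed.

Lemma pt2_1 (R : Type) (x y : R) : pt2 x y 0 1 = y.
Proof. by rewrite mxE. Qed.

Lemma row2E (R : Type) (v : 'rV[R]_2) : v = pt2 (v 0 0) (v 0 1).
Proof.
by apply/rowP => i; have [->|->] := ord2P i; rewrite mxE.
Qed.

Lemma big_ord2 (R : Type) (idx : R) (op : Monoid.law idx) (F : 'I_2 -> R) :
  \big[op/idx]_i F i = op (F 0) (F 1).
Proof.
rewrite big_ord_recl big_ord1; congr (op (F _) (F _)); exact: val_inj.
Qed.

Definition ev2 P x y : k := P.@[pt2 x y 0].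

Lemma meval_ev2 P (v : 'rV[k]_2) : P.@[v 0] = ev2 P (v 0 0) (v 0 1).
Proof. by rewrite /ev2 -row2E. Qed.

Lemma ev2D P F x y : ev2 (P + F) x y = ev2 P x y + ev2 F x y.
Proof. exact: mevalD. Qed.
Lemma ev2B P F x y : ev2 (P - F) x y = ev2 P x y - ev2 F x y.
Proof. exact: mevalB. Qed.
Lemma ev2M P F x y : ev2 (P * F) x y = ev2 P x y * ev2 F x y.
Proof. exact: mevalM. Qed.
Lemma ev2X P m x y : ev2 (P ^+ m) x y = ev2 P x y ^+ m.
Proof. exact: rmorphXn. Qed.
Lemma ev2Z a P x y : ev2 (a *: P) x y = a * ev2 P x y.
Proof. exact: mevalZ. Qed.
Lemma ev2C c x y : ev2 c%:MP x y = c.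
Proof. exact: mevalC. Qed.
Lemma ev2_X0 x y : ev2 'X_0 x y = x.
Proof. by rewrite /ev2 mevalXU pt2_0. Qed.
Lemma ev2_X1 x y : ev2 'X_1 x y = y.
Proof. by rewrite /ev2 mevalXU pt2_1. Qed.
Lemma ev2_0 x y : ev2 0 x y = 0.
Proof. exact: meval0. Qed.
Lemma ev2_prod (I : Type) (r : seq I) (G : I -> {mpoly k[2]}) x y :
  ev2 (\prod_(i <- r) G i) x y = \prod_(i <- r) ev2 (G i) x y.
Proof. exact: rmorph_prod. Qed.

Definition mnm2 (i j : nat) : 'X_{1..2} :=
  [multinom (if l == 0%R then i else j) | l < 2].

Lemma mnm2E (m : 'X_{1..2}) : m = mnm2 (m 0) (m 1).
Proof.
by apply/mnmP => i; have [->|->] := ord2P i; rewrite mnmE.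
Qed.

(* P as a polynomial in X = 'X_0 with coefficients in k[Y], Y = 'X_1 *)
Definition biv P : {poly {poly k}} :=
  \sum_(m <- msupp P) (P@_m *: 'X^(m 1)) *: 'X^(m 0).

Lemma evb_biv P x y : evb (biv P) x y = ev2 P x y.
Proof.
rewrite /ev2 mevalE /biv /evb rmorph_sum horner_sum; apply: eq_bigr => m _.
rewrite -/(evb _ x y) evbZ hornerZ hornerXn big_ord2 pt2_0 pt2_1 -mulrA.
congr (_ * _); rewrite mulrC; congr (_ * _).
by rewrite /evb rmorphXn /= map_polyX hornerXn.
Qed.

Lemma coef_biv P i j : (biv P)`_i`_j = P@_(mnm2 i j).
Proof.
rewrite /biv coef_sum coef_sum.
under eq_bigr do rewrite coefZ coefXn mulr_natr.
have [h|h] := boolP (mnm2 i j \in msupp P).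
  rewrite (bigD1_seq (mnm2 i j)) ?msupp_uniq //= !mnmE /= eqxx mulr1n coefZ.
  rewrite coefXn eqxx mulr1 big1 ?addr0 // => m nm.
  case: (eqVneq i (m 0)) => [e|]; last by rewrite coef0.
  rewrite mulr1n coefZ coefXn; case: eqP => [e'|]; last by rewrite mulr0.
  by case/negP: nm; rewrite e e' -mnm2E.
rewrite (memN_msupp_eq0 h) big_seq big1 // => m hm.
case: (eqVneq i (m 0)) => [e|]; last by rewrite coef0.
rewrite mulr1n coefZ coefXn; case: eqP => [e'|]; last by rewrite mulr0.
by move: h; rewrite e e' -mnm2E hm.
Qed.

Lemma biv_neq0 P : P != 0 -> biv P != 0.
Proof.
apply: contra_neq => h; apply/mpolyP => m.
by rewrite (mnm2E m) -coef_biv h !coef0 mcoeff0.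
Qed.

Lemma evb_surj (v : {poly {poly k}}) : exists P, forall x y, ev2 P x y = evb v x y.
Proof.
elim/poly_ind: v => [|v c [P hP]].
  by exists 0 => x y; rewrite /ev2 meval0 /evb rmorph0 horner0.
have [Q hQ] : exists Q, forall x y, ev2 Q x y = evb c%:P x y.
  elim/poly_ind: c => [|c a [Q hQ]].
    by exists 0 => x y; rewrite /ev2 meval0 evbC horner0.
  exists (Q * 'X_1 + a%:MP) => x y.
  by rewrite ev2D ev2M ev2C ev2_X1 hQ !evbC hornerMXaddC.
exists (P * 'X_0 + Q) => x y.
rewrite ev2D ev2M ev2_X0 hP hQ evbD evbM; congr (_ * _ + _).
by rewrite /evb specX hornerX.
Qed.

Lemma evb_eq0 (v : {poly {poly k}}) : (forall x y, evb v x y = 0) -> v = 0.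
Proof.
move=> h; apply/polyP => i; rewrite coef0.
apply: (finite_roots_eq0 (@infinite_closed_field k)) => y _.
have : spec y v = 0.
  by apply: (finite_roots_eq0 (@infinite_closed_field k)) => x _; exact: h.
by move=> /(congr1 (fun p : {poly k} => p`_i)); rewrite coef_spec coef0.
Qed.

Lemma evb_inj (v w : {poly {poly k}}) :
  (forall x y, evb v x y = evb w x y) -> v = w.
Proof.
move=> h; apply/eqP; rewrite -subr_eq0; apply/eqP/evb_eq0 => x y.
by rewrite -scaleN1r evbD evbZ h hornerN hornerC mulN1r subrr.
Qed.

Lemma ev2_eq0 P : (forall x y, ev2 P x y = 0) -> P = 0.
Proof.
move=> h; apply/eqP/negPn/negP => /biv_neq0/negP; apply; apply/eqP/evb_eq0.
by move=> x y; rewrite evb_biv.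
Qed.

Lemma ev2_taylor P a b : exists A B, forall x y,
  ev2 P x y = ev2 P a b + (x - a) * ev2 A x y + (y - b) * ev2 B x y.
Proof.
elim/mpoly_ring_ind: P => [c|i|p q [A [B hA]] [C [D hC]]|
    p q [A [B hA]] [C [D hC]]].
- by exists 0, 0 => x y; rewrite !(ev2_0, ev2C); ring.
- have [->|->] := ord2P i.
  + by exists 1%:MP, 0 => x y; rewrite !(ev2_0, ev2C, ev2_X0); ring.
  + by exists 0, 1%:MP => x y; rewrite !(ev2_0, ev2C, ev2_X1); ring.
- by exists (A + C), (B + D) => x y; rewrite !ev2D hA hC; ring.
exists (A * q + (ev2 p a b) *: C), (B * q + (ev2 p a b) *: D) => x y.
by rewrite !(ev2M, ev2D, ev2Z) hA hC; ring.
Qed.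

Lemma ev2_inj P F : (forall x y, ev2 P x y = ev2 F x y) -> P = F.
Proof.
move=> h; apply/eqP; rewrite -subr_eq0; apply/eqP/ev2_eq0 => x y.
by rewrite ev2B h subrr.
Qed.

Lemma ev2_taylor_deriv P a b : exists A B,
  [/\ forall x y, ev2 P x y = ev2 P a b + (x - a) * ev2 A x y + (y - b) * ev2 B x y,
      ev2 A a b = ev2 P^`M(0) a b & ev2 B a b = ev2 P^`M(1) a b].
Proof.
have [A [B hAB]] := ev2_taylor P a b; exists A, B.
have e : P = (ev2 P a b)%:MP + ('X_0 - a%:MP) * A + ('X_1 - b%:MP) * B.
  by apply: ev2_inj => x y; rewrite hAB !(ev2B, ev2D, ev2M, ev2C, ev2_X0, ev2_X1).
have dX (i j : 'I_2) : ('X_j : {mpoly k[2]})^`M(i) = (j == i)%:R%:MP.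
  rewrite mderivX mnm1E; case: eqP => [->|_]; last by rewrite scale0r mpolyC0.
  by rewrite scale1r -[X in (X - _)%MM]add0m addmK mpolyX0.
split=> //; rewrite [in RHS]e !(mderivB, mderivD, mderivM, mderivC, dX) /=;
  by rewrite !(ev2B, ev2D, ev2M, ev2C, ev2_X0, ev2_X1, ev2_0) !subrr; ring.
Qed.

(** The inverse of [M] is integral, so it can be applied to elements of [k] in any
    characteristic. *)
Lemma int_mx_inj n (D : 'I_n -> k) (M : 'M[int]_n) : M \in unitmx ->
  (forall i, \sum_l D l *~ M i l = 0) -> forall l, D l = 0.
Proof.
move=> uM h l0.
have -> : D l0 = \sum_l D l *~ (invmx M *m M) l0 l.
  rewrite mulVmx // (bigD1 l0) //= mxE eqxx mulr1z big1 ?addr0 // => l nl.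
  by rewrite mxE eq_sym (negbTE nl).
transitivity (\sum_i (\sum_l D l *~ M i l) *~ invmx M l0 i).
  under [RHS]eq_bigr do rewrite mulrz_suml.
  rewrite [RHS]exchange_big; apply: eq_bigr => l _ /=.
  rewrite mxE mulrz_sumr; apply: eq_bigr => i _.
  by rewrite mulrC mulrzA.
by rewrite big1 // => i _; rewrite h mul0rz.
Qed.

End TwoVariables.

Section PlaneCurve.
Variables (k : closedFieldType).

Lemma laurent_poly n (f : laurent k n) :
  exists c G, monomial_subst f 1%:M c G.
Proof.
(* A crude bound for all entries of all exponents: shifting by [N] makes them nonnegative. *)
pose N : int := \sum_(e <- finsupp f) \sum_i `|e ord0 i|.
have hN e i : e \in finsupp f -> 0 <= e ord0 i + N.
  move=> he; have h1 : `|e ord0 i| <= N.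
    rewrite /N (big_fsetD1 e) //= (bigD1 i) //= -addrA ler_wpDr //.
    by rewrite addr_ge0 ?sumr_ge0 // => e' _; rewrite ?sumr_ge0.
  by have := ler_norm (- e ord0 i); rewrite normrN; lia.
pose c : 'rV[int]_n := \row_i (- N).
pose mm (e : 'rV[int]_n) : 'X_{1..n} := [multinom absz ((e - c)%R ord0 i) | i < n].
exists c, (\sum_(e <- finsupp f) f e *: 'X_[mm e]) => e.
rewrite trmx1 mulmx1 /lcoef.
have [h|h] := boolP (e \in finsupp f).
  rewrite ifT; last first.
    by apply/forallP => i; rewrite !mxE opprK; apply: hN.
  rewrite raddf_sum /= (big_fsetD1 e) //= mcoeffZ mcoeffX eqxx mulr1.
  rewrite big_seq big1 ?addr0 // => e'; rewrite in_fsetD1 => /andP[ne he'].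
  rewrite mcoeffZ mcoeffX; case: eqP => [/mnmP em|]; last by rewrite mulr0.
  case/negP: ne; apply/eqP/rowP => i; have := em i.
  rewrite !mnmE !mxE opprK => ee; apply: (@addIr _ N).
  by rewrite -(gez0_abs (hN e' i he')) ee gez0_abs // hN.
have /eqP -> : f e == 0 by rewrite -memNfinsupp.
case: ifP => // /forallP hi; rewrite raddf_sum /= big_seq big1 // => e' he'.
rewrite mcoeffZ mcoeffX; case: eqP => [/mnmP em|]; last by rewrite mulr0.
case/negP: h; suff -> : e = e' by [].
apply/rowP => i; have := em i; rewrite !mnmE !mxE opprK => ee.
apply: (@addIr _ N); have := hi i; rewrite !mxE opprK => h2.
by rewrite -(gez0_abs h2) -ee gez0_abs // hN.
Qed.

Variable f : laurent k 2.

Lemma laurent_subst_eval (M : 'M[int]_2) c G (x : 'rV[k]_2) :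
  M \in unitmx -> torus x -> monomial_subst f M c G ->
  laurent_eval f (bullet x M) = xmon x c * G.@[x 0].
Proof.
move=> uM tx hG; have := monomial_subst_eval uM (fset_uniq (finsupp f)) _ tx hG.
by apply => e; rewrite mem_finsupp.
Qed.

(** On the torus a derivative vanishes exactly when its logarithmic version does. At a zero of [G]
    the logarithmic derivatives of [f] and [G] differ by a nonzero factor and the invertible matrix
    [M]. *)
Lemma smooth_subst (M : 'M[int]_2) c G (x : 'rV[k]_2) :
  smooth_plane_curve f -> M \in unitmx -> torus x -> monomial_subst f M c G ->
  G.@[x 0] = 0 -> exists l, (G^`M(l)).@[x 0] != 0.
Proof.
move=> [_ hf] uM tx hG G0; apply: contrapT => /forallNP n.
have tz := torus_bullet M tx.
have [|l /eqP] := hf (bullet x M).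
  by split=> //=; rewrite (laurent_subst_eval uM tx hG) G0 mulr0.
apply; apply: (mulfI (tz l)); rewrite mulr0.
apply: (@int_mx_inj k 2 (fun l => bullet x M 0 l *
  laurent_deriv_eval f l (bullet x M)) M uM _ l) => i.
have /negP/negPn/eqP d0 := n i.
have E := euler_subst i uM (fset_uniq (finsupp f)) _ tx hG.
rewrite d0 G0 mulr0 mul0rz addr0 mulr0 in E; rewrite [RHS]E; last first.
  by move=> e; rewrite mem_finsupp.
apply: eq_bigr => j _; congr (_ *~ _).
rewrite /laurent_deriv_eval /coef_eval mulr_sumr; apply: eq_bigr => e _.
rewrite mulrCA; congr (_ * _); rewrite /xmon (bigD1 j) //= mulrA.
rewrite [RHS](bigD1 j) //= eqxx -{1}[bullet x M 0 j]expr1z -expfzDr //.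
rewrite addrC subrK; congr (_ * _).
by apply: eq_bigr => i' /negbTE ni; rewrite ni subr0.
Qed.

End PlaneCurve.

(** * The affine curve C_0 *)

Section Pieces.
Variable k : closedFieldType.

Lemma curve_like_infinite_opens (T : topologicalType) (s : seq (set T)) :
  curve_like s -> has_infinite_opens T.
Proof.
move=> [cov hs] U oU [x Ux] fU; have [B Bs Bx] := cov x.
have [_ infB hB] := hs B Bs.
have [sub|fin] := hB (~` U) (open_closedC oU); first by have := sub x Bx.
apply: infB; suff : finite_set (U `|` (B `&` ~` U)).
  apply: sub_finite_set => y By.
  by have [Uy|nU] := pselect (U y); [left|right].
by rewrite finite_setU.
Qed.

Definition zpt n (Z : set 'rV[k]_n) x (h : Z x) : zspace Z :=
  (exist (fun x => x \in Z) x (mem_set h) : zar Z).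

(* the locally closed set u != 0 as the zero locus of u T - 1 *)
Lemma quasi_affine n (H : set {mpoly k[n]}) (u : {mpoly k[n]}) (Z : set 'rV[k]_n) :
  (forall x, Z x <-> u.@[x 0] != 0 /\ zero_locus H x) ->
  exists n' (H' : set {mpoly k[n']}) (phi : zspace (zero_locus H') -> zspace Z),
    open_immersion_on setT phi /\ range phi = setT.
Proof.
move=> hZ; pose w (i : 'I_n) : 'I_n.+1 := widen_ord (leqnSn n) i.
pose lft (h : {mpoly k[n]}) : {mpoly k[n.+1]} :=
  h \mPo [tuple 'X_(w i) | i < n].
pose pr (x : 'rV[k]_n.+1) : 'rV[k]_n := \row_i x 0 (w i).
pose up (x : 'rV[k]_n) : 'rV[k]_n.+1 :=
  \row_i if insub (nat_of_ord i) is Some j then x 0 j else (u.@[x 0])^-1.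
have eup_w x i : up x 0 (w i) = x 0 i.
  rewrite mxE; case: insubP => [j _ ej|]; last by rewrite /= ltn_ord.
  by congr (x 0 _); apply: val_inj.
have eup_m x : up x 0 ord_max = (u.@[x 0])^-1.
  by rewrite mxE insubF //= ltnn.
have elft h (x : 'rV[k]_n.+1) : (lft h).@[x 0] = h.@[(pr x) 0].
  rewrite /lft comp_mpoly_meval; apply: meval_eq => i.
  by rewrite tnth_mktuple mevalXU mxE.
have prup x : pr (up x) = x by apply/rowP => i; rewrite mxE eup_w.
pose H' : set {mpoly k[n.+1]} := lft @` H `|` [set lft u * 'X_ord_max - 1].
have hH' (x : 'rV[k]_n.+1) : zero_locus H' x <-> Z (pr x) /\ x 0 ord_max = (u.@[(pr x) 0])^-1.
  split=> [h|[/hZ[u0 hx] e] g].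
    have e : u.@[(pr x) 0] * x 0 ord_max = 1.
      apply/eqP; rewrite -subr_eq0; apply/eqP.
      have := h (lft u * 'X_ord_max - 1) (or_intror erefl).
      by rewrite mevalB mevalM mevalXU meval1 elft.
    have u0 : u.@[(pr x) 0] != 0.
      by apply: contra_eq_neq e => ->; rewrite mul0r eq_sym oner_neq0.
    split; last by rewrite -[LHS](mulKf u0) e mulr1.
    apply/hZ; split=> // g Hg; rewrite -elft; apply: h; left; by exists g.
  move=> [[g' Hg' <-]|->]; first by rewrite elft; apply: hx.
  by rewrite mevalB mevalM mevalXU meval1 elft e mulfV // subrr.
have exphi (x : zspace (zero_locus H')) :
    exists y : zspace Z, \val (y : zar Z) = pr (\val (x : zar (zero_locus H'))).
  have /set_mem/hH'[Zx _] := valP (x : zar (zero_locus H')).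
  by exists (zpt Zx).
have expsi (y : zspace Z) : exists x : zspace (zero_locus H'),
    \val (x : zar (zero_locus H')) = up (\val (y : zar Z)).
  have /set_mem Zy := valP (y : zar Z).
  have h : zero_locus H' (up (\val (y : zar Z))).
    by apply/hH'; rewrite prup eup_m.
  by exists (zpt h).
have [phi hphi] := choice exphi; have [psi hpsi] := choice expsi.
have phiK x : psi (phi x) = x.
  apply: val_inj; rewrite hpsi hphi.
  have /set_mem/hH'[_ e] := valP (x : zar (zero_locus H')).
  apply/rowP => i; have [->|] := eqVneq i ord_max; first by rewrite eup_m e.
  move=> ni; have li : (i < n)%N.
    by rewrite ltn_neqAle -ltnS ltn_ord andbT.
  have -> : i = w (Ordinal li) by apply: val_inj.
  by rewrite eup_w mxE.
have psiK y : phi (psi y) = y by apply: val_inj; rewrite hphi hpsi prup.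
exists n.+1, H', phi; split; last first.
  by apply/seteqP; split=> // y _; exists (psi y).
apply: (open_immersion_of_inverse (zspace_sheaf_like _) (zspace_sheaf_like _)
  openT openT (psi := psi)) => //.
- apply: (@morphism_on_zspace _ _ _ _ _ _ _ 1 (fun i x => x 0 (w i))) => //.
  + exact: openT.
  + by move=> i; apply: regular_over_coord.
  + by move=> x _; rewrite meval1 oner_neq0.
  + by move=> x i _; rewrite hphi mxE.
- apply: (@morphism_on_zspace _ _ _ _ _ _ _ u (fun i x => up x 0 i)) => //.
  + exact: openT.
  + move=> i; have [->|ni] := eqVneq i ord_max.
      apply: eq_regular_over (regular_over_inv (phi := fun y : 'rV[k]_n => u.@[y 0]) (c := 1) _).
        by move=> y _; rewrite eup_m.
      by move=> y _; rewrite meval1 mulr1.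
    have li : (i < n)%N by rewrite ltn_neqAle -ltnS ltn_ord andbT.
    have -> : i = w (Ordinal li) by apply: val_inj.
    by apply: eq_regular_over (regular_over_coord _ (Ordinal li)) => y _; rewrite eup_w.
  + by move=> x _; have /set_mem/hZ[] := valP (x : zar Z).
  + by move=> x i _; rewrite hpsi.
Qed.

(* To check regularity at a point, polynomials suffice. *)
Lemma zspace_regular_point n (Z : set 'rV[k]_n) (P : zspace Z) (t : {mpoly k[n]}) :
  t.@[(\val (P : zar Z)) 0] = 0 ->
  (forall h : {mpoly k[n]}, h.@[(\val (P : zar Z)) 0] = 0 ->
     exists s q : {mpoly k[n]}, s.@[(\val (P : zar Z)) 0] != 0 /\
       forall x, Z x -> s.@[x 0] * h.@[x 0] = t.@[x 0] * q.@[x 0]) ->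
  regular_point P.
Proof.
move=> t0 H; exists setT, (fun x : zspace Z => t.@[(\val (x : zar Z)) 0]).
split=> //; first exact: openT.
  move=> x _; exists t, 1; rewrite meval1 oner_neq0; split=> // y _ _.
  by rewrite meval1 divr1.
move=> V h oV VP hV h0; have [a [b [b0 ab]]] := hV P VP.
have a0 : a.@[(\val (P : zar Z)) 0] = 0.
  by have := h0; rewrite ab // => /eqP; rewrite mulf_eq0 invr_eq0 (negbTE b0)
    orbF => /eqP.
have [s [q [s0 sq]]] := H a a0.
have oD := zar_open_basic Z (s * b).
exists (V `&` [set x : zar Z | (s * b).@[(\val x) 0] != 0]),
  (fun x : zspace Z => q.@[(\val (x : zar Z)) 0] / (s * b).@[(\val (x : zar Z)) 0]).
split.
- exact: openI.
- by split=> //=; rewrite mevalM mulf_neq0.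
- by move=> x [].
- move=> x [Vx hx]; exists q, (s * b); split=> // y _ _.
- move=> x [Vx /=]; rewrite mevalM mulf_eq0 negb_or => /andP[sx bx].
  rewrite ab // mulrA -sq ?mevalM; last exact: set_mem (valP (x : zar Z)).
  by rewrite invfM mulrACA divff // mul1r.
Qed.

Variable f : laurent k 2.

Lemma C0_poly : exists F0 : {mpoly k[2]},
  [/\ forall q, C0_set f q <-> torus q /\ F0.@[q 0] = 0,
      (exists e, f e != 0) -> F0 != 0 &
      smooth_plane_curve f -> forall q, C0_set f q ->
        exists l, (F0^`M(l)).@[q 0] != 0].
Proof.
have [c [G hG]] := laurent_poly f; exists G.
have uM : (1%:M : 'M[int]_2) \in unitmx by exact: unitmx1.
have E (q : 'rV[k]_2) : torus q -> laurent_eval f q = xmon q c * G.@[q 0].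
  by move=> tq; rewrite -(laurent_subst_eval uM tq hG) bullet1.
have hC q : C0_set f q <-> torus q /\ G.@[q 0] = 0.
  split=> -[tq /=].
    by rewrite E // => /eqP; rewrite mulf_eq0 (negbTE (xmon_neq0 _ tq)) => /eqP.
  by move=> g0; split=> //=; rewrite E // g0 mulr0.
split=> //.
  move=> [e fe]; apply: contra_neq fe => g0.
  by rewrite hG g0 /lcoef; case: ifP; rewrite // mcoeff0.
by move=> sf q /hC[tq g0]; apply: (smooth_subst sf uM tq hG).
Qed.

(** The components are the traces on the torus of the minimal curves that make up the zero set of a
    polynomial equation of C_0. *)
Lemma C0_curve_like : (exists e, f e != 0) ->
  exists s : seq (set (C0 f)), curve_like s.
Proof.
move=> f0; have [F0 [hC /(_ f0) nF _]] := C0_poly.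
have [Ps [h1 h2]] := curve_decomposition (biv_neq0 nF).
pose pt (q : C0 f) : 'rV[k]_2 := \val (q : zar (C0_set f)).
pose z q : k * k := (pt q 0 0, pt q 0 1).
have tz q : torus (pt q) /\ zerob (biv F0) (z q).
  have /set_mem/hC[tq e] := valP (q : zar (C0_set f)).
  by split=> //; rewrite /zerob /= evb_biv -meval_ev2.
have zinj q q' : z q = z q' -> q = q'.
  by move=> [e0 e1]; apply: val_inj; rewrite [LHS]row2E [RHS]row2E -!/(pt _) e0 e1.
pose B P : set (C0 f) := [set q | zerob P (z q)].
(* Curves inside the coordinate axes are dropped. Any other one meets the axes in finitely many
   points, by minimality with respect to XY, so its trace is infinite. *)
exists [seq B P | P <- Ps & `[< B P !=set0 >]]; split.
  move=> q; have [_ /h2[P hP zP]] := tz q.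
  exists (B P) => //; apply/mapP; exists P => //; rewrite mem_filter hP andbT.
  by apply/asboolP; exists q.
move=> _ /mapP[P + ->]; rewrite mem_filter => /andP[/asboolP[q0 Bq0] hP].
have [infP minP] := h1 P hP.
have lift x : zerob P x -> x.1 * x.2 != 0 -> exists q, B P q /\ z q = x.
  move=> Px x0; have Fx : zerob (biv F0) x by apply/h2; exists P.
  have Cx : C0_set f (pt2 x.1 x.2).
    apply/hC; split.
      move: x0; rewrite mulf_eq0 negb_or => /andP[x1 x2] i.
      by rewrite mxE; case: ifP.
    by rewrite meval_ev2 pt2_0 pt2_1 -evb_biv.
  pose q : C0 f := zpt Cx.
  have zq : z q = x by rewrite /z /pt /= pt2_0 pt2_1; case: (x).
  by exists q; rewrite /B /= zq.
split.
- rewrite -openC; have [Q hQ] := evb_surj P.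
  rewrite (_ : ~` _ = [set x : zar (C0_set f) | Q.@[(\val x) 0] != 0]).
    exact: zar_open_basic.
  apply/seteqP; split=> q; rewrite /B /= /zerob /= meval_ev2 hQ.
    by move=> h; apply/eqP.
  by move=> /eqP.
- move=> fB; apply: infP.
  have [XY hXY] : exists v, forall x : k * k, evb v x.1 x.2 = x.1 * x.2.
    exists ('X * ('X)%:P) => x; rewrite evbM evbC hornerX.
    by rewrite /evb specX hornerX.
  have [sub|fin] := minP XY.
    have [tq _] := tz q0.
    have : evb XY (z q0).1 (z q0).2 = 0 := sub _ Bq0; rewrite hXY /= => /eqP.
    by rewrite mulf_eq0 (negbTE (tq 0)) (negbTE (tq 1)).
  have : finite_set (z @` B P `|` (zerob P `&` zerob XY)).
    by rewrite finite_setU; split=> //; apply: finite_image.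
  apply: sub_finite_set => x Px.
  have [e|ne] := eqVneq (x.1 * x.2) 0; first by right; rewrite /zerob /= hXY.
  by have [q [Bq <-]] := lift x Px ne; left; exists q.
move=> W cW; have [|/existsNP[q /not_implyP[Bq nW]]] := pselect (B P `<=` W).
  by left.
have oW : open (~` W) by rewrite openC.
have [e [e0 eW]] := (zar_openP (~` W)).1 oW q nW.
right; have [sub|fin] := minP (biv e).
  by have := sub _ Bq; rewrite /zerob /= evb_biv -meval_ev2 => /eqP; rewrite (negbTE e0).
apply: (finite_of_inj (g := z)) fin; last by move=> x y _ _; exact: zinj.
move=> x [Bx Wx]; split=> //; rewrite /zerob /= evb_biv -meval_ev2.
by apply/eqP/negPn/negP => /eW.
Qed.

(** With x, y centred at P, the equation reads x A + y D = 0, where A and D take the values of the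
    derivatives at P. If A(P) is nonzero, h = x H1 + y H2 satisfies A h = y (A H2 - D H1) on the
    curve, so y is a uniformiser; if D(P) is nonzero, x is one. *)
Lemma C0_regular_point : smooth_plane_curve f -> forall P : C0 f, regular_point P.
Proof.
move=> sf P; have [F0 [hC _ /(_ sf) hd]] := C0_poly.
have CP := set_mem (valP (P : zar (C0_set f))).
have [tP FP] := (hC _).1 CP; have [l dl] := hd _ CP.
set p := \val (P : zar (C0_set f)) in CP tP FP dl.
pose a := p 0 0; pose b := p 0 1.
have [A [D [hF hA hD]]] := ev2_taylor_deriv F0 a b.
have FPab : ev2 F0 a b = 0 by rewrite -meval_ev2.
have main (h : {mpoly k[2]}) : h.@[p 0] = 0 -> exists H1 H2, forall x : 'rV[k]_2,
    h.@[x 0] = (x 0 0 - a) * H1.@[x 0] + (x 0 1 - b) * H2.@[x 0].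
  move=> h0; have [H1 [H2 hh]] := ev2_taylor h a b; exists H1, H2 => x.
  have hab : ev2 h a b = 0 by rewrite -meval_ev2.
  by rewrite !meval_ev2 hh hab add0r.
have onC (x : 'rV[k]_2) : C0_set f x ->
    (x 0 0 - a) * A.@[x 0] + (x 0 1 - b) * D.@[x 0] = 0.
  by move=> /hC[_]; rewrite !meval_ev2 hF FPab add0r.
have [el|el] : l = 0 \/ l = 1.
  by case: (l) => [[|[|//]] hi]; [left|right]; apply: val_inj.
- apply: (@zspace_regular_point _ _ P ('X_1 - b%:MP)).
    by rewrite mevalB mevalXU mevalC subrr.
  move=> h /main[H1 [H2 hh]]; exists A, (A * H2 - D * H1); split.
    by rewrite meval_ev2 hA -meval_ev2 -el.
  move=> x /onC e; rewrite hh !(mevalB, mevalM, mevalXU, mevalC).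
  apply/eqP; rewrite -subr_eq0 -[X in _ == X](mul0r (H1.@[x 0])) -e; apply/eqP; ring.
- apply: (@zspace_regular_point _ _ P ('X_0 - a%:MP)).
    by rewrite mevalB mevalXU mevalC subrr.
  move=> h /main[H1 [H2 hh]]; exists D, (D * H1 - A * H2); split.
    by rewrite meval_ev2 hD -meval_ev2 -el.
  move=> x /onC e; rewrite hh !(mevalB, mevalM, mevalXU, mevalC).
  apply/eqP; rewrite -subr_eq0 -[X in _ == X](mul0r (H2.@[x 0])) -e; apply/eqP; ring.
Qed.

Lemma C0_affine : exists n (H : set {mpoly k[n]})
    (phi : zspace (zero_locus H) -> C0 f),
  open_immersion_on setT phi /\ range phi = setT.
Proof.
have [F0 [hC _ _]] := C0_poly.
apply: (@quasi_affine 2 [set F0] ('X_0 * 'X_1)) => q; rewrite hC.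
rewrite mevalM !mevalXU mulf_eq0 negb_or; split=> [[tq F0q]|[/andP[q0 q1] h]].
  by rewrite !tq; split=> // _ ->.
split; last exact: h.
by move=> [[|[|//]] hi]; [move: q0|move: q1]; congr (is_true (_ != _));
  congr (q _ _); apply: val_inj.
Qed.

End Pieces.

(** * A chart: C_(0,alpha) and its closure *)

Section Chart.
Variables (k : closedFieldType) (f : laurent k 2).
Implicit Types al : chart k.

Definition gpoly al (i : 'I_(ng al).+2) : {mpoly k[2]} :=
  nth 0 (rcons ('X_0 :: gs al) 'X_1) i.

Definition xvec al (q : 'rV[k]_2) : 'rV[k]_(ng al).+2 :=
  \row_i (gpoly i).@[q 0].

Lemma chart_coordE al q : chart_coord al q = bullet (xvec al q) (invmx (mat al)).
Proof.
rewrite /chart_coord; congr bullet; apply/rowP => i; rewrite !mxE /gpoly.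
set s := rcons ('X_0 :: _) 'X_1.
have -> : rcons (q 0 0 :: [seq g.@[q 0] | g : {mpoly k[2]} <- gs al]) (q 0 1) =
    [seq g.@[q 0] | g <- s].
  by rewrite /s map_rcons /= !mevalXU.
by rewrite (nth_map 0) // /s size_rcons /= size_tuple ltn_ord.
Qed.

Lemma C0_chartP al q : C0_chart f al q <-> C0_set f q /\ torus (xvec al q).
Proof.
split=> [[Cq /= /allP h]|[Cq h]].
  split=> // i; rewrite mxE; have [tq _] := Cq.
  have : gpoly i \in rcons ('X_0 :: gs al) 'X_1.
    by rewrite mem_nth // size_rcons /= size_tuple ltn_ord.
  rewrite mem_rcons !inE => /or3P[/eqP ->|/eqP ->|/h //]; by rewrite mevalXU tq.
split=> //=; apply/allP => g /(nthP 0)[i hi <-].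
have hi' : (i.+1 < (ng al).+2)%N by move: hi; rewrite size_tuple; lia.
have := h (Ordinal hi'); rewrite mxE /gpoly /= nth_rcons.
by rewrite hi.
Qed.

Lemma gpoly0 al : gpoly (ord0 : 'I_(ng al).+2) = 'X_0.
Proof. by []. Qed.

Lemma gpoly_max al : gpoly (ord_max : 'I_(ng al).+2) = 'X_1.
Proof.
by rewrite /gpoly nth_rcons /= size_tuple ltnn eqxx.
Qed.

Variable al : chart k.
Hypothesis det1 : \det (mat al) = 1.

Lemma mat_unit : mat al \in unitmx.
Proof. by rewrite unitmxE det1 unitr1. Qed.

Lemma torus_chart_coord q : C0_chart f al q -> torus (chart_coord al q).
Proof. by move=> /C0_chartP[_ h]; rewrite chart_coordE; apply: torus_bullet. Qed.

Lemma chart_coordK q : C0_chart f al q ->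
  bullet (chart_coord al q) (mat al) = xvec al q.
Proof.
move=> /C0_chartP[_ h]; rewrite chart_coordE bulletM // mulVmx ?mat_unit //.
by rewrite bullet1.
Qed.

Lemma chart_coord_unique q x : C0_chart f al q -> torus x ->
  bullet x (mat al) = xvec al q -> chart_coord al q = x.
Proof.
move=> /C0_chartP[_ h] tx e.
by rewrite chart_coordE -e bulletM // mulmxV ?mat_unit // bullet1.
Qed.

Lemma xvec_pt q : pt2 (xvec al q 0 0) (xvec al q 0 ord_max) = q.
Proof.
rewrite !mxE gpoly0 gpoly_max !mevalXU.
by rewrite -row2E.
Qed.

Lemma chart_coord_inj q q' : C0_chart f al q -> C0_chart f al q' ->
  chart_coord al q = chart_coord al q' -> q = q'.
Proof.
move=> h h' e; rewrite -(xvec_pt q) -(xvec_pt q').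
by rewrite -!chart_coordK // e.
Qed.

(* An identity between functions on T_v, or on an open subset of T_v,
   extends from C_(0,alpha) to its closure. *)
Lemma C_set_closure (b : {mpoly k[(ng al).+2]}) phi :
  regular_over b phi ->
  (forall x, C0_image f al x -> b.@[x 0] != 0 /\ phi x = 0) ->
  forall x, C_set f al x -> b.@[x 0] != 0 -> phi x = 0.
Proof.
move=> [N [a ha]] h x [_ hx] bx.
have a0 : a.@[x 0] = 0.
  by apply: hx => y /h[by0 py]; rewrite -ha // py mul0r.
apply: (mulIf (expf_neq0 N bx)).
by rewrite ha // a0 mul0r.
Qed.

Lemma C_set_poly (a : {mpoly k[(ng al).+2]}) :
  (forall x, C0_image f al x -> a.@[x 0] = 0) ->
  forall x, C_set f al x -> a.@[x 0] = 0.
Proof. by move=> h x [_ hx]; apply: hx. Qed.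

Lemma C0_image_sub x : C0_image f al x -> C_set f al x.
Proof.
move=> [q hq <-]; split; first by move=> i _; apply: torus_chart_coord.
by move=> h; apply; exists q.
Qed.

Lemma C_set_torus x : C_set f al x -> x 0 ord_max != 0 -> torus x.
Proof. by move=> [h _] xm i; have [->//|] := eqVneq i ord_max; apply: h. Qed.

Definition all_vars : {mpoly k[(ng al).+2]} := \prod_i 'X_i.

Lemma all_varsE (x : 'rV[k]_(ng al).+2) : all_vars.@[x 0] = \prod_i x 0 i.
Proof. by rewrite /all_vars rmorph_prod; apply: eq_bigr => i _; rewrite /= mevalXU. Qed.

Lemma all_vars_neq0 (x : 'rV[k]_(ng al).+2) : all_vars.@[x 0] != 0 <-> torus x.
Proof.
rewrite all_varsE; split=> [/prodf_neq0 h i|h]; first by rewrite h.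
by apply/prodf_neq0 => i _; rewrite h.
Qed.

Lemma regular_over_xmon (e : 'rV[int]_(ng al).+2) :
  regular_over all_vars (fun x => xmon x e).
Proof.
apply: regular_over_prod => i; apply: regular_overXz; first exact: regular_over_coord.
apply: (regular_over_inv (c := \prod_(j | j != i) 'X_j)) => y _.
rewrite all_varsE [RHS](bigD1 i) //= rmorph_prod; congr (_ * _).
by apply: eq_bigr => j _; rewrite /= mevalXU.
Qed.

Lemma regular_over_bullet M i :
  regular_over all_vars (fun x : 'rV[k]_(ng al).+2 => bullet x M 0 i).
Proof.
apply: eq_regular_over (regular_over_xmon (\row_j M j i)) => x _.
by rewrite bulletE.
Qed.

Lemma C0_image_torus x : C0_image f al x -> torus x.
Proof. by move=> [q hq <-]; apply: torus_chart_coord. Qed.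

(** The inverse of [chart_coord] on the image of C_(0,alpha): after the return to x_1, ..., x_m, y,
    the coordinates x_1 and y determine the point of C_0. *)
Definition base_pt (x : 'rV[k]_(ng al).+2) : 'rV[k]_2 :=
  pt2 (bullet x (mat al) 0 0) (bullet x (mat al) 0 ord_max).

Lemma base_ptK q : C0_chart f al q -> base_pt (chart_coord al q) = q.
Proof. by move=> h; rewrite /base_pt chart_coordK // xvec_pt. Qed.

Lemma regular_over_base_pt (h : {mpoly k[2]}) :
  regular_over all_vars (fun x => h.@[(base_pt x) 0]).
Proof.
apply: (regular_over_comp h (F := fun i x => base_pt x 0 i)) => i.
apply: (@eq_regular_over _ _ _ (fun x : 'rV[k]_(ng al).+2 =>
  bullet x (mat al) 0 (if i == 0 then 0 else ord_max))); last first.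
  exact: regular_over_bullet.
by move=> x _; rewrite [RHS]mxE; case: (i == 0).
Qed.

(** C_(0,alpha) is closed in the torus: the relations x_i = g_i(x_1, y) and the equation of C_0 are
    regular there and extend to the closure. So the closure adds points with Y = 0 only. *)
Lemma C_set_Y_neq0 x : C_set f al x -> x 0 ord_max != 0 -> C0_image f al x.
Proof.
move=> Cx xm; have tx := C_set_torus Cx xm.
have [F0 [hC _ _]] := C0_poly f.
have vx : all_vars.@[x 0] != 0 by apply/all_vars_neq0.
set q := base_pt x.
have xq : xvec al q = bullet x (mat al).
  apply/rowP => i; rewrite mxE; apply/eqP; rewrite -subr_eq0; apply/eqP.
  apply: (@C_set_closure all_vars (fun x => (gpoly i).@[(base_pt x) 0] -
     bullet x (mat al) 0 i)) => //.
    apply: regular_overB; first exact: regular_over_base_pt.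
    exact: regular_over_bullet.
  move=> y Cy; split; first by apply/all_vars_neq0/C0_image_torus.
  by case: Cy => q' hq' <-; rewrite base_ptK // chart_coordK // mxE subrr.
have Cq : C0_chart f al q.
  apply/C0_chartP; split; last by rewrite xq; apply: torus_bullet.
  apply/hC; split.
    by move=> i; rewrite mxE; case: ifP => _; apply: torus_bullet.
  apply: (@C_set_closure all_vars (fun x => F0.@[(base_pt x) 0])) => //.
    exact: regular_over_base_pt.
  move=> y Cy; split; first by apply/all_vars_neq0/C0_image_torus.
  case: Cy => q' hq' <-; rewrite base_ptK //.
  by have [/hC[]] := (C0_chartP _ _).1 hq'.
by exists q => //; apply: chart_coord_unique.
Qed.

(** A single denominator for all chart coordinates; on C_0 its nonvanishing locus is C_(0,alpha), as
    x_1 and y are units there. *)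
Definition gdenom : {mpoly k[2]} := \prod_i gpoly (al := al) i.

Lemma gdenom_neq0 (q : 'rV[k]_2) : gdenom.@[q 0] != 0 <-> torus (xvec al q).
Proof.
rewrite /gdenom rmorph_prod; split=> [/prodf_neq0 h i|h].
  by rewrite mxE h.
by apply/prodf_neq0 => i _; have := h i; rewrite mxE.
Qed.

Lemma regular_over_chart_coord i :
  regular_over gdenom (fun q : 'rV[k]_2 => chart_coord al q 0 i).
Proof.
apply: (@eq_regular_over _ _ _ (fun q : 'rV[k]_2 =>
   \prod_j (gpoly (al := al) j).@[q 0] ^ invmx (mat al) j i)).
  by move=> q _; rewrite chart_coordE mxE; apply: eq_bigr => j _; rewrite mxE.
apply: regular_over_prod => j; apply: regular_overXz; first exact: regular_over_poly.
apply: (@regular_over_inv _ _ _ _ (\prod_(j' | j' != j) gpoly j')) => y _.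
by rewrite /gdenom [in RHS](bigD1 j) //= mevalM.
Qed.

Hypothesis f_neq0 : exists e, f e != 0.
Hypothesis cofin : finite_set (C0_set f `\` C0_chart f al).

Lemma chart_immersion :
  exists (U : set (C0 f)) (iota : C0 f -> C_chart f al),
  [/\ finite_set (~` U), open_immersion_on U iota,
      iota @` U = [set x | C0_image f al (\val (x : zar (C_set f al)))]
    & forall q x, @marks k f (Some al) q x <->
        exists p : C0 f, [/\ U p, \val (p : zar (C0_set f)) = q & iota p = x]].
Proof.
have [s hs] := C0_curve_like f_neq0.
have infC := curve_like_infinite_opens hs.
pose pt (p : C0 f) : 'rV[k]_2 := \val (p : zar (C0_set f)).
have ptC p : C0_set f (pt p) by exact: set_mem (valP (p : zar (C0_set f))).
pose U : set (C0 f) := [set p | C0_chart f al (pt p)].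
have fU : finite_set (~` U).
  apply: (finite_of_inj (g := pt)) cofin => [p nUp|p p' _ _ e]; last exact: val_inj.
  by split.
have ex (p : C0 f) : exists x : C_chart f al,
    C0_chart f al (pt p) -> \val (x : zar (C_set f al)) = chart_coord al (pt p).
  have [h|h] := pselect (C0_chart f al (pt p)).
    have Cx : C_set f al (chart_coord al (pt p)) by apply: C0_image_sub; exists (pt p).
    by exists (zpt Cx).
  have infT := infC setT openT (ex_intro _ p I).
  have [p' Up'] : exists p', U p'.
    apply: contrapT => n; apply: infT; apply: sub_finite_set fU => p' _ Up'.
    by apply: n; exists p'.
  have Cx : C_set f al (chart_coord al (pt p')) by apply: C0_image_sub; exists (pt p').
  by exists (zpt Cx).
have [iota hiota] := choice ex.
have oU : open U.
  rewrite (_ : U = [set p : zar (C0_set f) | gdenom.@[(\val p) 0] != 0]).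
    exact: zar_open_basic.
  apply/seteqP; split=> p.
    by move=> /C0_chartP[_ h]; apply/gdenom_neq0.
  by move=> /gdenom_neq0 h; apply/C0_chartP.
have img : iota @` U = [set x | C0_image f al (\val (x : zar (C_set f al)))].
  apply/seteqP; split=> [_ [p Up <-]|x [q hq e]] /=.
    by exists (pt p); rewrite ?hiota.
  have [Cq _] := (C0_chartP _ _).1 hq.
  exists (zpt Cq); first by [].
  by apply: val_inj; rewrite hiota.
exists U, iota; split=> //; last first.
  move=> q x /=; split=> [[hq e]|[p [Up <- <-]]].
    have [Cq _] := (C0_chartP _ _).1 hq.
    by exists (zpt Cq); split=> //; apply: val_inj; rewrite hiota.
  by split; rewrite ?hiota.
(* The inverse [psi] needs a default value in C_0, so an empty C_0 is treated apart. *)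
have [[p0 _]|none] := pselect (exists p : C0 f, True); last first.
  split=> //.
  - move=> V oV; split; last by move=> h hV p; exfalso; apply: none; exists p.
    by rewrite (_ : _ `&` _ = set0); [exact: open0|apply/seteqP; split=> // p;
      exfalso; apply: none; exists p].
  - by move=> p; exfalso; apply: none; exists p.
  - move=> V oV VU; rewrite (_ : _ @` _ = set0); last first.
      by apply/seteqP; split=> // y [p]; exfalso; apply: none; exists p.
    by split; [exact: open0|move=> h _ x].
have ex' (x : C_chart f al) : exists p : C0 f,
    C0_image f al (\val (x : zar (C_set f al))) ->
    pt p = base_pt (\val (x : zar (C_set f al))).
  have [[q hq e]|] := pselect (C0_image f al (\val (x : zar (C_set f al)))); last first.
    by exists p0.
  have [Cq _] := (C0_chartP _ _).1 hq.
  by exists (zpt Cq) => _; rewrite -e base_ptK.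
have [psi hpsi] := choice ex'.
have oV : open (iota @` U).
  rewrite img (_ : [set x | _] =
    [set x : zar (C_set f al) | all_vars.@[(\val x) 0] != 0]).
    exact: zar_open_basic.
  apply/seteqP; split=> x /= h; first by apply/all_vars_neq0/C0_image_torus.
  move/all_vars_neq0: h => h; apply: C_set_Y_neq0; last exact: h.
  exact: set_mem (valP (x : zar (C_set f al))).
have psiK p : U p -> psi (iota p) = p.
  move=> Up; apply: val_inj; rewrite -/(pt _) hpsi hiota // ?base_ptK //.
  by exists (pt p).
apply: (open_immersion_of_inverse (zspace_sheaf_like _) (zspace_sheaf_like _)
  oU oV (psi := psi)).
- apply: (@morphism_on_zspace _ _ _ _ _ _ _ gdenom
    (fun i q => chart_coord al q 0 i)) => //.
  + exact: regular_over_chart_coord.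
  + by move=> p /C0_chartP[_ h]; apply/gdenom_neq0.
  + by move=> p i Up; rewrite hiota.
- apply: (@morphism_on_zspace _ _ _ _ _ _ _ all_vars (fun i x => base_pt x 0 i)) => //.
  + move=> i; apply: eq_regular_over (regular_over_base_pt 'X_i) => x _.
    by rewrite mevalXU.
  + by rewrite img => x /C0_image_torus h; apply/all_vars_neq0.
  + by rewrite img => x i h; rewrite -/(pt _) hpsi.
- by move=> p Up; split; [exists p|apply: psiK].
- by move=> _ [p Up <-]; rewrite psiK.
Qed.

(** C_(0,alpha) is dense in its closure, so a nonempty open set pulls back to a nonempty open set of
    C_0, which is infinite. *)
Lemma chart_infinite_opens : has_infinite_opens (C_chart f al).
Proof.
move=> V oV [x Vx]; have [s hs] := C0_curve_like f_neq0.
have [U [iota [fU oi img hm]]] := chart_immersion.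
have [oU mi inj _] := oi; have [oUV _] := mi V oV.
have [e [e0 eV]] := (zar_openP V).1 oV x Vx.
have [y Cy ey] : exists2 y, C0_image f al y & e.@[y 0] != 0.
  apply: contrapT => n; move/negP: e0; apply; apply/eqP.
  have [_ h] := set_mem (valP (x : zar (C_set f al))).
  by apply: h => y Cy; apply: contrapT => /eqP ny; apply: n; exists y.
have Cy' := C0_image_sub Cy.
have : (iota @` U) (zpt Cy') by rewrite img.
move=> [p Up ep]; have Vp : V (iota p) by rewrite ep; apply: eV.
have := curve_like_infinite_opens hs oUV (ex_intro _ p (conj Up Vp)).
apply: contra_not => fV.
apply: (finite_of_inj (g := iota)) fV => [p' []//|p' p'' [? _] [? _]].
exact: inj.
Qed.

End Chart.

(** * Local rings of \bar C_alpha and regularity of C_alpha *)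

Section GoodCharts.
Variables (k : closedFieldType) (f : laurent k 2).
Implicit Types (al : chart k) (F : {mpoly k[2]}).

(** For [charteq al] this is f|_alpha; the X_j-coordinates of the points of \bar C_alpha are among
    its roots. *)
Definition fbar F : {poly k} := spec 0 (biv F).

Lemma horner_fbar F x : (fbar F).[x] = ev2 F x 0.
Proof. by rewrite -evb_biv. Qed.

Lemma coef_fbar F i : (fbar F)`_i = F@_(mnm2 i 0).
Proof. by rewrite coef_spec horner_coef0 coef_biv. Qed.

Lemma ev2_split_Y F : exists B, forall x y, ev2 F x y = ev2 F x 0 + y * ev2 B x y.
Proof.
elim/mpoly_ring_ind: F => [c|i|p q [A hA] [B hB]|p q [A hA] [B hB]].
- by exists 0 => x y; rewrite ev2_0 !ev2C; ring.
- have [->|->] := ord2P i.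
  + by exists 0 => x y; rewrite !(ev2_0, ev2_X0); ring.
  + by exists 1%:MP => x y; rewrite !(ev2_0, ev2C, ev2_X1); ring.
- by exists (A + B) => x y; rewrite !ev2D hA hB; ring.
exists (A * q + p * B - 'X_1 * A * B) => x y.
by rewrite !(ev2B, ev2D, ev2M, ev2_X1) hA hB; ring.
Qed.

Definition xcoord al (x : 'rV[k]_(ng al).+2) : k := x 0 (xj al).
Definition ycoord al (x : 'rV[k]_(ng al).+2) : k := x 0 ord_max.

Lemma meval_in_chart al F (x : 'rV[k]_(ng al).+2) : (in_chart al F).@[x 0] = ev2 F (xcoord x) (ycoord x).
Proof.
rewrite /in_chart comp_mpoly_meval; apply: meval_eq => i.
rewrite mxE; case: i => [[|[|//]] hi] /=; by rewrite (tnth_nth 0) /= mevalXU.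
Qed.

(* The coordinates on C_alpha are rational functions of X_(j_alpha) and Y,
   whose denominators have no zero on C_alpha. *)
Record good_chart al : Prop := GoodChart {
  good_det : \det (mat al) = 1;
  good_Y : fbar (charteq al) != 0;
  good_eq : forall x, C_set f al x -> ev2 (charteq al) (xcoord x) (ycoord x) = 0;
  good_param : forall i, exists a b : {mpoly k[2]}, forall x, C_set f al x ->
    ev2 b (xcoord x) (ycoord x) != 0 /\
    ev2 b (xcoord x) (ycoord x) * x 0 i = ev2 a (xcoord x) (ycoord x);
  good_cofinite : finite_set (C0_set f `\` C0_chart f al) }.

Lemma meval_taylor n (a : {mpoly k[n]}) (p : 'rV[k]_n) :
  exists A : 'I_n -> {mpoly k[n]}, forall x : 'rV[k]_n,
    a.@[x 0] = a.@[p 0] + \sum_i (x 0 i - p 0 i) * (A i).@[x 0].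
Proof.
elim/mpoly_ring_ind: a => [c|i|u v [A hA] [B hB]|u v [A hA] [B hB]].
- exists (fun=> 0) => x; rewrite big1 => [|i _]; first by rewrite !mevalC addr0.
  by rewrite meval0 mulr0.
- exists (fun j => (j == i)%:R%:MP) => x; rewrite !mevalXU (bigD1 i) //= eqxx mevalC.
  rewrite mulr1 big1 ?addr0 => [|j /negbTE ->]; first by ring.
  by rewrite mevalC mulr0.
- exists (fun i => A i + B i) => x; rewrite !mevalD hA hB.
  under [X in _ = _ + X]eq_bigr do rewrite mevalD mulrDr.
  by rewrite big_split /=; ring.
exists (fun i => A i * v + u.@[p 0] *: B i) => x.
have -> : \sum_i (x 0 i - p 0 i) * (A i * v + u.@[p 0] *: B i).@[x 0] =
    (\sum_i (x 0 i - p 0 i) * (A i).@[x 0]) * v.@[x 0] +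
    u.@[p 0] * (\sum_i (x 0 i - p 0 i) * (B i).@[x 0]).
  rewrite mulr_suml mulr_sumr -big_split; apply: eq_bigr => i _ /=.
  by rewrite mevalD mevalM mevalZ; ring.
by rewrite !mevalM (hA x) (hB x); ring.
Qed.

Section OneChart.
Variables (al : chart k).
Hypothesis good : good_chart al.
Local Notation T := {mpoly k[(ng al).+2]}.

Lemma C0_image_C_set x : C0_image f al x -> C_set f al x.
Proof. exact: C0_image_sub. Qed.

Lemma Cbar_idealP (h : T) : Cbar_ideal f al h <->
  exists b : T, forall x, C0_image f al x -> h.@[x 0] = b.@[x 0] * ycoord x.
Proof.
split=> [[a [b [va ->]]]|[b hb]].
  by exists b => x Cx; rewrite mevalD mevalM mevalXU va // add0r.
exists (h - b * 'X_ord_max), b; split; last by rewrite subrK.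
by move=> x Cx; rewrite mevalB mevalM mevalXU hb // subrr.
Qed.

(* K is an ideal containing that of \bar C_alpha, and [in_local K] is its
   localisation at p. *)
Variable p : 'rV[k]_(ng al).+2.
Hypothesis Cp : Cbar_points f al p.
Variable K : T -> Prop.
Hypothesis KI : forall h, Cbar_ideal f al h -> K h.
Hypothesis KD : forall g h, K g -> K h -> K (g + h).
Hypothesis KM : forall g h, K h -> K (g * h).

Definition in_local (h : T) := exists s : T, s.@[p 0] != 0 /\ K (s * h).

Lemma in_localD g h : in_local g -> in_local h -> in_local (g + h).
Proof.
move=> [s [s0 hs]] [t [t0 ht]]; exists (s * t); rewrite mevalM mulf_neq0 //.
split=> //; rewrite mulrDr; apply: KD; last by rewrite -mulrA; apply: KM.
by rewrite [s * t]mulrC -mulrA; apply: KM.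
Qed.

Lemma in_localM g h : in_local h -> in_local (g * h).
Proof. by move=> [s [s0 hs]]; exists s; rewrite mulrCA; split=> //; apply: KM. Qed.

Lemma in_local_K h : K h -> in_local h.
Proof. by exists 1; rewrite meval1 oner_neq0 mul1r. Qed.

Lemma in_local_unit u h : u.@[p 0] != 0 -> in_local (u * h) -> in_local h.
Proof.
by move=> u0 [s [s0 hs]]; exists (s * u); rewrite mevalM mulf_neq0 // -mulrA.
Qed.

Lemma in_local_sum (I : Type) (r : seq I) (h : I -> T) :
  (forall i, in_local (h i)) -> in_local (\sum_(i <- r) h i).
Proof.
move=> hi; elim/big_rec: _ => [|i x _ IH]; last exact: in_localD.
apply/in_local_K/KI/Cbar_idealP; exists 0 => x _.
by rewrite meval0 mul0r.
Qed.

(** X_j - X_j(p) and Y generate the maximal ideal at p. Indeed X_i = a / b on C_alpha with b a unit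
    at p, and the Taylor expansion of a - p_i b expresses b (X_i - p_i) through them. Y lies in [K]
    already. Here [K] will be the ideal of \bar C_alpha, or a prime containing it. *)
Lemma maximal_in_local :
  in_local ('X_(xj al) - (xcoord p)%:MP) ->
  forall h : T, h.@[p 0] = 0 -> in_local h.
Proof.
move=> hj; have [Cpp yp] := Cp.
have hi i : in_local ('X_i - (p 0 i)%:MP).
  have [a [b hab]] := good_param good i; have [b0 e] := hab p Cpp.
  pose c := a - p 0 i *: b.
  have [A [B hc]] := ev2_taylor c (xcoord p) 0.
  have c0 : ev2 c (xcoord p) 0 = 0.
    by rewrite ev2B ev2Z -yp -e mulrC subrr.
  apply: (@in_local_unit (in_chart al b)); first by rewrite meval_in_chart.
  have -> : in_chart al b * ('X_i - (p 0 i)%:MP) =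
    (in_chart al A * ('X_(xj al) - (xcoord p)%:MP)) +
    (in_chart al b * ('X_i - (p 0 i)%:MP) -
      in_chart al A * ('X_(xj al) - (xcoord p)%:MP)) by rewrite [RHS]addrC subrK.
  apply: in_localD; first exact: in_localM.
  apply/in_local_K/KI/Cbar_idealP; exists (in_chart al B) => x Cx.
  have Cx' := C0_image_C_set Cx; have [bx ex] := hab x Cx'.
  rewrite !(mevalB, mevalM, mevalXU, mevalC) !meval_in_chart mulrBr ex.
  have := hc (xcoord x) (ycoord x); rewrite c0 add0r subr0 ev2B ev2Z => e'.
  have -> : ev2 a (xcoord x) (ycoord x) = p 0 i * ev2 b (xcoord x) (ycoord x) +
    ((xcoord x - xcoord p) * ev2 A (xcoord x) (ycoord x) +
     ycoord x * ev2 B (xcoord x) (ycoord x)) by rewrite -e' [RHS]addrC subrK.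
  by rewrite -/(xcoord x); ring.
move=> h h0; have [A hA] := meval_taylor h p.
pose g := \sum_i A i * ('X_i - (p 0 i)%:MP).
have -> : h = g + (h - g) by rewrite addrC subrK.
apply: in_localD; first by apply: in_local_sum => i; apply: in_localM.
apply/in_local_K/KI/Cbar_idealP; exists 0 => x _.
rewrite meval0 mul0r mevalB hA h0 add0r; apply/eqP; rewrite subr_eq0; apply/eqP.
rewrite /g rmorph_sum; apply: eq_bigr => i _.
by rewrite /= mevalM mevalB mevalXU mevalC mulrC.
Qed.

Definition lift_poly (q : {poly k}) : T := (map_poly (@mpolyC _ k) q).['X_(xj al)].

Lemma meval_lift_poly q (x : 'rV[k]_(ng al).+2) : (lift_poly q).@[x 0] = q.[xcoord x].
Proof.
rewrite /lift_poly; elim/poly_ind: q => [|q c IH].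
  by rewrite rmorph0 !horner0 meval0.
rewrite rmorphD rmorphM /= map_polyX map_polyC /= !hornerMXaddC.
by rewrite mevalD mevalM mevalXU mevalC IH.
Qed.

Lemma lift_fbar : K (lift_poly (fbar (charteq al))).
Proof.
have [B hB] := ev2_split_Y (charteq al).
apply/KI/Cbar_idealP; exists (- in_chart al B) => x Cx.
have := good_eq good (C0_image_C_set Cx); rewrite hB => /eqP.
rewrite addr_eq0 => /eqP e; rewrite meval_lift_poly horner_fbar e mevalN.
by rewrite meval_in_chart mulNr mulrC.
Qed.

End OneChart.

Variables (al : chart k).
Hypothesis good : good_chart al.
Local Notation T := {mpoly k[(ng al).+2]}.

Lemma Cbar_ideal_D (g h : T) :
  Cbar_ideal f al g -> Cbar_ideal f al h -> Cbar_ideal f al (g + h).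
Proof.
move=> [a [b [va ->]]] [c [d [vc ->]]]; exists (a + c), (b + d); split.
  by move=> x Cx; rewrite mevalD va // vc // addr0.
by ring.
Qed.

Lemma Cbar_ideal_M (g h : T) : Cbar_ideal f al h -> Cbar_ideal f al (g * h).
Proof.
move=> [a [b [va ->]]]; exists (g * a), (g * b); split; last by ring.
by move=> x Cx; rewrite mevalM va // mulr0.
Qed.

Lemma max_ideal_prime (p : 'rV[k]_(ng al).+2) : prime_ideal (max_ideal p).
Proof.
split.
  split; rewrite ?inE /= ?meval0 ?eqxx // ?meval1 ?oner_neq0 // => a u v.
  by rewrite !inE mevalD mevalM => /eqP -> /eqP ->; rewrite mulr0 addr0.
by move=> u v; rewrite !inE mevalM mulf_eq0.
Qed.

Lemma Cbar_ideal_max p (h : T) : Cbar_points f al p -> Cbar_ideal f al h ->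
  h.@[p 0] = 0.
Proof.
move=> [[_ vp] yp] [a [b [va ->]]]; rewrite mevalD mevalM mevalXU vp //.
by rewrite (yp : _ = 0) mulr0 addr0.
Qed.

Lemma Cbar_root p : Cbar_points f al p -> (fbar (charteq al)).[xcoord p] = 0.
Proof.
move=> [Cp yp]; have := good_eq good Cp.
by rewrite /ycoord (yp : p 0 ord_max = 0) horner_fbar.
Qed.

(** At a simple root f|_alpha is X_j - X_j(p) times a unit, so the maximal ideal vanishes in the
    local ring of \bar C_alpha. That ring is thus a field, regular of dimension 0. *)
Lemma regular_of_simple_root p : Cbar_points f al p ->
  (mup (xcoord p) (fbar (charteq al)) <= 1)%N -> Cbar_regular_at f p.
Proof.
move=> Cp r1; have [Cpp yp] := Cp.
have F0 := Cbar_root Cp.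
have /factor_theorem[q eq_] : root (fbar (charteq al)) (xcoord p) by apply/rootP.
have q0 : q.[xcoord p] != 0.
  apply/negP => h; have /factor_theorem[q' eq'] : root q (xcoord p) by [].
  have : (2 <= mup (xcoord p) (fbar (charteq al)))%N.
    rewrite mup_geq ?good_Y // eq_ eq' -mulrA -expr2; exact: dvdp_mull.
  by rewrite leqNgt ltnS r1.
have loc (h : T) : h.@[p 0] = 0 -> in_local p (Cbar_ideal f al) h.
  apply: (maximal_in_local good Cp) => //.
  - exact: Cbar_ideal_D.
  - exact: Cbar_ideal_M.
  exists (lift_poly _ q); rewrite meval_lift_poly; split=> //.
  have := lift_fbar good (K := Cbar_ideal f al) (fun _ h => h).
  move=> /Cbar_idealP[b hb]; apply/Cbar_idealP; exists b => x Cx.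
  rewrite -hb // mevalM !meval_lift_poly eq_ hornerM hornerXsubC.
  by rewrite mevalB mevalXU mevalC.
exists 0%N; split.
- exists (fun=> max_ideal p); split=> // [_ _|a Ia]; first exact: max_ideal_prime.
  by rewrite inE (Cbar_ideal_max Cp).
- move=> [q' [q'1 q'2 q'3 q'4]]; have [sub nq] := q'4 0%N isT; apply: nq => a.
  apply/idP/idP => [/sub //|]; rewrite q'3 inE => /eqP /loc[s [s0 /q'2]].
  have [_ pr] := q'1 0%N isT; move=> /pr/orP[/sub|//].
  by rewrite q'3 inE (negbTE s0).
exists (fun=> 0); split=> [[]//|a]; rewrite inE => /eqP /loc[s [s0 hs]].
by exists s, (fun=> 0); rewrite inE s0 big_ord0 subr0.
Qed.

(** The local ring has dimension 0, so regularity makes its maximal ideal zero. Lifted to C_alpha,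
    this says that Y generates the maximal ideal at p. *)
Lemma Cbar_regular_local p : Cbar_points f al p -> Cbar_regular_at f p ->
  forall h : T, h.@[p 0] = 0 -> exists s b : T, s.@[p 0] != 0 /\
    forall x, C_set f al x -> s.@[x 0] * h.@[x 0] = ycoord x * b.@[x 0].
Proof.
move=> Cp [d [[q [q1 q2 q3 q4]] _ [g [_ hg]]]] h h0.
have [Cpp yp] := Cp.
have d0 : d = 0%N.
  case: d => // d in q q1 q2 q3 q4 g hg *; exfalso.
  have [sub nq] := q4 d (leqnn _); apply: nq => a; apply/idP/idP => [/sub //|].
  have qI i : (i <= d)%N -> forall u, Cbar_ideal f al u -> u \in q i.
    elim: i => [|i IH] hi u Iu; first exact: q2.
    have [s _] := q4 i (ltnW hi); apply: s; apply: IH => //; exact: ltnW.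
  have [[z0 n1 hD] pr] := q1 d (leqnSn d).
  have qD u v : u \in q d -> v \in q d -> u + v \in q d.
    by move=> hu hv; rewrite -[u]mul1r; apply: hD.
  have qM u v : v \in q d -> u * v \in q d.
    by move=> hv; rewrite -[_ * _]addr0; apply: hD.
  have subP u : u \in q d -> u.@[p 0] = 0.
    by move=> /sub; rewrite q3 inE => /eqP.
  have loc u : in_local p (fun v => v \in q d) u -> u \in q d.
    move=> [s [s0 /pr /orP[/subP e|//]]].
    by rewrite e eqxx in s0.
  rewrite q3 inE => /eqP a0; apply: loc.
  apply: (maximal_in_local good Cp) => //; first exact: qI.
  apply: in_local_K => //.
  (* The prime [q d] contains f|_alpha(X_j), a product of linear factors, hence one of these. That
     factor vanishes at p, so it is X_j - X_j(p), and [q d] is already the maximal ideal. *)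
  have := lift_fbar good (K := fun v => v \in q d) (qI d (leqnn d)).
  have [rs ers] := closed_field_poly_normal (fbar (charteq al)).
  rewrite /lift_poly ers -mul_polyC rmorphM /= map_polyC /= hornerM hornerC.
  move=> /pr /orP[|].
    move=> /subP; rewrite mevalC => /eqP.
    by rewrite lead_coef_eq0 (negbTE (good_Y good)).
  elim: rs {ers} => [|r rs IH]; first by rewrite big_nil rmorph1 hornerC (negbTE n1).
  rewrite big_cons rmorphM hornerM => /pr /orP[|//].
  rewrite rmorphB /= map_polyX map_polyC /= hornerD hornerN hornerX hornerC => hr.
  have := subP _ hr; rewrite mevalB mevalXU mevalC => /eqP; rewrite subr_eq0.
  by move=> /eqP e; rewrite /xcoord e.
subst d; have hP : h \in max_ideal p by rewrite inE h0.
have [s [c [sP]]] := hg h hP; rewrite big_ord0 subr0 => /Cbar_idealP[b hb].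
exists s, b; split=> // x Cx; apply/eqP; rewrite -subr_eq0; apply/eqP.
have := @C_set_poly k f al (s * h - 'X_ord_max * b) _ x Cx.
rewrite mevalB !mevalM mevalXU; apply => y Cy.
by rewrite mevalB -/(_ * _) !mevalM mevalXU -mevalM hb // mulrC subrr.
Qed.

(** At Y = 0 all coordinates are functions of X_j, which takes its values among the roots of
    f|_alpha. *)
Lemma finite_Cbar_points : finite_set (Cbar_points f al).
Proof.
apply: (finite_of_inj (g := @xcoord al)) (finite_roots (good_Y good)).
  exact: Cbar_root.
move=> x y [Cx yx] [Cy yy] e; apply/rowP => i.
have [a [b hab]] := good_param good i.
have [bx ex] := hab x Cx; have [_ ey] := hab y Cy.
apply: (mulfI bx); rewrite ex.
have ye : ycoord x = ycoord y by rewrite /ycoord (yx : _ = 0) (yy : _ = 0).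
by rewrite e ye ey.
Qed.

Lemma C_chart_affine : exists n (H : set {mpoly k[n]})
    (phi : zspace (zero_locus H) -> C_chart f al),
  open_immersion_on setT phi /\ range phi = setT.
Proof.
apply: (@quasi_affine k (ng al).+2 (vanishing (C0_image f al))
  (\prod_(i | i != ord_max) 'X_i)) => x.
have e : (\prod_(i | i != ord_max) 'X_i : T).@[x 0] = \prod_(i | i != ord_max) x 0 i.
  by rewrite rmorph_prod; apply: eq_bigr => i _; rewrite /= mevalXU.
rewrite e; split=> [[h v]|[/prodf_neq0 h v]]; split=> //.
by apply/prodf_neq0.
Qed.

Hypothesis smooth : smooth_plane_curve f.

Lemma C_chart_regular_point : Cbar_regular f al ->
  forall P : C_chart f al, regular_point P.
Proof.
move=> reg P; have CP : C_set f al (\val (P : zar (C_set f al))).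
  exact: set_mem (valP (P : zar (C_set f al))).
have [y0|y0] := eqVneq (ycoord (\val (P : zar (C_set f al)))) 0; last first.
  have [U [iota [_ oi img _]]] :=
    chart_immersion (good_det good) smooth.1 (good_cofinite good).
  have : (iota @` U) P by rewrite img; apply: C_set_Y_neq0 (good_det good) _ CP y0.
  move=> [p Up <-]; apply: regular_point_immersion oi Up _.
    exact: zspace_sheaf_like.
  exact: C0_regular_point.
apply: (@zspace_regular_point _ _ _ P 'X_ord_max); first by rewrite mevalXU.
move=> h h0; have Cb : Cbar_points f al (\val (P : zar (C_set f al))) by [].
have [s [b [s0 hb]]] := Cbar_regular_local Cb (reg _ Cb) h0.
by exists s, b; split=> // x Cx; rewrite hb // mevalXU.
Qed.

End GoodCharts.

(** * Multiplicities and jacobian ideals *)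

Section Jacobian.
Variable k : closedFieldType.
Implicit Types F G P : {mpoly k[2]}.

Lemma ev2_y_poly (c : {poly k}) x y : ev2 (y_poly c) x y = c.[y].
Proof.
rewrite /y_poly; elim/poly_ind: c => [|q c IH].
  by rewrite rmorph0 !horner0 ev2_0.
rewrite rmorphD rmorphM /= map_polyX map_polyC /= !hornerMXaddC.
by rewrite ev2D ev2M ev2_X1 ev2C IH.
Qed.

Lemma ev2_tG (c : {poly k}) x y : ev2 (tG c) x y = x + c.[y].
Proof. by rewrite /tG ev2D ev2_X0 ev2_y_poly. Qed.

Definition shift_poly F (c : {poly k}) : {mpoly k[2]} :=
  F \mPo [tuple 'X_0 - y_poly c; 'X_1].

Lemma ev2_comp F (P Q : {mpoly k[2]}) x y :
  ev2 (F \mPo [tuple P; Q]) x y = ev2 F (ev2 P x y) (ev2 Q x y).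
Proof.
rewrite /ev2 comp_mpoly_meval; apply: meval_eq => i; rewrite mxE.
by case: i => [[|[|//]] hi] /=; rewrite (tnth_nth 0).
Qed.

Lemma ev2_shift F c x y : ev2 (shift_poly F c) x y = ev2 F (x - c.[y]) y.
Proof. by rewrite ev2_comp ev2B ev2_X0 ev2_X1 ev2_y_poly. Qed.

Lemma mderiv_var (i j : 'I_2) : ('X_j : {mpoly k[2]})^`M(i) = (j == i)%:R%:MP.
Proof.
rewrite mderivX mnm1E; case: eqP => [->|_]; last by rewrite scale0r mpolyC0.
by rewrite scale1r -[X in (X - _)%MM]add0m addmK mpolyX0 mpolyC1.
Qed.

Lemma mderiv0_y_poly c : (y_poly c : {mpoly k[2]})^`M(0) = 0.
Proof.
rewrite /y_poly; elim/poly_ind: c => [|q c IH].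
  by rewrite rmorph0 !horner0 mderiv0.
rewrite rmorphD rmorphM /= map_polyX map_polyC /= !hornerMXaddC.
by rewrite mderivD mderivM IH mderiv_var mderivC mpolyC0 mul0r mulr0 !addr0.
Qed.

Lemma mderiv_shift F c :
  (shift_poly F c)^`M(0) = shift_poly F^`M(0) c /\
  (shift_poly F c)^`M(1) =
    shift_poly F^`M(1) c - (y_poly c)^`M(1) * shift_poly F^`M(0) c.
Proof.
rewrite /shift_poly; set t := [tuple _; _].
elim/mpoly_ring_ind: F => [a|i|p q [p0 p1] [q0 q1]|p q [p0 p1] [q0 q1]].
- by rewrite !(comp_mpolyC, mderivC, comp_mpoly0) mulr0 subr0.
- have [->|->] := ord2P i.
  + rewrite !comp_mpolyXU /= !mderivB mderiv0_y_poly !mderiv_var !comp_mpolyC /=.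
    by rewrite subr0 mpolyC0 mpolyC1 mulr1.
  + rewrite !comp_mpolyXU /= !mderiv_var !comp_mpolyC /=.
    by rewrite mpolyC0 mpolyC1 mulr0 subr0.
- by rewrite !(mderivD, comp_mpolyD) p0 p1 q0 q1; split=> //; ring.
rewrite !(mderivM, comp_mpolyD) !(rmorphM (comp_mpoly t)) /= !mderivM p0 p1 q0 q1.
by split=> //; ring.
Qed.

(* Some power of Y times a unit of the local ring at (x, 0) lies in the
   jacobian ideal of F. *)
Definition jac_bound F (x : k) (N : nat) : Prop :=
  exists u A B C : {mpoly k[2]}, ev2 u x 0 != 0 /\
    u * 'X_1 ^+ N = A * F + B * F^`M(0) + C * F^`M(1).

(** By the chain rule the shift changes the derivative in Y only by a multiple of the derivative in
    X, so it carries the jacobian ideal to the jacobian ideal and fixes Y. *)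
Lemma jac_bound_shift F c N :
  jac_bound F (- c.[0]) N -> jac_bound (shift_poly F c) 0 N.
Proof.
move=> [u [A [B [C [u0 e]]]]]; have [e0 e1] := mderiv_shift F c.
exists (shift_poly u c), (shift_poly A c),
  (shift_poly B c + shift_poly C c * (y_poly c)^`M(1)), (shift_poly C c).
split; first by rewrite ev2_shift sub0r.
apply: ev2_inj => x y; have := congr1 (fun P => ev2 P (x - c.[y]) y) e.
rewrite e0 e1 !(ev2B, ev2D, ev2M, ev2X, ev2_X1, ev2_shift) => ->; ring.
Qed.

Lemma ev2_inj_torus P Q : (forall x y, x != 0 -> y != 0 -> ev2 P x y = ev2 Q x y) ->
  P = Q.
Proof.
move=> h.
have nz (i : 'I_2) : 'X_i != 0 :> {mpoly k[2]}.
  apply/eqP => /(congr1 (mcoeff U_(i)%MM)).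
  by rewrite mcoeffX eqxx mcoeff0 => /eqP; rewrite oner_eq0.
apply: (mulIf (nz 0)); apply: (mulIf (nz 1)); apply: ev2_inj => x y.
rewrite !ev2M ev2_X0 ev2_X1.
have [->|x0] := eqVneq x 0; first by rewrite !mulr0 !mul0r.
have [->|y0] := eqVneq y 0; first by rewrite !mulr0.
by rewrite h.
Qed.

Lemma X1_neq0 : 'X_1 != 0 :> {mpoly k[2]}.
Proof.
apply/eqP => /(congr1 (mcoeff U_(1)%MM)).
by rewrite mcoeffX eqxx mcoeff0 => /eqP; rewrite oner_eq0.
Qed.

Lemma monomial_subst_lcoef n (H G : {mpoly k[n]}) M c (x : 'rV[k]_n) :
  M \in unitmx -> torus x -> monomial_subst (lcoef H) M c G ->
  H.@[(bullet x M) 0] = xmon x c * G.@[x 0].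
Proof.
move=> uM tx hG; rewrite meval_coef_eval.
apply: (monomial_subst_eval uM _ _ tx hG).
  by rewrite map_inj_uniq ?msupp_uniq //; apply: mexp_inj.
by move=> e /lcoef_support[m hm ->]; apply/mapP; exists m.
Qed.

Lemma euler_lcoef n (H G : {mpoly k[n]}) M c (x : 'rV[k]_n) i :
  M \in unitmx -> torus x -> monomial_subst (lcoef H) M c G ->
  xmon x c * (x 0 i * (G^`M(i)).@[x 0] + (G.@[x 0]) *~ c 0 i) =
  \sum_l (bullet x M 0 l * (H^`M(l)).@[(bullet x M) 0]) *~ M i l.
Proof.
move=> uM tx hG; pose s := [seq mexp m | m <- msupp H].
have us : uniq s by rewrite map_inj_uniq ?msupp_uniq //; apply: mexp_inj.
have hs e : lcoef H e != 0 -> e \in s.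
  by move=> /lcoef_support[m hm ->]; apply/mapP; exists m.
rewrite (euler_subst i uM us hs tx hG); apply: eq_bigr => l _; congr (_ *~ _).
transitivity ('X_l * H^`M(l)).@[(bullet x M) 0]; last by rewrite mevalM mevalXU.
rewrite meval_coef_eval /coef_eval; transitivity
  (\sum_(e <- s) lcoef ('X_l * H^`M(l)) e * xmon (bullet x M) e).
  by apply: eq_bigr => e _; rewrite lcoef_euler.
apply: big_support => //.
  by rewrite map_inj_uniq ?msupp_uniq //; apply: mexp_inj.
move=> e nz; have nl : lcoef ('X_l * H^`M(l)) e != 0.
  by apply: contra_neq nz => ->; rewrite mul0r.
apply/andP; split; last first.
  by have [m hm ->] := lcoef_support nl; apply/mapP; exists m.
apply: hs; apply: contra_neq nl => z; by rewrite lcoef_euler z mul0rz.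
Qed.

Lemma fbar_neq0 F : ~ mdivides 'X_1 F -> fbar F != 0.
Proof.
move=> h; apply/eqP => z; apply: h; have [B hB] := ev2_split_Y F.
exists B; apply: ev2_inj => x y; rewrite hB ev2M ev2_X1 -horner_fbar z horner0.
by rewrite add0r mulrC.
Qed.

End Jacobian.

Lemma sum_ord2 (V : nmodType) (F : 'I_2 -> V) : \sum_i F i = F 0 + F 1.
Proof. by rewrite big_ord2. Qed.

(** The power of X in [p] does not contribute to the multiplicity of a nonzero root, so the degree
    exceeds the lowest exponent by at least that multiplicity. *)
Lemma mup_support (k : closedFieldType) (p : {poly k}) x : p != 0 -> x != 0 ->
  exists i1 i2, [/\ p`_i1 != 0, p`_i2 != 0 & (mup x p + i1 <= i2)%N].
Proof.
move=> p0 x0; have [m [q /implyP/(_ p0) nq ep]] := multiplicity_XsubC p 0.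
have q0 : q != 0 by apply: contra_neq p0 => e; rewrite ep e mul0r.
rewrite subr0 in ep.
have h : (mup x p <= (size q).-1)%N.
  have hd : ('X - x%:P) ^+ mup x p %| q.
    have : ('X - x%:P) ^+ mup x p %| q * 'X^m by rewrite -ep -mup_geq.
    rewrite Gauss_dvdpl // coprimep_expl // coprimep_expr // coprimep_sym.
    by rewrite coprimep_XsubC rootE hornerX.
  have := dvdp_leq q0 hd; rewrite size_exp_XsubC.
  by have := q0; rewrite -size_poly_gt0; case: (size q).
exists m, (size p).-1; split.
- by rewrite ep coefMXn ltnn subnn -horner_coef0.
- by rewrite -lead_coefE lead_coef_eq0.
- have sp : size p = (size q + m)%N.
    by rewrite ep size_Mmonic ?monicXn // size_polyXn addnS.
  by rewrite sp; have := q0; rewrite -size_poly_gt0; lia.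
Qed.

(** * Multiplicity and jacobian bound under the substitution by M_beta *)

Section MonomialStep.
Variables (k : closedFieldType) (G Fb : {mpoly k[2]}).
Variables (M : 'M[int]_2) (be e0 : 'rV[int]_2).
Hypotheses (att : attached M be) (pos : pos_primitive be).
Hypothesis sub : monomial_subst (lcoef G) M e0 Fb.
Hypothesis nY : fbar Fb != 0.

Let a := M 0 0.
Let b := M 0 1.
Let b1 := be 0 0.
Let b2 := be 0 1.
Local Notation reg0 := (regular_over ('X_0 : {mpoly k[2]})).

Let M10 : M 1 0 = b1.
Proof.
by case: att => _ e; rewrite /b1 -e mxE; congr (M _ _); apply: val_inj.
Qed.

Let M11 : M 1 1 = b2.
Proof.
by case: att => _ e; rewrite /b2 -e mxE; congr (M _ _); apply: val_inj.
Qed.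

Lemma attached_unit : M \in unitmx.
Proof. by case: att => e _; rewrite unitmxE e unitr1. Qed.

Let det2 : a * b2 - b * b1 = 1.
Proof.
case: att => <- _; rewrite (expand_det_row M 0) big_ord2 /cofactor !det_mx11 !mxE.
rewrite -M10 -M11 /a /b /= expr0 mul1r expr1 mulN1r mulrN.
by congr (_ * M _ _ - _ * M _ _); apply: val_inj.
Qed.

(** The variables of [G] in terms of those of [Fb]. The exponents of y are the entries of beta;
    being positive, they make both variables vanish at y = 0. *)
Let zX x y : k := x ^ a * y ^ b1.
Let zY x y : k := x ^ b * y ^ b2.

Lemma bullet_pt2 x y : bullet (pt2 x y) M = pt2 (zX x y) (zY x y).
Proof.
apply/rowP => j; rewrite mxE big_ord2 /zX /zY -M10 -M11.
by have [->|->] := ord2P j; rewrite !(pt2_0, pt2_1).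
Qed.

Let torus2 x y : x != 0 -> y != 0 -> torus (pt2 x y : 'rV[k]_2).
Proof. by move=> x0 y0 i; rewrite mxE; case: ifP. Qed.

Let b1_gt0 : 0 < b1. Proof. by case: pos. Qed.
Let b2_gt0 : 0 < b2. Proof. by case: pos. Qed.
(** As Y does not divide [Fb], this is the minimum of b1 i + b2 j over the exponents (i, j) of
    [G]. *)
Let d := e0 0 1.

(* The monomials X^i of F_gamma(X, 0) come from the edge b1 i' + b2 j' = d of
   the Newton polygon of G. *)
Lemma coef_Fb i : Fb@_(mnm2 i 0) != 0 ->
  exists i' j' : nat, [/\ G@_(mnm2 i' j') != 0,
    b1 * i'%:Z + b2 * j'%:Z = d & (i'%:Z = b2 * (i%:Z + e0 0 0) - b * d)].
Proof.
move=> nz; have uM := attached_unit.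
have uMT : M^T \in unitmx by rewrite unitmx_tr.
pose e := (mexp (mnm2 i 0) + e0) *m invmx M^T.
have ee : e *m M^T - e0 = mexp (mnm2 i 0) by rewrite /e mulmxKV // addrK.
have [|m hm em] := @lcoef_support k 2 G e; first by rewrite sub ee lcoef_mexp.
exists (m 0), (m 1); have e1 := congr1 (fun v => v + e0) ee.
rewrite subrK em in e1.
have E0 : a * (m 0)%:Z + b * (m 1)%:Z = i%:Z + e0 0 0.
  have := congr1 (fun v : 'rV[int]_2 => v 0 0) e1; rewrite !mxE big_ord2 !mxE mnmE /= => <-.
  by rewrite /a /b; ring.
have E1 : b1 * (m 0)%:Z + b2 * (m 1)%:Z = d.
  have := congr1 (fun v : 'rV[int]_2 => v 0 1) e1; rewrite !mxE big_ord2 !mxE mnmE /= add0r -/d => <-.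
  by rewrite M10 M11; ring.
split=> //; first by rewrite -mnm2E -mcoeff_msupp.
rewrite -E0 -E1 -[LHS]mul1r -det2; ring.
Qed.

Lemma coef_G i' j' : G@_(mnm2 i' j') != 0 -> d <= b1 * i'%:Z + b2 * j'%:Z.
Proof.
rewrite -lcoef_mexp sub => /lcoef_support[m _ /(congr1 (fun v : 'rV[int]_2 => v 0 1))].
rewrite !mxE big_ord2 !mxE !mnmE /= -/d M10 M11 => e.
have := le0z_nat (m 1); rewrite -e; lia.
Qed.

Lemma d_ge0 : 0 <= d.
Proof.
have : lead_coef (fbar Fb) != 0 by rewrite lead_coef_eq0.
rewrite lead_coefE coef_fbar => /coef_Fb[i' [j' [_ <- _]]].
have := b1_gt0; have := b2_gt0; nia.
Qed.

(** The monomial X^r of [G] gives d <= b1 r, so the exponents of X on the edge are at most r. By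
    [mup_support] and [coef_Fb] the edge has horizontal width at least b2 times the multiplicity.
    Equality with r > 0 forces b2 = 1 and an edge that ends at (r, 0), whence d = b1 r. *)
Lemma mult_step r x : x != 0 -> G@_(mnm2 r 0) != 0 ->
  b2 * (mup x (fbar Fb))%:Z <= r%:Z /\
  (mup x (fbar Fb) = r -> (0 < r)%N -> b2 = 1 /\ d = b1 * r%:Z).
Proof.
move=> x0 /coef_G dr; have [i1 [i2 [h1 h2 h]]] := mup_support nY x0.
move: h1 h2; rewrite !coef_fbar => /coef_Fb[i1' [j1 [_ ed1 e1]]].
move=> /coef_Fb[i2' [j2 [_ ed2 e2]]]; set r' := mup _ _ in h *.
have e12 : i2'%:Z = i1'%:Z + b2 * (i2%:Z - i1%:Z) by rewrite e1 e2; ring.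
have p1 := b1_gt0; have p2 := b2_gt0.
have li2 : i2'%:Z <= r%:Z by nia.
have hr' : b2 * r'%:Z <= b2 * (i2%:Z - i1%:Z) by rewrite ler_pM2l //; lia.
split; first by lia.
move=> er r0; have b21 : b2 = 1 by nia.
by split=> //; rewrite b21 !mul1r in hr' e12; nia.
Qed.

Let reg_comp (P : {mpoly k[2]}) : reg0
  (fun v : 'rV[k]_2 => ev2 P (zX (v 0 0) (v 0 1)) (zY (v 0 0) (v 0 1))).
Proof.
apply: (regular_over_comp P
  (F := fun i (v : 'rV[k]_2) => pt2 (zX (v 0 0) (v 0 1)) (zY (v 0 0) (v 0 1)) 0 i)).
move=> i; have [->|->] := ord2P i.
- apply: eq_regular_over (@regular_over_coord2 k 2 0 1 a b1 (ltW b1_gt0)).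
  by move=> v _; rewrite pt2_0.
- apply: eq_regular_over (@regular_over_coord2 k 2 0 1 b b2 (ltW b2_gt0)).
  by move=> v _; rewrite pt2_1.
Qed.

(** The linear relations between logarithmic derivatives, solved for those of [G] by means of the
    determinant a b2 - b b1 = 1. *)
Let euler_G x y : x != 0 -> y != 0 ->
  let E := xmon (pt2 x y) e0 in
  let A0 := x * ev2 Fb^`M(0) x y + ev2 Fb x y * (e0 0 0)%:~R in
  let A1 := y * ev2 Fb^`M(1) x y + ev2 Fb x y * d%:~R in
  [/\ ev2 G (zX x y) (zY x y) = E * ev2 Fb x y,
      zX x y * ev2 G^`M(0) (zX x y) (zY x y) = E * (A0 * b2%:~R - A1 * b%:~R)
    & zY x y * ev2 G^`M(1) (zX x y) (zY x y) = E * (A1 * a%:~R - A0 * b1%:~R)].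
Proof.
move=> x0 y0 E A0 A1; have tx := torus2 x0 y0.
have uM := attached_unit.
have h0 := euler_lcoef 0 uM tx sub; have h1 := euler_lcoef 1 uM tx sub.
have hG := monomial_subst_lcoef uM tx sub.
rewrite bullet_pt2 !meval_ev2 !pt2_0 !pt2_1 in hG.
rewrite sum_ord2 bullet_pt2 !meval_ev2 !pt2_0 !pt2_1 in h0.
rewrite sum_ord2 bullet_pt2 !meval_ev2 !pt2_0 !pt2_1 in h1.
rewrite -(mulrzr (ev2 Fb x y)) -(mulrzr (zX x y * _)) -(mulrzr (zY x y * _)) in h0.
rewrite -(mulrzr (ev2 Fb x y)) -(mulrzr (zX x y * _)) -(mulrzr (zY x y * _)) in h1.
rewrite M10 M11 -/d in h1; rewrite -/a -/b in h0.
rewrite -/E -/A0 in h0; rewrite -/E -/A1 in h1.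
have D : a%:~R * b2%:~R - b%:~R * b1%:~R = 1 :> k by rewrite -!rmorphM -rmorphB det2.
split=> //.
- set p := zX x y * _ in h0 h1 *.
  transitivity (E * A0 * b2%:~R - E * A1 * b%:~R); last by ring.
  rewrite h0 h1; transitivity (p * (a%:~R * b2%:~R - b%:~R * b1%:~R)); last by ring.
  by rewrite D mulr1.
- set p := zY x y * _ in h0 h1 *.
  transitivity (E * A1 * a%:~R - E * A0 * b1%:~R); last by ring.
  rewrite h0 h1; transitivity (p * (a%:~R * b2%:~R - b%:~R * b1%:~R)); last by ring.
  by rewrite D mulr1.
Qed.

(** Multiplied by [zX] times [zY], the relation for [G] involves logarithmic derivatives only. Its
    left side then carries y^(b2 (N + 1) + b1), while on the right y^d comes from the monomial [E]
    and y^m, with m = min(b1, b2), from the remaining factors [zX] and [zY]. Cancelling y^(d + m)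
    gives K; powers of x are units at x0. *)
Lemma jac_step N x0 : x0 != 0 -> jac_bound G 0 N ->
  exists K : nat, jac_bound Fb x0 K /\
    K%:Z + d + Num.min b1 b2 = b2 * N.+1%:Z + b1.
Proof.
move=> x00 [u [A [B [C [u0 eJ]]]]]; have p1 := b1_gt0; have p2 := b2_gt0.
set m := Num.min b1 b2; have [m0 m1 m2] : [/\ 0 <= m, m <= b1 & m <= b2].
  by rewrite /m; split; lia.
(* [zX'] and [zY'] are the old variables divided by their common factor y^m. *)
pose zX' x y : k := x ^ a * y ^ (b1 - m).
pose zY' x y : k := x ^ b * y ^ (b2 - m).
pose T P (v : 'rV[k]_2) := ev2 P (zX (v 0 0) (v 0 1)) (zY (v 0 0) (v 0 1)).
have regc (c : int) : reg0 (fun=> c%:~R).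
  exact: regular_over_const.
have rX' : reg0 (fun v : 'rV[k]_2 => zX' (v 0 0) (v 0 1)).
  by apply: (@regular_over_coord2 k 2 0 1); lia.
have rY' : reg0 (fun v : 'rV[k]_2 => zY' (v 0 0) (v 0 1)).
  by apply: (@regular_over_coord2 k 2 0 1); lia.
have rY : reg0 (fun v : 'rV[k]_2 => zY (v 0 0) (v 0 1)).
  by apply: (@regular_over_coord2 k 2 0 1); lia.
have rx := @regular_over_coord k 2 'X_0 0.
have ry := @regular_over_coord k 2 'X_0 1.
(* The exponent is that of x in zY^N zX zY, minus that of x in the monomial [E], by which both sides
   are divided. *)
have [Nu [Pu hu]] := regular_overM (reg_comp u) (@regular_over_coordXz k 2 0 (b * N%:Z + a + b - e0 0 0)).
have [N1 [P1 h1]] := regular_overD (regular_overD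
  (regular_overM (regular_overM (reg_comp A) rX') rY)
  (regular_overM (regular_overM (reg_comp B) rY') (regc (b2 * e0 0 0 - b * d))))
  (regular_overM (regular_overM (reg_comp C) rX') (regc (a * d - b1 * e0 0 0))).
have [N2 [P2 h2]] := regular_overB
  (regular_overM (regular_overM (regular_overM (reg_comp B) rY') (regc b2)) rx)
  (regular_overM (regular_overM (regular_overM (reg_comp C) rX') (regc b1)) rx).
have [N3 [P3 h3]] := regular_overB
  (regular_overM (regular_overM (regular_overM (reg_comp C) rX') (regc a)) ry)
  (regular_overM (regular_overM (regular_overM (reg_comp B) rY') (regc b)) ry).
(* Each term is multiplied by the other denominators, so that all four share the power Nu + N1 + N2
   + N3 of X. *)
pose u' := Pu * 'X_0 ^+ (N1 + N2 + N3); pose A' := P1 * 'X_0 ^+ (Nu + N2 + N3).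
pose B' := P2 * 'X_0 ^+ (Nu + N1 + N3); pose C' := P3 * 'X_0 ^+ (Nu + N1 + N2).
have dge := d_ge0.
have [K0 eK0] : exists K0 : nat, K0%:Z = b2 * N.+1%:Z + b1.
  by exists (absz (b2 * N.+1%:Z + b1)%R); rewrite gez0_abs //; nia.
have [D eD] : exists D : nat, D%:Z = d + m.
  by exists (absz (d + m)%R); rewrite gez0_abs //; lia.
have main : u' * 'X_1 ^+ K0 =
    'X_1 ^+ D * (A' * Fb + B' * Fb^`M(0) + C' * Fb^`M(1)).
  apply: ev2_inj_torus => x y xn0 yn0.
  have [g0 gx gy] := euler_G xn0 yn0.
  have vx : ('X_0 : {mpoly k[2]}).@[(pt2 x y) 0] != 0 by rewrite mevalXU pt2_0.
  have := hu _ vx; have := h1 _ vx; have := h2 _ vx; have := h3 _ vx.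
  rewrite !mevalXU !pt2_0 !pt2_1 !meval_ev2 !pt2_0 !pt2_1 => q3 q2 q1 qu.
  rewrite !(ev2D, ev2M, ev2X, ev2_X0, ev2_X1) -qu -q1 -q2 -q3 => {qu q1 q2 q3}.
  have := congr1 (fun P => ev2 P (zX x y) (zY x y)) eJ.
  rewrite !(ev2D, ev2M, ev2X, ev2_X1) g0 => eJ'.
  have eX : zX x y = y ^ m * zX' x y.
    by rewrite /zX /zX' mulrCA -expfzDr // addrC subrK.
  have eY : zY x y = y ^ m * zY' x y.
    by rewrite /zY /zY' mulrCA -expfzDr // addrC subrK.
  have eE : xmon (pt2 x y) e0 = x ^ e0 0 0 * y ^ d.
    by rewrite /xmon big_ord2 !pt2_0 !pt2_1.
  have yD : y ^+ D = y ^ d * y ^ m by rewrite -expfzDr // -eD.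
  have yK : y ^+ K0 * x ^ (b * N%:Z + a + b - e0 0 0) =
      (x ^ e0 0 0)^-1 * (zY x y ^+ N * zX x y * zY x y).
    have eN : zY x y ^+ N = x ^ (b * N%:Z) * y ^ (b2 * N%:Z).
      by rewrite /zY exprMn -!exprz_exp.
    have eyK : y ^+ K0 = y ^ (b2 * N%:Z) * y ^ b1 * y ^ b2.
      rewrite -[LHS]/(y ^ K0%:Z) eK0 -!expfzDr //; congr (_ ^ _).
      by rewrite -addn1 PoszD; ring.
    rewrite eN eyK !expfzDr // -invr_expz /zX /zY.
    move: (_^-1) (x ^ (b * N%:Z)) (x ^ a) (x ^ b) (y ^ (b2 * N%:Z)) (y ^ b1) (y ^ b2).
    by move=> w1 w2 w3 w4 w5 w6 w7; ring.
  move: eJ' gx gy yK; set U := ev2 u _ _; set a_ := ev2 A _ _; set b_ := ev2 B _ _.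
  set c_ := ev2 C _ _; set gX := ev2 G^`M(0) _ _; set gY := ev2 G^`M(1) _ _.
  set xk := x ^ (_ - _); set F0 := ev2 Fb x y; set Fx := ev2 Fb^`M(0) x y.
  set Fy := ev2 Fb^`M(1) x y => eJ' gx gy yK.
  have W : U * xk * y ^+ K0 = y ^+ D *
    ((a_ * zX' x y * zY x y + b_ * zY' x y * (b2 * e0 0 0 - b * d)%:~R +
      c_ * zX' x y * (a * d - b1 * e0 0 0)%:~R) * F0 +
     (b_ * zY' x y * b2%:~R * x - c_ * zX' x y * b1%:~R * x) * Fx +
     (c_ * zX' x y * a%:~R * y - b_ * zY' x y * b%:~R * y) * Fy).
    rewrite -mulrA [xk * _]mulrC yK.
    have xe : x ^ e0 0 0 != 0 by rewrite expfz_neq0.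
    apply: (mulfI xe); rewrite mulrCA mulVKf //.
    transitivity (U * zY x y ^+ N * (zX x y * zY x y)); first by ring.
    rewrite eJ'; transitivity (a_ * zX x y * zY x y * (xmon (pt2 x y) e0 * F0) +
      b_ * zY x y * (zX x y * gX) + c_ * zX x y * (zY x y * gY)); first by ring.
    rewrite gx gy eE yD !rmorphB !rmorphM /=.
    rewrite eX eY; move: (zX' x y) (zY' x y) (x ^ e0 0 0) (y ^ d)
      (y ^ m) (a%:~R : k) (b%:~R : k) (b1%:~R : k) (b2%:~R : k) (d%:~R : k)
      ((e0 0 0)%:~R : k).
    by move=> w1 w2 w3 w4 w5 w6 w7 w8 w9 w10 w11; ring.
  by rewrite !exprD; transitivity ((U * xk * y ^+ K0) *
    (x ^+ Nu * x ^+ N1 * x ^+ N2 * x ^+ N3)); [ring|rewrite W; ring].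
have u'0 : ev2 u' x0 0 != 0.
  rewrite /u' ev2M ev2X ev2_X0 mulf_neq0 ?expf_neq0 //.
  rewrite /ev2 -hu ?mevalXU ?pt2_0 // mulf_neq0 ?expf_neq0 // pt2_1
    mulf_neq0 ?expfz_neq0 //.
  rewrite /zX /zY !exp0rz.
  have /negbTE -> : b1 != 0 by rewrite gt_eqF.
  have /negbTE -> : b2 != 0 by rewrite gt_eqF.
  by rewrite !mulr0.
(* Were [D] larger than [K0], then Y would divide [u'], contradicting that [u'] is a unit at (x0,
   0). *)
have [leD|ltD] := leqP D K0; last first.
  case/negP: u'0; apply/eqP.
  have e : u' = 'X_1 ^+ (D - K0) * (A' * Fb + B' * Fb^`M(0) + C' * Fb^`M(1)).
    apply: (mulIf (expf_neq0 K0 (X1_neq0 k))); rewrite main [RHS]mulrAC -exprD subnK //.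
    exact: ltnW.
  rewrite e ev2M ev2X ev2_X1 expr0n subn_eq0 leqNgt ltD.
  by rewrite mul0r.
exists (K0 - D)%N; split; last by rewrite -subzn // eK0 eD; lia.
exists u', A', B', C'; split=> //.
apply: (mulfI (expf_neq0 D (X1_neq0 k))).
by rewrite mulrCA -exprD subnKC // main.
Qed.

End MonomialStep.

(** * Elementary steps *)

Section Insertion.
Variables (k : closedFieldType) (r : nat).

Lemma newposE : newpos r = r.+1 :> nat.
Proof. by rewrite /newpos inordK. Qed.

Lemma lift_newpos_max : lift (newpos r) ord_max = ord_max.
Proof. by apply: val_inj; rewrite /= /bump newposE leqnn. Qed.

Lemma newpos_neq_max : newpos r != ord_max.
Proof. by rewrite -val_eqE /= newposE; apply/eqP; lia. Qed.

Lemma lift_newpos_small (i : 'I_r.+2) : i != ord_max ->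
  nat_of_ord (lift (newpos r) i) = i.
Proof.
move=> ni; have : (i < r.+1)%N.
  by rewrite ltn_neqAle -ltnS ltn_ord andbT.
by rewrite /= /bump newposE => /ltn_geF ->.
Qed.

Lemma lift_newpos_eq_max (i : 'I_r.+2) :
  (lift (newpos r) i == ord_max) = (i == ord_max).
Proof. by rewrite -lift_newpos_max (inj_eq (@lift_inj _ _)). Qed.

Definition ins (X : 'rV[k]_r.+2) (h : k) : 'rV[k]_r.+3 :=
  \row_i if unlift (newpos r) i is Some i' then X 0 i' else h.

Lemma ins_lift X h i : ins X h 0 (lift (newpos r) i) = X 0 i.
Proof. by rewrite mxE liftK. Qed.

Lemma ins_new X h : ins X h 0 (newpos r) = h.
Proof. by rewrite mxE unlift_none. Qed.

Lemma row_ins (Y : 'rV[k]_r.+3) (X : 'rV[k]_r.+2) h :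
  (forall i, Y 0 (lift (newpos r) i) = X 0 i) -> Y 0 (newpos r) = h ->
  Y = ins X h.
Proof.
move=> hX hh; apply/rowP => i; case: (unliftP (newpos r) i) => [j ->|->].
  by rewrite hX ins_lift.
by rewrite hh ins_new.
Qed.

Lemma torus_ins X h : torus (ins X h) <-> torus X /\ h != 0.
Proof.
split=> [t|[t h0] i].
  split=> [i|]; first by rewrite -(ins_lift X h).
  by rewrite -(ins_new X h).
by case: (unliftP (newpos r) i) => [j ->|->]; rewrite ?ins_lift ?ins_new.
Qed.

Lemma insert_mat_lift (M : 'M[int]_r.+2) n i j :
  insert_mat M n (lift (newpos r) i) (lift (newpos r) j) = M i j.
Proof. by rewrite mxE !liftK. Qed.

Lemma insert_mat_col (M : 'M[int]_r.+2) n i :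
  insert_mat M n (lift (newpos r) i) (newpos r) = n 0 i.
Proof. by rewrite mxE liftK unlift_none. Qed.

Lemma insert_mat_row (M : 'M[int]_r.+2) n j :
  insert_mat M n (newpos r) (lift (newpos r) j) = 0.
Proof. by rewrite mxE liftK unlift_none. Qed.

Lemma insert_mat_new (M : 'M[int]_r.+2) n :
  insert_mat M n (newpos r) (newpos r) = 1.
Proof. by rewrite mxE unlift_none. Qed.

Lemma det_insert_mat (M : 'M[int]_r.+2) n : \det (insert_mat M n) = \det M.
Proof.
rewrite (expand_det_row _ (newpos r)) (bigD1_ord (newpos r)) //= big1; last first.
  by move=> j _; rewrite insert_mat_row mul0r.
rewrite addr0 insert_mat_new mul1r /cofactor -signr_odd oddD addbb expr0 mul1r.
by congr (\det _); apply/matrixP => i j; rewrite !mxE !liftK.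
Qed.

(** The inserted column encodes x_(m+1) = X^n X_(m+1): the new coordinate is g freed from its
    monomial factor. *)
Lemma bullet_insert (M : 'M[int]_r.+2) n X h :
  bullet (ins X h) (insert_mat M n) = ins (bullet X M) (xmon X n * h).
Proof.
apply: row_ins => [j|]; rewrite mxE (bigD1_ord (newpos r)) //= ins_new.
  rewrite insert_mat_row expr0z mul1r mxE; apply: eq_bigr => i _.
  by rewrite ins_lift insert_mat_lift.
rewrite insert_mat_new expr1z mulrC; congr (_ * _); apply: eq_bigr => i _.
by rewrite ins_lift insert_mat_col.
Qed.

Definition wid (i : 'I_r.+1) : 'I_r.+3 := lift (newpos r) (widen_ord (leqnSn _) i).

Lemma wid_val i : nat_of_ord (wid i) = i.
Proof.
rewrite lift_newpos_small // -val_eqE /=.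
by apply/eqP; have := ltn_ord i; lia.
Qed.

Lemma dsum_matE (Mb : 'M[int]_2) i j :
  dsum_mat r Mb i j =
    if (i < r.+1)%N then (nat_of_ord i == j)%:R
    else if (j < r.+1)%N then 0 else Mb (inord (i - r.+1)) (inord (j - r.+1)).
Proof.
rewrite /dsum_mat castmxE /block_mx mxE; case: splitP => i' /= ei; rewrite mxE;
  case: splitP => j' /= ej; rewrite ?mxE.
- by rewrite ei ltn_ord ej.
- rewrite ei ltn_ord ej; case: eqP => // e; have := ltn_ord i'; lia.
- by rewrite ei ltnNge leq_addr /= ej ltn_ord.
- rewrite ei ej !ltnNge !leq_addr /= !addKn; congr (Mb _ _);
    by apply: val_inj; rewrite /= inordK.
Qed.

Lemma dsum_wid Mb i j : dsum_mat r Mb (wid i) j = (nat_of_ord i == j)%:R.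
Proof. by rewrite dsum_matE wid_val ltn_ord. Qed.

Lemma dsum_new_wid Mb j : dsum_mat r Mb (newpos r) (wid j) = 0.
Proof. by rewrite dsum_matE newposE ltnn wid_val ltn_ord. Qed.

Lemma dsum_max_wid Mb j : dsum_mat r Mb ord_max (wid j) = 0.
Proof. by rewrite dsum_matE wid_val (ltn_ord j) /= ltnNge leqnSn. Qed.

Lemma dsum_corner (Mb : 'M[int]_2) (M := dsum_mat r Mb) (np := newpos r) :
  [/\ M np np = Mb 0 0, M np ord_max = Mb 0 1,
      M ord_max np = Mb 1 0 & M ord_max ord_max = Mb 1 1].
Proof.
split; rewrite /M dsum_matE ?newposE ?ltnn /= ?[(_ < r.+1)%N]ltnNge ?leqnSn /=;
  rewrite ?subnn ?subSnn; by congr (Mb _ _); apply: val_inj; rewrite /= inordK.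
Qed.

Lemma det_dsum Mb : \det (dsum_mat r Mb) = \det Mb.
Proof.
rewrite /dsum_mat; move: (addn2 r.+1) => e.
have h m n (E E' : m = n) (A : 'M[int]_m) : \det (castmx (E, E') A) = \det A.
  by subst n; rewrite (eq_axiomK E') castmx_id.
by rewrite h det_ublock det1 mul1r.
Qed.

(* The map C_gamma --> C_alpha: the last two coordinates (X_(m+1), Y) of Z are
   replaced by the second coordinate of (X_(m+1), Y) bullet Mb; the first one
   is new_coord. *)
Definition descend (Mb : 'M[int]_2) (Z : 'rV[k]_r.+3) : 'rV[k]_r.+2 :=
  \row_i if i == ord_max then
      Z 0 (newpos r) ^ Mb 0 1 * Z 0 ord_max ^ Mb 1 1
    else Z 0 (lift (newpos r) i).

Definition new_coord (Mb : 'M[int]_2) (Z : 'rV[k]_r.+3) : k :=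
  Z 0 (newpos r) ^ Mb 0 0 * Z 0 ord_max ^ Mb 1 0.

Lemma big_newpos (F : 'I_r.+3 -> k) :
  \prod_i F i = F (newpos r) * ((\prod_(i < r.+1) F (wid i)) * F ord_max).
Proof.
rewrite (bigD1_ord (newpos r)) //= big_ord_recr /= lift_newpos_max.
by congr (_ * (_ * _)).
Qed.

Lemma bullet_dsum Mb Z : bullet Z (dsum_mat r Mb) = ins (descend Mb Z) (new_coord Mb Z).
Proof.
have [eNN eNM eMN eMM] := dsum_corner Mb.
apply: row_ins => [j|]; rewrite mxE big_newpos.
- rewrite mxE; have [->|nj] := eqVneq j ord_max.
    rewrite lift_newpos_max eNM eMM big1 ?mul1r // => i _.
    rewrite dsum_wid; case: eqP => [e|]; last by rewrite expr0z.
    by have := ltn_ord i; rewrite e /= ltnNge leqnSn.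
  have hj : (j < r.+1)%N by rewrite ltn_neqAle -ltnS ltn_ord andbT.
  have -> : lift (newpos r) j = wid (Ordinal hj).
    by rewrite /wid; congr lift; apply: val_inj.
  rewrite dsum_new_wid dsum_max_wid !expr0z mul1r mulr1 (bigD1 (Ordinal hj)) //=.
  rewrite dsum_wid wid_val eqxx expr1z big1 ?mulr1 // => i ni.
  rewrite dsum_wid wid_val; case: eqP => [e|]; last by rewrite expr0z.
  by case/eqP: ni; apply: val_inj.
rewrite eNN eMN big1 ?mul1r // => i _.
rewrite dsum_wid newposE; case: eqP => [e|]; last by rewrite expr0z.
by have := ltn_ord i; rewrite e ltnn.
Qed.

End Insertion.

Section FiniteIntersection.
Variable k : closedFieldType.
Implicit Types (F H : {mpoly k[2]}) (c : {poly k}).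

Definition zero2 H : set (k * k) := [set z | ev2 H z.1 z.2 = 0].

(** The zero set of X + c(Y) is a graph over the Y-line. The restriction of [F] to it is a
    polynomial in Y, nonzero because X + c(Y) does not divide [F]. *)
Lemma finite_zero2_tG F c : ~ mdivides (tG c) F ->
  finite_set (zero2 F `&` zero2 (tG c)).
Proof.
move=> nd; pose R := (biv F).[- c].
have eR y : R.[y] = ev2 F (- c.[y]) y.
  rewrite -evb_biv -[LHS]/(horner_eval y R) /R -horner_map /=.
  by rewrite /evb /horner_eval hornerN.
have R0 : R != 0.
  apply/eqP => z; apply: nd.
  have /factor_theorem[Q eQ] : root (biv F) (- c) by apply/rootP.
  have [Q' hQ'] := evb_surj Q; exists Q'; apply: ev2_inj => x y.
  rewrite ev2M ev2_tG hQ' -evb_biv eQ evbM; congr (_ * _).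
  by rewrite polyCN opprK evbD evbC /evb specX hornerX.
apply: (finite_of_inj (g := snd)) (finite_roots R0).
  move=> [x y] /= [h1 h2]; rewrite eR; move: h2; rewrite /zero2 /= ev2_tG.
  by move=> /eqP; rewrite addr_eq0 => /eqP <-.
move=> [x y] [x' y'] /= [_ h] [_ h'] e; move: h h'; rewrite /zero2 /= !ev2_tG e.
by move=> <- /addIr ->.
Qed.

Lemma finite_zero2_prod (I : eqType) (s : seq I) F (H : I -> {mpoly k[2]}) :
  (forall i, i \in s -> finite_set (zero2 F `&` zero2 (H i))) ->
  finite_set (zero2 F `&` zero2 (\prod_(i <- s) H i)).
Proof.
elim: s => [|i s IH] h.
  rewrite big_nil (_ : _ `&` _ = set0); first exact: finite_set0.
  apply/seteqP; split=> // z [_]; rewrite /zero2 /= /ev2 meval1 => /eqP.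
  by rewrite oner_eq0.
rewrite big_cons; have h1 := h i (mem_head _ _).
have h2 : finite_set (zero2 F `&` zero2 (\prod_(i <- s) H i)).
  by apply: IH => j hj; apply: h; rewrite inE hj orbT.
have : finite_set ((zero2 F `&` zero2 (H i)) `|`
   (zero2 F `&` zero2 (\prod_(i <- s) H i))) by rewrite finite_setU.
apply: sub_finite_set => z [Fz]; rewrite /zero2 /= ev2M => /eqP.
by rewrite mulf_eq0 => /orP[] /eqP; [left|right].
Qed.

End FiniteIntersection.

Section Step.
Variables (k : closedFieldType) (f : laurent k 2) (al : chart k).
Hypothesis good : good_chart f al.
Variables (g : {mpoly k[(ng al).+2]}) (n : 'rV[int]_(ng al).+2) (H : {mpoly k[2]}).
Hypothesis hsub : monomial_subst (lcoef g) (mat al) n (in_chart al H).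
Hypothesis fin : finite_set (zero2 (charteq al) `&` zero2 H).

Let X q := chart_coord al q.
Let hq q := ev2 H (xcoord (X q)) (ycoord (X q)).

Lemma step_eval q : C0_chart f al q -> g.@[(xvec al q) 0] = xmon (X q) n * hq q.
Proof.
move=> Cq; rewrite -(chart_coordK (good_det good) Cq).
rewrite (monomial_subst_lcoef (mat_unit (good_det good)) _ hsub).
  by rewrite meval_in_chart.
exact: torus_chart_coord Cq.
Qed.

Section AnyChart.
Variables (v : 'rV[int]_(ng al).+3) (M : 'M[int]_((ng al).+3)) (j : 'I_(ng al).+2).
Variable F : {mpoly k[2]}.
(** C_(0,gamma) depends on the functions g_i only, so one argument covers tilde alpha and all beta
    o_g alpha. *)
Let ga := @Chart k (ng al).+1 v (circ_gs g) M j F.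

Lemma xvec_circ q : xvec ga q = ins (xvec al q) (g.@[(xvec al q) 0]).
Proof.
apply: row_ins => [i|].
  rewrite !mxE; congr (_.@[_]); have [->|ni] := eqVneq i ord_max.
    by rewrite lift_newpos_max !gpoly_max.
  rewrite /gpoly lift_newpos_small //.
  have hi : (i < (ng al).+1)%N by rewrite ltn_neqAle -ltnS ltn_ord andbT.
  rewrite !nth_rcons /= !size_rcons !size_tuple ltnW // hi.
  case: (nat_of_ord i) hi => [//|i'] /= hi'.
  by rewrite nth_rcons size_tuple -ltnS hi'.
rewrite mxE /gpoly newposE nth_rcons /= size_rcons size_tuple ltnS leqnn.
rewrite nth_rcons size_tuple ltnn eqxx comp_mpoly_meval.
by apply: meval_eq => i; rewrite mxE /gpoly (tnth_nth 0).
Qed.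

Lemma C0_chart_circ q : C0_chart f ga q <-> C0_chart f al q /\ hq q != 0.
Proof.
have nz : C0_chart f al q -> xmon (X q) n != 0.
  by move=> h; apply: xmon_neq0; apply: torus_chart_coord h.
split=> [/C0_chartP[Cq]|[h h0]].
  rewrite xvec_circ => /torus_ins[tq]; have h : C0_chart f al q by apply/C0_chartP.
  by rewrite step_eval // mulf_eq0 negb_or => /andP[_ ?].
apply/C0_chartP; have [Cq tq] := (C0_chartP _ _ _).1 h; split=> //.
by rewrite xvec_circ; apply/torus_ins; rewrite step_eval // mulf_neq0 // nz.
Qed.

(** A point of C_(0,alpha) is determined by (X_j, Y), and the points lost in this step have (X_j, Y)
    in the finite intersection of F_alpha = 0 and H = 0. *)
Lemma circ_cofinite : finite_set (C0_set f `\` C0_chart f ga).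
Proof.
have h : finite_set (C0_chart f al `&` [set q | hq q = 0]).
  apply: (finite_of_inj (g := fun q => (xcoord (X q), ycoord (X q)))) fin.
    move=> q [Cq e]; split=> //=; apply: (good_eq good).
    by apply: C0_image_sub; exists q.
  move=> q q' [Cq _] [Cq' _] [ex ey]; apply: (chart_coord_inj (good_det good) Cq Cq').
  apply/rowP => i; have [a [b hab]] := good_param good i.
  have [|b0 e1] := hab (X q); first by apply: C0_image_sub; exists q.
  have [|_ e2] := hab (X q'); first by apply: C0_image_sub; exists q'.
  by apply: (mulfI b0); rewrite e1 ex ey e2.
have : finite_set ((C0_set f `\` C0_chart f al) `|`
    (C0_chart f al `&` [set q | hq q = 0])).
  by rewrite finite_setU; split=> //; exact: good_cofinite good.
apply: sub_finite_set => q [Cq nq].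
have [Cal|] := pselect (C0_chart f al q); last by left.
right; split=> //=; apply: contrapT => /eqP h0; apply: nq; exact/C0_chart_circ.
Qed.

End AnyChart.

Let ta := tilde_chart g n.

Lemma det_tilde : \det (mat ta) = 1.
Proof. by rewrite /ta /= det_insert_mat (good_det good). Qed.

Lemma tilde_coord q : C0_chart f ta q -> chart_coord ta q = ins (X q) (hq q).
Proof.
move=> Cq; have [Cal h0] := (C0_chart_circ _ _ _ _ _).1 Cq.
apply: (chart_coord_unique det_tilde Cq).
  by apply/torus_ins; split=> //; apply: torus_chart_coord Cal.
rewrite bullet_insert (chart_coordK (good_det good) Cal) -step_eval //.
by rewrite xvec_circ.
Qed.

Definition old (y : 'rV[k]_(ng al).+3) : 'rV[k]_(ng al).+2 :=
  \row_i y 0 (lift (newpos (ng al)) i).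

Lemma old_ins x h : old (ins x h) = x.
Proof. by apply/rowP => i; rewrite mxE ins_lift. Qed.

Lemma xj_neq_max (be : chart k) : xj be != ord_max.
Proof. by rewrite -val_eqE /= neq_ltn ltn_ord. Qed.

Lemma xj_tilde : xj ta = lift (newpos (ng al)) (xj al).
Proof. by apply: val_inj; apply/esym; exact: lift_newpos_small (xj_neq_max al). Qed.

Lemma xcoord_old y : xcoord (old y) = xcoord (al := ta) y.
Proof. by rewrite /xcoord mxE xj_tilde. Qed.

Lemma ycoord_old y : ycoord (old y) = ycoord (al := ta) y.
Proof. by rewrite /ycoord mxE lift_newpos_max. Qed.

Lemma tilde_C_set y : C_set f ta y ->
  C_set f al (old y) /\ y 0 (newpos (ng al)) = ev2 H (xcoord (old y)) (ycoord (old y)).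
Proof.
move=> Cy; have [ny _] := Cy.
have reg i : regular_over (1 : {mpoly k[(ng ta).+2]}) (fun y => old y 0 i).
  by apply: eq_regular_over (regular_over_coord _ (lift (newpos (ng al)) i)) => z _;
    rewrite mxE.
have one (z : 'rV[k]_(ng ta).+2) : (1 : {mpoly k[(ng ta).+2]}).@[z 0] != 0.
  by rewrite meval1 oner_neq0.
split; last first.
  rewrite xcoord_old ycoord_old; apply/eqP; rewrite -subr_eq0; apply/eqP.
  apply: (@C_set_closure k f ta 1 (fun y => y 0 (newpos (ng al)) -
     ev2 H (xcoord (al := ta) y) (ycoord (al := ta) y))) => //.
    apply: regular_overB; first exact: regular_over_coord.
    apply: eq_regular_over (regular_over_poly _ (in_chart ta H)) => z _.
    by rewrite meval_in_chart.
  move=> z [q Cq <-]; split=> //.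
  by rewrite -xcoord_old -ycoord_old tilde_coord // ins_new old_ins subrr.
split=> [i ni|v hv]; first by rewrite mxE; apply: ny; rewrite lift_newpos_eq_max.
apply: (@C_set_closure k f ta 1 (fun y => v.@[(old y) 0])) => //.
  exact: (regular_over_comp v (F := fun i y => old y 0 i)).
move=> z [q Cq <-]; split=> //.
have [Cal _] := (C0_chart_circ _ _ _ _ _).1 Cq.
by rewrite tilde_coord // old_ins; apply: hv; exists q.
Qed.

Lemma tilde_good : good_chart f ta.
Proof.
split.
- exact: det_tilde.
- exact: good_Y good.
- move=> y /tilde_C_set[Cy _]; rewrite -xcoord_old -ycoord_old.
  exact: good_eq good _ Cy.
- move=> i; case: (unliftP (newpos (ng al)) i) => [i' ->|->].
    have [a [b hab]] := good_param good i'; exists a, b => y /tilde_C_set[Cy _].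
    by have := hab _ Cy; rewrite xcoord_old ycoord_old mxE.
  exists H, 1%:MP => y /tilde_C_set[Cy e].
  by rewrite !ev2C oner_neq0 mul1r e xcoord_old ycoord_old.
- exact: circ_cofinite.
Qed.

(** X_(m+1) is invertible on T_v and equals H(X_j, Y) on the curve, so the points of \bar C_alpha at
    which H vanishes are absent from the new chart. *)
Lemma tilde_points y : Cbar_points f ta y ->
  [/\ Cbar_points f al (old y), xcoord (old y) = xcoord (al := ta) y
    & ev2 H (xcoord (old y)) 0 != 0].
Proof.
move=> [Cy yy]; have [Co e] := tilde_C_set Cy; have [ny _] := Cy.
have y0 : ycoord (old y) = 0 by rewrite ycoord_old.
split; [by split|exact: xcoord_old|].
rewrite y0 in e; rewrite -e; apply: ny; exact: newpos_neq_max.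
Qed.

Section Circ.
Variables (c : {poly k}) (be e0 : 'rV[int]_2) (Mb : 'M[int]_2) (Fb : {mpoly k[2]}).
Hypothesis eH : H = tG c.
Hypotheses (att : attached Mb be) (pos : pos_primitive be).
Hypothesis nY : ~ mdivides 'X_1 Fb.
Hypothesis sub : monomial_subst (lcoef (shift_eqn al c)) Mb e0 Fb.

Let ca := circ_chart be g n Mb Fb.
Local Notation np := (newpos (ng al)).

Let be0 : Mb 1 0 = be 0 0.
Proof. by case: att => _ <-; rewrite mxE; congr (Mb _ _); apply: val_inj. Qed.

Let be1 : Mb 1 1 = be 0 1.
Proof. by case: att => _ <-; rewrite mxE; congr (Mb _ _); apply: val_inj. Qed.

Lemma det_circ : \det (mat ca) = 1.
Proof.
by rewrite /ca /= det_mulmx det_dsum det_insert_mat (good_det good) mulr1; case: att.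
Qed.

(** M_gamma is the product of the block matrix of M_beta and the matrix of [ta]. Applying the block
    matrix to the coordinates for gamma therefore gives those in [ta], namely (X, H). *)
Lemma circ_coord q : C0_chart f ca q ->
  [/\ torus (chart_coord ca q), descend Mb (chart_coord ca q) = X q
    & new_coord Mb (chart_coord ca q) = hq q].
Proof.
move=> Cq; have [Cal h0] := (C0_chart_circ _ _ _ _ _).1 Cq.
have tq := torus_chart_coord Cq.
have Ct : C0_chart f ta q by apply/C0_chart_circ.
have e : ins (descend Mb (chart_coord ca q)) (new_coord Mb (chart_coord ca q)) =
    ins (X q) (hq q).
  rewrite -bullet_dsum -(tilde_coord Ct); apply/esym.
  apply: (chart_coord_unique det_tilde Ct); first exact: torus_bullet.
  rewrite bulletM // (chart_coordK det_circ Cq).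
  by rewrite /ca /ta !xvec_circ.
split=> //; first by rewrite -[LHS](old_ins _ (new_coord Mb (chart_coord ca q))) e old_ins.
by rewrite -[LHS](ins_new (descend Mb (chart_coord ca q))) e ins_new.
Qed.

Lemma xj_circ : xj ca = np.
Proof. by apply: val_inj; rewrite /= newposE. Qed.

Lemma xcoord_circ (Z : 'rV[k]_(ng al).+3) : xcoord (al := ca) Z = Z 0 np.
Proof. by rewrite /xcoord xj_circ. Qed.

Local Notation T := {mpoly k[(ng ca).+2]}.

Let reg_down i : regular_over ('X_np : T) (fun Z => descend Mb Z 0 i).
Proof.
have [->|ni] := eqVneq i ord_max.
  have h : 0 <= Mb 1 1 by rewrite be1; case: pos => _ /ltW.
  apply: eq_regular_over (@regular_over_coord2 k _ np ord_max (Mb 0 1) _ h) => Z _.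
  by rewrite mxE eqxx.
apply: eq_regular_over (regular_over_coord _ (lift np i)) => Z _.
by rewrite mxE (negbTE ni).
Qed.

Let reg_new : regular_over ('X_np : T) (new_coord Mb).
Proof.
have h : 0 <= Mb 1 0 by rewrite be0; case: pos => /ltW.
exact: regular_over_coord2.
Qed.

Lemma circ_C_set Z : C_set f ca Z ->
  [/\ Z 0 np != 0, C_set f al (descend Mb Z) &
      xcoord (descend Mb Z) = new_coord Mb Z - c.[ycoord (descend Mb Z)]].
Proof.
move=> CZ; have [nZ _] := CZ; have Z0 : Z 0 np != 0 by apply: nZ; exact: newpos_neq_max.
have np0 (z : 'rV[k]_(ng ca).+2) : C0_image f ca z -> ('X_np : T).@[z 0] != 0.
  by move=> [q Cq <-]; rewrite mevalXU; apply: (torus_chart_coord Cq).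
split=> //; last first.
  apply/eqP; rewrite -subr_eq0 opprB addrA; apply/eqP.
  apply: (@C_set_closure k f ca 'X_np (fun Z => xcoord (descend Mb Z) +
     c.[ycoord (descend Mb Z)] - new_coord Mb Z)); last by rewrite mevalXU.
  - apply: regular_overB reg_new; apply: regular_overD; first exact: reg_down.
    apply: eq_regular_over (regular_over_comp (y_poly c)
       (F := fun i Z => pt2 0 (descend Mb Z 0 ord_max) 0 i) _) => [z _|i].
      by rewrite -/(ev2 _ _ _) ev2_y_poly.
    apply: eq_regular_over (_ : regular_over _ (fun Z => if i == 0 then 0 else
      descend Mb Z 0 ord_max)); first by move=> z _; rewrite [RHS]mxE.
    by case: (i == 0); [exact: regular_over_const|exact: reg_down].
  - move=> z Cz; split; first exact: np0.
    case: Cz => q Cq <-; have [_ -> ->] := circ_coord Cq.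
    by rewrite /hq eH ev2_tG subrr.
  - by [].
split=> [i ni|v hv].
  by rewrite mxE (negbTE ni); apply: nZ; rewrite lift_newpos_eq_max.
apply: (@C_set_closure k f ca 'X_np (fun Z => v.@[(descend Mb Z) 0])) => //.
- exact: (regular_over_comp v (F := fun i Z => descend Mb Z 0 i)).
- move=> z Cz; split; first exact: np0.
  case: Cz => q Cq <-; have [_ -> _] := circ_coord Cq.
  have [Cal _] := (C0_chart_circ _ _ _ _ _).1 Cq.
  by apply: hv; exists q.
- by rewrite mevalXU.
Qed.

Lemma bullet_new_down (Z : 'rV[k]_(ng al).+3) :
  bullet (pt2 (Z 0 np) (Z 0 ord_max)) Mb = pt2 (new_coord Mb Z) (ycoord (descend Mb Z)).
Proof.
apply/rowP => j; rewrite mxE big_ord2 pt2_0 pt2_1 [RHS]mxE.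
case: j => [[|[|//]] hj] /=; [rewrite /new_coord|rewrite /ycoord mxE eqxx];
  by congr (_ ^ Mb _ _ * _ ^ Mb _ _); apply: val_inj.
Qed.

(** The monomial substitution can be evaluated on the torus; the resulting equation is polynomial
    and passes to the closure. *)
Lemma circ_eq Z : C_set f ca Z -> ev2 Fb (xcoord (al := ca) Z) (ycoord (al := ca) Z) = 0.
Proof.
move=> CZ; rewrite -meval_in_chart; apply: C_set_poly CZ => z Cz.
have tz := C0_image_torus Cz; have [_ Cd ed] := circ_C_set (C0_image_sub Cz).
rewrite meval_in_chart xcoord_circ.
have t2 : torus (pt2 (z 0 np) (z 0 ord_max)) by move=> i; rewrite mxE; case: ifP.
have := monomial_subst_lcoef (attached_unit att) t2 sub.
rewrite bullet_new_down !meval_ev2 !pt2_0 !pt2_1.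
rewrite -[shift_eqn al c]/(shift_poly (charteq al) c) ev2_shift -ed.
rewrite (good_eq good Cd) => /esym /eqP; rewrite mulf_eq0.
by rewrite (negbTE (xmon_neq0 _ t2)) => /eqP.
Qed.

(** The two old variables are polynomial in Y and Laurent in X_(m+1), which is a unit on C_gamma.
    Fractions with invertible denominators thus remain such in the new chart. *)
Lemma circ_subst (P : {mpoly k[2]}) : exists (N : nat) (P' : {mpoly k[2]}),
  forall Z, C_set f ca Z ->
    ev2 P (xcoord (descend Mb Z)) (ycoord (descend Mb Z)) * Z 0 np ^+ N =
    ev2 P' (Z 0 np) (Z 0 ord_max).
Proof.
pose zz (v : 'rV[k]_2) : 'rV[k]_2 := bullet v Mb.
have regz i : regular_over ('X_0 : {mpoly k[2]}) (fun v => zz v 0 i).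
  have hi : 0 <= Mb 1 i.
    have [->|->] := ord2P i.
    + by rewrite be0; case: pos => /ltW.
    + by rewrite be1; case: pos => _ /ltW.
  apply: eq_regular_over (@regular_over_coord2 k 2 0 1 (Mb 0 i) _ hi) => v _.
  by rewrite mxE big_ord2.
have [N [P' h]] := regular_over_comp (shift_poly P c) regz.
exists N, P' => Z CZ; have [Z0 _ ed] := circ_C_set CZ.
have := h (pt2 (Z 0 np) (Z 0 ord_max)); rewrite mevalXU pt2_0 => /(_ Z0).
rewrite -/(ev2 P' _ _) => <-; congr (_ * _).
rewrite -[RHS]/((shift_poly P c).@[(zz (pt2 (Z 0 np) (Z 0 ord_max))) 0]).
by rewrite /zz bullet_new_down meval_ev2 pt2_0 pt2_1 ev2_shift ed.
Qed.

Lemma circ_good : good_chart f ca.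
Proof.
split.
- exact: det_circ.
- exact: fbar_neq0.
- exact: circ_eq.
- move=> i; case: (unliftP np i) => [i' ->|->]; last first.
    exists 'X_0, 1%:MP => Z CZ.
    by rewrite !ev2C oner_neq0 mul1r ev2_X0 xcoord_circ.
  have [->|ni] := eqVneq i' ord_max.
    exists 'X_1, 1%:MP => Z CZ.
    by rewrite !ev2C oner_neq0 mul1r ev2_X1 lift_newpos_max.
  have [a [b hab]] := good_param good i'.
  have [Na [a' ha]] := circ_subst a; have [Nb [b' hb]] := circ_subst b.
  exists (a' * 'X_0 ^+ Nb), (b' * 'X_0 ^+ Na) => Z CZ.
  have [Z0 Cd _] := circ_C_set CZ; have [b0 e] := hab _ Cd.
  rewrite !(ev2M, ev2X, ev2_X0) xcoord_circ -[ycoord _]/(Z 0 ord_max) -ha // -hb //.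
  rewrite !mulf_neq0 ?expf_neq0 //; split=> //.
  by rewrite -e [descend Mb Z 0 i']mxE (negbTE ni); ring.
- exact: circ_cofinite.
Qed.

(** Both entries of beta are positive, so at Y = 0 both tG_p and tilde Y vanish: the new points lie
    over X_j = -c(0), that is over p. *)
Lemma circ_points Z : Cbar_points f ca Z ->
  [/\ xcoord (al := ca) Z != 0, Cbar_points f al (descend Mb Z)
    & xcoord (descend Mb Z) = - c.[0]].
Proof.
move=> [CZ Zy]; have [Z0 Cd ed] := circ_C_set CZ.
have zy : Z 0 ord_max = 0 by [].
have b0 : be 0 0 != 0 by case: pos => h _ _; rewrite gt_eqF.
have b1 : be 0 1 != 0 by case: pos => _ h _; rewrite gt_eqF.
have y0 : ycoord (descend Mb Z) = 0.
  by rewrite /ycoord mxE eqxx zy be1 exp0rz (negbTE b1) mulr0.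
split; [by rewrite xcoord_circ|by split|].
by rewrite ed y0 /new_coord zy be0 exp0rz (negbTE b0) mulr0 sub0r.
Qed.

End Circ.

End Step.

(** * Finiteness of the set of edge normals *)

Section Primitive.
Implicit Types u v w : 'rV[int]_2.

Lemma idot2 v u : idot v u = v 0 0 * u 0 0 + v 0 1 * u 0 1.
Proof. by rewrite /idot sum_ord2. Qed.

(** In the plane [v] and [w] are proportional. A Bezout relation for the entries of [v] makes the
    factor [t] an integer, and primitivity of [w] makes it a unit. *)
Lemma primitive_orthogonal u v w : u != 0 -> primitive v -> primitive w ->
  idot v u = 0 -> idot w u = 0 -> w = v \/ w = - v.
Proof.
move=> u0 pv pw; rewrite !idot2 => hv hw.
have cr : v 0 0 * w 0 1 = v 0 1 * w 0 0.
  have [e0|n0] := eqVneq (u 0 0) 0.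
    have n1 : u 0 1 != 0.
      apply: contra_neq u0 => e1; rewrite [u]row2E e0 e1.
      by apply/rowP => i; rewrite !mxE; case: ifP.
    rewrite e0 mulr0 add0r in hv; rewrite e0 mulr0 add0r in hw.
    move/eqP: hv; rewrite mulf_eq0 (negbTE n1) orbF => /eqP ->.
    move/eqP: hw; rewrite mulf_eq0 (negbTE n1) orbF => /eqP ->.
    by rewrite mulr0 mul0r.
  apply: (mulIf n0).
  have -> : v 0 0 * w 0 1 * u 0 0 = (v 0 0 * u 0 0) * w 0 1 by ring.
  have -> : v 0 1 * w 0 0 * u 0 0 = v 0 1 * (w 0 0 * u 0 0) by ring.
  have -> : v 0 0 * u 0 0 = - (v 0 1 * u 0 1) by lia.
  have -> : w 0 0 * u 0 0 = - (w 0 1 * u 0 1) by lia.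
  by ring.
have [[a b] hab] : exists ab : int * int, ab.1 * v 0 0 + ab.2 * v 0 1 = 1.
  pose v0 := v 0 0; pose v1 := v 0 1.
  have [a [b hab]] := Bezoutz v0 v1.
  have g1 : (gcdz v0 v1 %| 1)%Z.
    apply: pv => i; have [->|->] := ord2P i.
    + by apply: dvdz_gcdl.
    + by apply: dvdz_gcdr.
  exists (a, b); rewrite /= -/v0 -/v1 hab; move: g1; rewrite dvdz1.
  by rewrite /gcdz absz_nat => /eqP ->.
set t := a * w 0 0 + b * w 0 1.
have w0 : w 0 0 = t * v 0 0.
  rewrite -[LHS]mul1r -hab /=.
  have -> : (a * v 0 0 + b * v 0 1) * w 0 0 = a * v 0 0 * w 0 0 + b * (v 0 1 * w 0 0)
    by ring.
  by rewrite -cr /t; ring.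
have w1 : w 0 1 = t * v 0 1.
  rewrite -[LHS]mul1r -hab /=.
  have -> : (a * v 0 0 + b * v 0 1) * w 0 1 = a * (v 0 0 * w 0 1) + b * v 0 1 * w 0 1
    by ring.
  by rewrite cr /t; ring.
have t1 : (t %| 1)%Z.
  apply: pw => i; have [->|->] := ord2P i.
  + by rewrite [X in (_ %| X)%Z]w0 dvdz_mulr.
  + by rewrite [X in (_ %| X)%Z]w1 dvdz_mulr.
have [ht|ht] : t = 1 \/ t = -1 by move: t1; rewrite dvdz1; lia.
  by left; rewrite [w]row2E [v]row2E w0 w1 ht !mul1r.
right; rewrite [w]row2E w0 w1 ht !mulN1r; apply/rowP => i; rewrite !mxE.
by have [->|->] := ord2P i.
Qed.

Lemma finite_primitive_orthogonal u : u != 0 ->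
  finite_set [set v | primitive v /\ idot v u = 0].
Proof.
move=> u0; have [[v [pv hv]]|n] := pselect (exists v, primitive v /\ idot v u = 0).
  apply: (@sub_finite_set _ _ [set v; - v]); last exact: finite_set2.
  by move=> w [pw hw]; have [->|->] := primitive_orthogonal u0 pv pw hv hw; [left|right].
rewrite (_ : [set _ | _] = set0); first exact: finite_set0.
by apply/seteqP; split=> // v hv; apply: n; exists v.
Qed.

Lemma finite_edge_directions (s : seq 'rV[int]_2) :
  finite_set [set v | primitive v /\ exists e e', [/\ e \in s, e' \in s, e != e'
    & idot v e = idot v e']].
Proof.
pose D := [set z : 'rV[int]_2 * 'rV[int]_2 | [/\ z.1 \in s, z.2 \in s & z.1 != z.2]].
have fD : finite_set D.
  apply: (@sub_finite_set _ _ ([set` s] `*` [set` s])).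
    by move=> [x y] [/= hx hy _].
  by apply: finite_setX; apply: finite_seq.
have : finite_set (\bigcup_(z in D) [set v | primitive v /\ idot v (z.1 - z.2) = 0]).
  apply: bigcup_finite => // -[x y] [/= _ _ ne].
  by apply: finite_primitive_orthogonal; rewrite subr_eq0.
apply: sub_finite_set => v [pv [e [e' [he he' ne eq_]]]].
exists (e, e') => //; split=> //=; move/eqP: eq_; rewrite -subr_eq0 => /eqP <-.
by rewrite !idot2 !mxE; ring.
Qed.

End Primitive.

(** * The charts of Sigma_1 *)

Section FirstStep.
Variables (k : closedFieldType) (f : laurent k 2).
Hypothesis smooth : smooth_plane_curve f.

Lemma finite_edge_normals : finite_set [set v | edge_normal f v].
Proof.
apply: sub_finite_set (finite_edge_directions (finsupp f)) => v.
move=> [pv [c [_ [e [e' [ne fe fe' h h']]]]]]; split=> //; exists e, e'.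
by split; rewrite ?mem_finsupp //; move: h h'; lia.
Qed.

(** F_alpha is prescribed up to a monomial with Y excluded as a factor, so X may divide it;
    [bezout_three] asks for a polynomial without the factor X. *)
Lemma factor_X0 (F : {mpoly k[2]}) : F != 0 -> exists (d : nat) F',
  F = 'X_0 ^+ d * F' /\ ~ (exists u, biv F' = 'X * u).
Proof.
have [n] := ubnP (size (biv F)); elim: n F => // n IH F hn F0.
have [[u eu]|nu] := pselect (exists u, biv F = 'X * u); last first.
  by exists 0%N, F; rewrite expr0 mul1r.
have [P hP] := evb_surj u.
have eF : F = 'X_0 * P.
  apply: ev2_inj => x y; rewrite ev2M ev2_X0 hP -evb_biv eu evbM; congr (_ * _).
  by rewrite /evb specX hornerX.
have P0 : P != 0 by apply: contra_neq F0 => e; rewrite eF e mulr0.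
have bP : biv P = u by apply: evb_inj => x y; rewrite evb_biv hP.
have [|d [F' [e1 e2]]] := IH P _ P0.
  rewrite bP; have := hn; rewrite eu mulrC size_mulX.
    by rewrite ltnS.
  by rewrite -bP biv_neq0.
by exists d.+1, F'; split=> //; rewrite eF e1 exprS mulrA.
Qed.

(** By smoothness of C_0 the polynomial F' = F / X^d and its derivatives have no common zero on the
    torus, so they generate an ideal containing some nonzero q(Y). The order of q at 0 serves as
    N. *)
Lemma first_jac_bound (M : 'M[int]_2) c F x : M \in unitmx ->
  monomial_subst f M c F -> F != 0 -> x != 0 -> exists N, jac_bound F x N.
Proof.
move=> uM hF F0 x0; have [d [F' [eF nX]]] := factor_X0 F0.
have eX (m : nat) : 'X_0 * ('X_0 ^+ m : {mpoly k[2]})^`M(0) = m%:R *: 'X_0 ^+ m /\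
    ('X_0 ^+ m : {mpoly k[2]})^`M(1) = 0.
  elim: m => [|m [IH0 IH1]].
    by rewrite expr0 -mpolyC1 !mderivC mulr0 scale0r.
  rewrite exprS !mderivM !mderiv_var IH1 mpolyC0 mpolyC1 mul1r mul0r mulr0 addr0.
  split=> //; rewrite mulrDr mulrCA IH0 -scalerAr -natr1 scalerDl.
  by rewrite scale1r addrC.
have [e0 e1] := eX d.
have XF0 : 'X_0 * F^`M(0) = d%:R *: F + 'X_0 ^+ d.+1 * F'^`M(0).
  rewrite {1}eF mderivM mulrDr; congr (_ + _); last by rewrite mulrA -exprS.
  by rewrite mulrA e0 -scalerAl -eF.
have F1 : F^`M(1) = 'X_0 ^+ d * F'^`M(1).
  by rewrite eF mderivM e1 mul0r add0r.
have nz y z : y != 0 -> z != 0 -> ~ [/\ evb (biv F') y z = 0,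
    evb (biv F'^`M(0)) y z = 0 & evb (biv F'^`M(1)) y z = 0].
  move=> y0 z0; rewrite !evb_biv => -[h0 h1 h2].
  have tz : torus (pt2 y z : 'rV[k]_2) by move=> i; rewrite mxE; case: ifP.
  have Fz : ev2 F y z = 0 by rewrite eF ev2M h0 mulr0.
  have [l] := smooth_subst smooth uM tz hF Fz.
  have [->|->] : l = 0 \/ l = 1.
    by case: l => [[|[|//]] hi]; [left|right]; apply: val_inj.
  + have := congr1 (fun P => ev2 P y z) XF0.
    rewrite ev2D !ev2M ev2Z ev2_X0 Fz h1 !mulr0 addr0 => /eqP.
    by rewrite mulf_eq0 (negbTE y0) /= => /eqP; rewrite /ev2 => ->; rewrite eqxx.
  + have := congr1 (fun P => ev2 P y z) F1.
    by rewrite ev2M h2 mulr0 /ev2 => ->; rewrite eqxx.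
have [q [a [b [e [q0 eq_]]]]] := bezout_three nX nz.
have [a' ha] := evb_surj a; have [b' hb] := evb_surj b; have [e' he] := evb_surj e.
have [N [q1 /implyP/(_ q0) nq1 eq1]] := multiplicity_XsubC q 0.
have [Q hQ] := evb_surj q1%:P.
(* The relation for F' multiplied by X^(d+1), a unit at x; [XF0] and [F1] rewrite it in terms of F
   and its derivatives. *)
exists N, ('X_0 ^+ d.+1 * Q), ('X_0 * a' - d%:R *: b'), ('X_0 * b'), ('X_0 * e').
split.
  rewrite ev2M ev2X ev2_X0 hQ evbC mulf_neq0 ?expf_neq0 //.
have hq : Q * 'X_1 ^+ N = a' * F' + b' * F'^`M(0) + e' * F'^`M(1).
  apply: ev2_inj => y z; rewrite !(ev2D, ev2M, ev2X, ev2_X1) hQ evbC ha hb he.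
  rewrite -!evb_biv -!evbM -!evbD eq_ evbC eq1 subr0 hornerM hornerXn.
  by [].
rewrite -mulrA hq F1 mulrDr.
have -> : 'X_0 * b' * F^`M(0) = b' * ('X_0 * F^`M(0)) by rewrite mulrCA mulrA.
rewrite XF0 -!mul_mpolyC; move: (_%:MP) => w; rewrite exprS {1 2}eF; ring.
Qed.

Lemma first_step_good Sigma al : first_step f Sigma -> Sigma al -> good_chart f al.
Proof.
move=> [M [F [hMF ->]]] [v /= ev <-]; have [att nY [c hc]] := hMF v ev.
have e0 : xj (@Chart k 0 v [tuple] (M v) ord0 (F v)) = 0 by apply: val_inj.
have e1 : (ord_max : 'I_2) = 1 by apply: val_inj.
have det1 := att.1; have uM := attached_unit att.
split=> //=.
- exact: fbar_neq0.
- move=> x Cx; rewrite -meval_in_chart; apply: C_set_poly Cx => z [q Cq <-].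
  have tz := torus_chart_coord Cq; rewrite meval_in_chart.
  set be := Chart _ _ _ _ _ in Cq tz *.
  rewrite /xcoord /ycoord e0 e1 -meval_ev2.
  have := laurent_subst_eval uM tz hc.
  rewrite -[M v]/(mat be) (chart_coordK (al := be) det1 Cq).
  have -> : xvec be q = q by rewrite -[RHS](xvec_pt be) [LHS]row2E e1.
  have [[_ ->] _] := (C0_chartP _ _ _).1 Cq.
  by move=> /esym/eqP; rewrite mulf_eq0 (negbTE (xmon_neq0 _ tz)) => /eqP.
- move=> i; have [->|->] := ord2P i.
  + by exists 'X_0, 1%:MP => x _; rewrite !ev2C oner_neq0 mul1r ev2_X0 /xcoord e0.
  + by exists 'X_1, 1%:MP => x _; rewrite !ev2C oner_neq0 mul1r ev2_X1 /ycoord e1.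
- rewrite (_ : _ `\` _ = set0); first exact: finite_set0.
  by apply/seteqP; split=> // q [Cq nq]; apply: nq.
Qed.

Lemma first_step_jac Sigma al p : first_step f Sigma -> Sigma al ->
  Cbar_points f al p -> exists N, jac_bound (charteq al) (xcoord p) N.
Proof.
move=> fs Sal Cp; have := fs; move: (Sal) => + [M [F [hMF eS]]]; rewrite eS.
move=> [v /= ev eal]; subst al; have [att nY [c hc]] := hMF v ev => /=.
apply: (first_jac_bound (attached_unit att) hc).
  by apply: contra_neq (fbar_neq0 nY) => ->; rewrite /fbar /biv msupp0 big_nil rmorph0.
by have [[h _] _] := Cp; apply: h; exact: xj_neq_max.
Qed.

Lemma first_step_finite Sigma : first_step f Sigma -> finite_set Sigma.
Proof.
by move=> [M [F [_ ->]]]; apply: finite_image; exact: finite_edge_normals.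
Qed.

End FirstStep.

(** * Termination *)

Section MultisetOrder.
Variables (T : eqType) (lt : T -> T -> Prop).

(* one element x of L is replaced by finitely many smaller ones *)
Definition mset_lt1 (L' L : seq T) : Prop := exists x K Y,
  [/\ perm_eq L (x :: K), perm_eq L' (Y ++ K) & forall y, y \in Y -> lt y x].

Lemma mset_Acc_perm L M : perm_eq L M -> Acc mset_lt1 L -> Acc mset_lt1 M.
Proof.
move=> pLM [h]; constructor=> N [x [K [Y [p1 p2 p3]]]]; apply: h.
by exists x, K, Y; split=> //; apply: perm_trans pLM p1.
Qed.

(** Induction on the accessibility of [K]. If a step replaces [x], the smaller elements are added to
    [K] one by one; if it replaces an element of [K], the induction hypothesis applies. *)
Lemma mset_Acc_cons x :
  (forall y, lt y x -> forall K, Acc mset_lt1 K -> Acc mset_lt1 (y :: K)) ->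
  forall K, Acc mset_lt1 K -> Acc mset_lt1 (x :: K).
Proof.
move=> hx K; elim=> {}K hK IH; constructor=> N [z [K' [Y [p1 p2 p3]]]].
have [ez|nz] := eqVneq z x.
  subst z; move: p1; rewrite perm_cons => p1.
  apply: (@mset_Acc_perm (Y ++ K)).
    by rewrite perm_sym (perm_trans p2) // perm_cat2l perm_sym.
  have accK : Acc mset_lt1 K by constructor.
  elim: Y p3 {p2} => [_|y Y IHY p3]; first exact: accK.
  have ly : lt y x by apply: p3; rewrite mem_head.
  apply: (hx y ly (Y ++ K)); apply: IHY => y' hy'.
  by apply: p3; rewrite inE hy' orbT.
have xK' : x \in K'.
  have : x \in z :: K' by rewrite -(perm_mem p1) mem_head.
  by rewrite inE eq_sym (negbTE nz).
have pK' := perm_to_rem xK'; set K'' := rem x K' in pK'.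
have pK : perm_eq K (z :: K'').
  have : perm_eq (x :: K) (x :: z :: K'').
    apply: perm_trans p1 _; apply: (@perm_trans _ (z :: x :: K'')).
      by rewrite perm_cons.
    by rewrite -(cat1s z) -(cat1s x) perm_catCA.
  by rewrite perm_cons.
apply: (@mset_Acc_perm (x :: (Y ++ K''))); last first.
  by apply: IH; exists z, K'', Y.
rewrite perm_sym (perm_trans p2) //.
apply: (@perm_trans _ (Y ++ x :: K'')); first by rewrite perm_cat2l.
by rewrite -cat1s perm_catCA.
Qed.

Lemma mset_wf : well_founded lt -> well_founded mset_lt1.
Proof.
move=> wf L.
have cons x : forall K, Acc mset_lt1 K -> Acc mset_lt1 (x :: K).
  by elim: (wf x) => {}x _ IH; apply: mset_Acc_cons.
elim: L => [|x L IH]; last exact: cons.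
by constructor=> N [x [K [Y [/perm_size]]]].
Qed.

Definition mset_lt : seq T -> seq T -> Prop := clos_trans _ mset_lt1.

Lemma mset_lt_permr L L' M : perm_eq L L' -> mset_lt M L -> mset_lt M L'.
Proof.
move=> p h; elim: h p => {L M} [M L [x [K [Y [p1 p2 p3]]]]|M N L h1 _ _ IH] p.
  apply: t_step; exists x, K, Y; split=> //.
  by apply: perm_trans p1; rewrite perm_sym.
exact: t_trans h1 (IH p).
Qed.

Lemma mset_lt_perml L M M' : perm_eq M M' -> mset_lt M L -> mset_lt M' L.
Proof.
move=> p h; elim: h p => {L M} [M L [x [K [Y [p1 p2 p3]]]]|M N L _ IH h2 _] p.
  apply: t_step; exists x, K, Y; split=> //.
  by apply: perm_trans p2; rewrite perm_sym.
exact: t_trans (IH p) h2.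
Qed.

(** The elements of [X] are replaced one at a time: the head [x] by all elements of [Y] below it,
    and the tail by the rest. *)
Lemma mset_lt_replace (X Y K : seq T) : X != [::] ->
  (forall y, y \in Y -> exists2 x, x \in X & lt y x) ->
  mset_lt (Y ++ K) (X ++ K).
Proof.
elim: X Y K => // x X IH Y K _ hY.
pose Y1 := [seq y <- Y | `[< lt y x >]]; pose Y2 := [seq y <- Y | ~~ `[< lt y x >]].
have pY : perm_eq (Y1 ++ Y2) Y by rewrite perm_filterC.
have hY1 y : y \in Y1 -> lt y x by rewrite mem_filter => /andP[/asboolP].
have hY2 y : y \in Y2 -> exists2 x, x \in X & lt y x.
  rewrite mem_filter => /andP[/asboolP nl /hY[z]]; rewrite inE.
  by move=> /orP[/eqP -> //|]; exists z.
have step1 : mset_lt (X ++ (Y1 ++ K)) (x :: X ++ K).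
  apply: t_step; exists x, (X ++ K), Y1; split=> //.
  by rewrite perm_catCA.
have pp : perm_eq (Y2 ++ (Y1 ++ K)) (Y ++ K).
  by rewrite perm_catCA catA perm_cat2r.
have [X0|X0] := eqVneq X [::].
  have Y20 : Y2 = [::].
    case: Y2 hY2 {pY pp} => // y s h.
    by have [z] := h y (mem_head _ _); rewrite X0.
  apply: t_step; exists x, (X ++ K), Y1; split=> //.
  by rewrite X0 /= perm_cat2r -(perm_cat2r Y2) Y20 !cats0 -[Y1]cats0 -Y20 perm_sym.
have step2 := IH Y2 (Y1 ++ K) X0 hY2.
exact: mset_lt_perml pp (t_trans _ _ _ _ _ step2 step1).
Qed.

End MultisetOrder.

Definition lex_lt (a b : nat * nat) : Prop :=
  (a.1 < b.1)%N \/ a.1 = b.1 /\ (a.2 < b.2)%N.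

Lemma lex_lt_wf : well_founded lex_lt.
Proof.
move=> [r N]; elim/ltn_ind: r N => r IHr; elim/ltn_ind => N IHN.
constructor=> -[r' N'] [/= h|[/= -> h]]; [exact: IHr|exact: IHN].
Qed.

Lemma wf_trans (T : Type) (lt : T -> T -> Prop) :
  well_founded lt -> well_founded (clos_trans T lt).
Proof.
move=> wf x; elim: (wf x) => {}x _ IH; constructor=> y h.
elim: h IH => {x y} [y x h IH|y z x h1 _ _ IH2 IH]; first exact: IH.
by have [] := IH2 IH; apply.
Qed.

(** * The list of multiplicities and bounds under an elementary step *)

Section Termination.
Variables (k : closedFieldType) (f : laurent k 2).
Implicit Types (al : chart k) (Sigma : set (chart k)).

(** The shift moves the root x of F(X, 0) to 0, so the monomial X^r, with r its multiplicity,
    occurs. This is the monomial that [mult_step] asks for. *)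
Lemma coef_shift (F : {mpoly k[2]}) c x : fbar F != 0 -> c.[0] = - x ->
  (shift_poly F c)@_(mnm2 (mup x (fbar F)) 0) != 0.
Proof.
move=> F0 cx; set r := mup x _.
have : ('X - x%:P) ^+ r %| fbar F by rewrite -mup_geq.
move=> /dvdpP[Q eQ].
have Qx : Q.[x] != 0.
  apply/negP => h; have /factor_theorem[Q' eQ'] : root Q x by [].
  have : (r.+1 <= mup x (fbar F))%N.
    by rewrite mup_geq // eQ eQ' -mulrA -exprS; exact: dvdp_mull.
  by rewrite ltnn.
have e : fbar (shift_poly F c) = 'X^r * (Q \Po ('X + x%:P)).
  apply/eqP; rewrite -subr_eq0; apply/eqP.
  apply: (finite_roots_eq0 (@infinite_closed_field k)) => y _.
  rewrite hornerD hornerN hornerM hornerXn horner_comp !hornerE.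
  rewrite horner_fbar ev2_shift -horner_fbar cx opprK eQ hornerM horner_exp.
  by rewrite hornerXsubC addrK mulrC subrr.
rewrite -coef_fbar e coefXnM ltnn subnn -horner_coef0 horner_comp !hornerE.
exact: Qx.
Qed.

Definition resolution_inv Sigma : Prop :=
  [/\ finite_set Sigma, forall al, Sigma al -> good_chart f al
    & forall al p, Sigma al -> Cbar_points f al p ->
        exists N, jac_bound (charteq al) (xcoord p) N].

(** A point is recorded by its chart and its X_j-coordinate, which determines it among the points
    with Y = 0 and has a type independent of the chart. *)
Definition item : Type := (chart k * k) * (nat * nat).

Definition valid_item (e : item) : Prop :=
  jac_bound (charteq e.1.1) e.1.2 e.2.2 /\ e.2.1 = mup e.1.2 (fbar (charteq e.1.1)).

Definition multiple_pt al (x : k) : bool := (1 < mup x (fbar (charteq al)))%N.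

(* L lists the possibly singular points of the curves \bar C_alpha, together
   with their multiplicities and bounds for the jacobian ideals. *)
Definition cover Sigma (L : seq item) : Prop :=
  (forall e, e \in L -> valid_item e) /\
  forall al p, Sigma al -> Cbar_points f al p -> multiple_pt al (xcoord p) ->
    exists2 e, e \in L & e.1 = (al, xcoord p).

Definition point_items Sigma : set (chart k * k) :=
  \bigcup_(al in Sigma) ((fun p => (al, xcoord p)) @` Cbar_points f al).

Lemma finite_point_items Sigma : finite_set Sigma ->
  (forall al, Sigma al -> good_chart f al) -> finite_set (point_items Sigma).
Proof.
move=> fS hg; apply: bigcup_finite => // al /hg good.
exact: finite_image (finite_Cbar_points good).
Qed.

Lemma item_list (D : set (chart k * k)) (P : chart k * k -> nat * nat -> Prop) :
  finite_set D -> (forall z, D z -> exists m, P z m) ->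
  exists L : seq item, (forall e, e \in L -> D e.1 /\ P e.1 e.2) /\
    forall z, D z -> exists2 e, e \in L & e.1 = z.
Proof.
move=> /finite_seqP[s ->] h.
have h' z : exists m, z \in s -> P z m.
  have [/h[m hm]|n] := boolP (z \in s); [by exists m|by exists (0%N, 0%N)].
have [m hm] := choice h'.
exists [seq (z, m z) | z <- s]; split=> [_ /mapP[z zs ->] /=|z /= zs].
  by split=> //; apply: hm.
by exists (z, m z) => //; apply/mapP; exists z.
Qed.

Lemma cover_exists Sigma : resolution_inv Sigma -> exists L, cover Sigma L.
Proof.
move=> [fS hg hj].
have [|L [h1 h2]] := @item_list (point_items Sigma) (fun z m => valid_item (z, m))
  (finite_point_items fS hg).
  move=> _ [al Sal [p Cp <-]]; have [N hN] := hj al p Sal Cp.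
  by exists (mup (xcoord p) (fbar (charteq al)), N).
exists L; split=> [[z m] /h1[]//|al p Sal Cp _].
by apply: h2; exists al => //; exists p.
Qed.

Lemma C_set_not_C0 al Z : \det (mat al) = 1 -> C_set f al Z -> ~ C0_image f al Z ->
  Cbar_points f al Z.
Proof.
move=> d CZ nC; split=> //=; apply: contrapT => /eqP nz; apply: nC.
exact: C_set_Y_neq0.
Qed.

Section OneStep.
Variables (Sigma Sigma' : set (chart k)) (al : chart k).
Variable S : seq 'rV[k]_(ng al).+2.
Hypotheses (inv : resolution_inv Sigma) (Sal : Sigma al).
Hypothesis sing : forall p, p \in S -> Sing_Cbar f al p.
Hypothesis step : elementary_step f Sigma S Sigma'.

Lemma step_multiple p : p \in S -> multiple_pt al (xcoord p).
Proof.
have [_ hg _] := inv; move=> /sing[Cp nr]; apply: contrapT => h; apply: nr.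
by apply: (regular_of_simple_root (hg _ Sal)) => //; rewrite leqNgt; apply/negP.
Qed.

(* If a new point has the same multiplicity r as the point p of S below it,
   then beta_2 = 1, and the bound for the jacobian ideal drops by
   beta_1 (r - 1), where r > 1 because p is singular. *)
Lemma step_charts : exists (ta : chart k) (Gamma : set (chart k)),
  [/\ Sigma' = (Sigma `\ al) `|` [set ta] `|` Gamma,
      [/\ good_chart f ta, charteq ta = charteq al
        & forall y, Cbar_points f ta y -> exists2 p, Cbar_points f al p &
            xcoord p = xcoord y /\ forall p', p' \in S -> xcoord p' != xcoord p],
      finite_set Gamma, forall ga, Gamma ga -> good_chart f ga
    & forall ga Z, Gamma ga -> Cbar_points f ga Z ->
        exists2 p, p \in S & forall N, jac_bound (charteq al) (xcoord p) N ->
          exists K, jac_bound (charteq ga) (xcoord Z) K /\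
            lex_lt (mup (xcoord Z) (fbar (charteq ga)), K)
                   (mup (xcoord p) (fbar (charteq al)), N)].
Proof.
have [fS hg hj] := inv; have good := hg _ Sal.
have [c [g [n [nS [Mb [Fb [h1 [h2 _] h3 eS]]]]]]] := step.
pose ta := tilde_chart (\prod_(p <- S) g p) nS.
pose gam p be := circ_chart be (g p) (n p) (Mb p be) (Fb p be).
have fin p : p \in S -> finite_set (zero2 (charteq al) `&` zero2 (tG (c p))).
  by move=> /h1[_ nd _ _]; apply: finite_zero2_tG.
have finS := finite_zero2_prod fin.
have sub p : p \in S -> monomial_subst (lcoef (g p)) (mat al) (n p)
    (in_chart al (tG (c p))) by move=> /h1[_ _ _ []].
have ggood p be : p \in S -> pos_primitive be -> good_chart f (gam p be).
  move=> pS pb; have [att nY [e0 he]] := h3 p be pS pb.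
  exact: (circ_good good (sub p pS) (fin p pS) erefl att pb nY he).
pose Gamma := [set ga | exists p be, [/\ p \in S, pos_primitive be, ga = gam p be
             & C0_image f (gam p be) `<` C_set f (gam p be)]].
exists ta, Gamma; split=> //.
- split=> //; first exact: (tilde_good good h2 finS).
  (* At Y = 0 the factor tG_p' is X_j - X_j(p'), so nonvanishing of the product says that no point
     of [S] is left. *)
  move=> y Cy; have [Co ex nz] := tilde_points good h2 Cy.
  exists (old y) => //; split=> // p' p'S; apply: contra_neq nz => e.
  rewrite ev2_prod; apply/eqP; rewrite prodf_seq_eq0; apply/hasP.
  exists p' => //=; have [e' _ _ _] := h1 p' p'S.
  by rewrite ev2_tG e' -e /xcoord subrr.
(* If C_gamma is larger than C_(0,gamma), it has a point with Y = 0, so F_gamma(X, 0) has a nonzero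
   root and at least two exponents. These come from two exponents of F_(alpha,p) of the same weight
   for beta. *)
- pose E p := [set be | primitive be /\ exists e e', [/\ 
     e \in [seq mexp m | m <- msupp (shift_eqn al (c p))],
     e' \in [seq mexp m | m <- msupp (shift_eqn al (c p))], e != e'
     & idot be e = idot be e']].
  have : finite_set (\bigcup_(p in [set` S]) (gam p @` E p)).
    apply: bigcup_finite => [|p _]; first exact: finite_seq.
    by apply: finite_image; apply: finite_edge_directions.
  apply: sub_finite_set => ga [p [be [pS pb -> [_ nsub]]]].
  exists p => //; exists be => //; split; first by case: pb.
  have [att nY [e0 he]] := h3 p be pS pb.
  have good' := ggood p be pS pb.
  have [Z CZ nZ] : exists2 Z, C_set f (gam p be) Z & ~ C0_image f (gam p be) Z.
    apply: contrapT => no; apply: nsub => Z CZ; apply: contrapT => nZ.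
    by apply: no; exists Z.
  have Cb := C_set_not_C0 (good_det good') CZ nZ.
  have [x0 _ _] := circ_points good (sub p pS) erefl att pb Cb.
  have rt := Cbar_root good' Cb; have nY' := fbar_neq0 nY.
  have [i1 [i2 [n1 n2 lt12]]] := mup_support nY' x0.
  have m0 : (0 < mup (xcoord Z) (fbar (Fb p be)))%N.
    by rewrite -XsubC_dvd // dvdp_XsubCl; apply/rootP.
  move: n1 n2; rewrite !coef_fbar.
  move=> /(coef_Fb att he)[i1' [j1 [k1 l1 e1]]] /(coef_Fb att he)[i2' [j2 [k2 l2 e2]]].
  exists (mexp (mnm2 i1' j1)), (mexp (mnm2 i2' j2)); split.
  + by apply/mapP; exists (mnm2 i1' j1); rewrite // mcoeff_msupp.
  + by apply/mapP; exists (mnm2 i2' j2); rewrite // mcoeff_msupp.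
  + apply/eqP => /rowP/(_ 0); rewrite !mxE !mnmE /= => ei.
    have : be 0 1 * (i2%:Z - i1%:Z) = 0.
      have : i1'%:Z = i2'%:Z by exact: ei.
      by rewrite e1 e2 => /addIr; rewrite !mulrDr mulrN => /addIr ->; rewrite subrr.
    have lt : (i1 < i2)%N by apply: leq_trans lt12; rewrite -add1n leq_add2r.
    case: pb => _ b1 _; move=> /eqP; rewrite mulf_eq0 gt_eqF //= subr_eq0 eqz_nat => /eqP ee.
    by rewrite ee ltnn in lt.
  + by rewrite !idot2 !mxE !mnmE /= l1 l2.
- by move=> ga [p [be [pS pb -> _]]]; exact: ggood.
move=> ga Z Gga; move: Z; case: Gga => p [be [pS pb -> _]] Z Cb; exists p => // N jN.
have [att nY [e0 he]] := h3 p be pS pb; have nY' := fbar_neq0 nY.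
have [x0 _ _] := circ_points good (sub p pS) erefl att pb Cb.
have [ec _ _ _] := h1 p pS.
have jG : jac_bound (shift_eqn al (c p)) 0 N.
  by apply: jac_bound_shift; rewrite ec opprK.
have [K [jK eK]] := jac_step att pb he nY' x0 jG.
exists K; split=> //.
have cr := @coef_shift _ (c p) (xcoord p) (good_Y good) ec.
have [le eqc] := mult_step att pb he nY' x0 cr.
have mp := step_multiple pS; rewrite /multiple_pt in mp.
set r := mup (xcoord p) _ in cr le eqc mp *.
set r' := mup (xcoord Z) _ in le eqc *; rewrite -/r'.
case: pb => b0 b1 _.
have ler : (r' <= r)%N.
  by rewrite -lez_nat; apply: le_trans le; rewrite ler_peMl.
have [lt|ge] := ltnP r' r; first by left.
have er : r' = r by apply/eqP; rewrite eqn_leq ler ge.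
right; split=> //=; have [b11 ed] := eqc er (ltnW mp).
(* With beta_2 = 1 and d = beta_1 r, [jac_step] reads K + beta_1 r + 1 = N + 1 + beta_1. *)
rewrite b11 ed mul1r in eK.
have m1 : Num.min (be 0 0) 1 = (1 : int) by apply/min_idPr.
rewrite m1 in eK.
by move: eK mp b0; move: (be 0 0) (r) => b r0; nia.
Qed.

Lemma step_inv : resolution_inv Sigma'.
Proof.
have [fS hg hj] := inv; have [ta [Ga [eS [gt ct ht] fG gG hG]]] := step_charts.
split.
- rewrite eS !finite_setU; split=> //; split; last exact: finite_set1.
  by apply: sub_finite_set fS => x [].
- by move=> be; rewrite eS => -[[[Sbe _]|->]|/gG]; [exact: hg|exact: gt|].
- move=> be p Sbe; move: Sbe p; rewrite eS => -[[[Sbe _]|->]|Gb] p Cp.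
  + exact: hj.
  + by have [p' Cp' [<- _]] := ht p Cp; rewrite ct; apply: hj.
  + have [q qS hq] := hG be p Gb Cp; have [Cq _] := sing qS.
    have [N jN] := hj al q Sal Cq; have [K [jK _]] := hq N jN.
    by exists K.
Qed.

(** Items at points of [S] are deleted, the other items of alpha move to tilde alpha with unchanged
    pairs, and each point of a new chart gets an item whose pair lies below that of a deleted
    one. *)
Lemma step_cover L : cover Sigma L -> exists L', [/\ cover Sigma' L',
  S = [::] -> [seq e.2 | e <- L'] = [seq e.2 | e <- L]
  & S <> [::] -> mset_lt lex_lt [seq e.2 | e <- L'] [seq e.2 | e <- L]].
Proof.
have [fS hg hj] := inv; have [ta [Ga [eS [gt ct ht] fG gG hG]]] := step_charts.
move=> [val cov].
pose rem (e : item) := (e.1.1 == al) && (e.1.2 \in [seq xcoord p | p <- S]).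
pose ren (e : item) : item := if e.1.1 == al then ((ta, e.1.2), e.2) else e.
have inL p : p \in S -> exists2 e, e \in L & e.1 = (al, xcoord p).
  by move=> pS; apply: cov => //; [case: (sing pS)|exact: step_multiple].
have remp p e : p \in S -> e.1 = (al, xcoord p) -> rem e.
  by move=> pS ee; rewrite /rem ee /= eqxx; apply/mapP; exists p.
(* The condition on [S] makes it immediate that an empty step adds no item. *)
pose D : set (chart k * k) := [set z | point_items Ga z /\ S <> [::]].
have fD : finite_set D.
  by apply: sub_finite_set (finite_point_items fG gG) => z [].
have [|W [W1 W2]] := @item_list D (fun z m => valid_item (z, m) /\
    exists2 e, e \in L & rem e /\ lex_lt m e.2) fD.
  move=> _ [[ga Gga [Z CZ <-]] _]; have [p pS hp] := hG ga Z Gga CZ.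
  have [e eL e1] := inL p pS; have := val e eL; rewrite /valid_item e1 /= => -[jN em].
  have [K [jK lt]] := hp _ jN; exists (mup (xcoord Z) (fbar (charteq ga)), K).
  split; first by split.
  exists e => //; split; first exact: remp pS e1.
  by rewrite [e.2]surjective_pairing em.
exists ([seq ren e | e <- L & ~~ rem e] ++ W).
have keepE : [seq e.2 | e <- [seq ren e | e <- L & ~~ rem e]] =
    [seq e.2 | e <- L & ~~ rem e].
  by rewrite -map_comp; apply: eq_map => e; rewrite /ren /=; case: ifP.
split.
- split=> [e|be p].
    rewrite mem_cat => /orP[/mapP[e' + ->]|/W1[_ []]]; last by case: e.
    rewrite mem_filter => /andP[_ /val ve']; rewrite /ren.
    by case: eqP => // e1; move: ve'; rewrite /valid_item /= ct e1.
  move=> Sbe; move: Sbe p; rewrite eS => -[[[Sbe nbe]|->]|Gb] p Cp mp.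
  + have [e eL e1] := cov be p Sbe Cp mp; exists e => //.
    have nal : (e.1.1 == al) = false by rewrite e1; apply/eqP.
    rewrite mem_cat; apply/orP; left; apply/mapP; exists e.
      by rewrite mem_filter /rem nal.
    by rewrite /ren nal.
  + have [p' Cp' [ex nS]] := ht p Cp.
    have [|e eL e1] := cov al p' Sal Cp'.
      by move: mp; rewrite /multiple_pt ct ex.
    exists ((ta, xcoord p), e.2) => //.
    rewrite mem_cat; apply/orP; left; apply/mapP; exists e.
      rewrite mem_filter eL andbT /rem e1 /= eqxx /=.
      by apply/mapP => -[q qS eq]; have := nS q qS; rewrite eq eqxx.
    by rewrite /ren e1 eqxx /= ex.
  + have [|e eW e1] := W2 (be, xcoord p).
      split; first by exists be => //; exists p.
      by have [q qS _] := hG be p Gb Cp; move: qS; case: (S).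
    by exists e => //; rewrite mem_cat eW orbT.
- move=> S0; have -> : W = [::].
    by case: (W) W1 => // e s /(_ e (mem_head _ _))[[_ nS]].
  rewrite cats0 keepE; congr map; apply/all_filterP/allP => e _.
  by rewrite /rem S0 andbF.
move=> S0; rewrite map_cat keepE.
pose X := [seq e.2 | e <- L & rem e]; pose K := [seq e.2 | e <- L & ~~ rem e].
apply: (@mset_lt_permr _ _ (X ++ K)).
  by rewrite -map_cat; apply: perm_map; rewrite perm_filterC.
apply: (@mset_lt_perml _ _ _ ([seq e.2 | e <- W] ++ K)); first by rewrite perm_catC.
apply: mset_lt_replace.
  have [p pS] : exists p, p \in S by case: (S) S0 => // p s _; exists p; rewrite mem_head.
  have [e eL e1] := inL p pS.
  have : e.2 \in X by apply/mapP; exists e; rewrite // mem_filter eL (remp p).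
  by case: X.
move=> _ /mapP[e /W1[_ [_ [e' e'L [re lt]]]] ->]; exists e'.2 => //.
by apply/mapP; exists e'; rewrite // mem_filter re.
Qed.

End OneStep.

End Termination.

(** * Stabilisation of a resolution *)

Section Resolution.
Variables (k : closedFieldType) (f : laurent k 2).
Variables (Sigma : nat -> set (chart k)) (alpha : nat -> chart k).
Variable calS : forall n : nat, seq 'rV[k]_(ng (alpha n)).+2.
Variable s : forall n : nat,
  glued_curve f (Sigma n.+1) -> glued_curve f (Sigma n).
Hypotheses (hf : smooth_plane_curve f).
Hypothesis hres : simple_Baker_resolution calS s.

Lemma resolution_invP n : (0 < n)%N -> resolution_inv f (Sigma n).
Proof.
case: n => // n _; elim: n => [|n IH].
  have [h1 _] := hres; split; first exact: first_step_finite h1.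
  - by move=> al; apply: first_step_good h1.
  - by move=> al p; apply: (first_step_jac hf h1).
have [_ /(_ n.+1 isT)[Sal [_ sing] step _]] := hres.
exact: step_inv IH Sal sing step.
Qed.

Lemma cover_step n L : (0 < n)%N -> cover f (Sigma n) L ->
  exists L', [/\ cover f (Sigma n.+1) L',
    calS n = [::] -> [seq e.2 | e <- L'] = [seq e.2 | e <- L]
    & calS n <> [::] -> mset_lt lex_lt [seq e.2 | e <- L'] [seq e.2 | e <- L]].
Proof.
move=> n0 cov; have [_ /(_ n n0)[Sal [_ sing] step _]] := hres.
exact: step_cover (resolution_invP n0) Sal sing step _ cov.
Qed.

(** Well-founded induction on the multiset of pairs. If some later stage has a cover with a smaller
    multiset, the induction hypothesis applies there. Otherwise every later step has empty [calS],
    since a nonempty one would lower the multiset, and the assumption gives outer regularity. *)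
Lemma eventually_outer_regular :
  (forall n, (0 < n)%N -> ~ outer_regular f (Sigma n) -> calS n <> [::]) ->
  exists2 h, (0 < h)%N & forall n, (h <= n)%N -> outer_regular f (Sigma n).
Proof.
move=> hS.
suff gen M : forall n L, (0 < n)%N -> cover f (Sigma n) L ->
    [seq e.2 | e <- L] = M ->
    exists2 h, (0 < h)%N & forall m, (h <= m)%N -> outer_regular f (Sigma m).
  have [L cov] := cover_exists (resolution_invP (ltn0Sn 0)).
  exact: gen cov erefl.
elim: (wf_trans (mset_wf lex_lt_wf) M) => {}M _ IH n L n0 cov eL.
have [[m [L' [nm cov' lt]]]|no] := pselect (exists m L', [/\ (n <= m)%N,
    cover f (Sigma m) L' & mset_lt lex_lt [seq e.2 | e <- L'] M]).
  exact: IH lt m L' (leq_trans n0 nm) cov' erefl.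
have same j : exists2 L', cover f (Sigma (n + j)) L' & [seq e.2 | e <- L'] = M.
  elim: j => [|j [L' cov' eL']]; first by rewrite addn0; exists L.
  have [L2 [cov2 e2 lt2]] := cover_step (leq_trans n0 (leq_addr j n)) cov'.
  rewrite addnS; exists L2 => //; rewrite -eL'; apply: e2.
  apply: contrapT => ne; apply: no; exists (n + j).+1, L2.
  by split=> //; [rewrite -addnS leq_addr|rewrite -eL'; apply: lt2].
exists n => // m nm; apply: contrapT => nr.
have m0 := leq_trans n0 nm.
have [L' cov' eL'] := same (m - n)%N; rewrite subnKC // in cov'.
have [L2 [cov2 _ lt2]] := cover_step m0 cov'.
apply: no; exists m.+1, L2; split=> //; first exact: leqW.
by rewrite -eL'; apply: lt2; apply: hS.
Qed.

End Resolution.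

(** * Smoothness of the glued curve *)

Section Glueing.
Variables (k : closedFieldType) (f : laurent k 2) (Sigma : set (chart k)).
Hypothesis hf : smooth_plane_curve f.
Hypothesis good : forall al, Sigma al -> good_chart f al.

Lemma index0_Some al : index0 Sigma (Some al) -> Sigma al.
Proof. by case=> [//|[be Sbe [<-]]]. Qed.

Lemma good_atlas : atlas f Sigma.
Proof.
have [f0 _] := hf; have [s0 cl] := C0_curve_like f0.
split=> [[al|]|[al|]|[al|]] /=.
- by move=> _; exact: zspace_sheaf_like.
- by move=> _; exact: zspace_sheaf_like.
- move=> /index0_Some/good g.
  exact: chart_infinite_opens (good_det g) f0 (good_cofinite g).
- by move=> _; exact: curve_like_infinite_opens cl.
- move=> /index0_Some/good g.
  have [U [iota [cU oi im mk]]] := chart_immersion (good_det g) f0 (good_cofinite g).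
  exists U, iota; split=> //; rewrite im.
  have fin := finite_Cbar_points g.
  apply: (@finite_of_inj _ _ _ (Cbar_points f al) \val) => //.
  + move=> x nx; apply: (C_set_not_C0 (good_det g)) => //; exact: set_valP x.
  + by move=> x y _ _; exact: val_inj.
- move=> _; exists setT, id; split=> //.
  + exact: id_open_immersion_on (@zspace_sheaf_like _ _ _).
  + by rewrite image_id setCT; exact: finite_set0.
  + move=> q x; split=> [e|[p [_ e <-]]] //.
    by exists x.
Qed.

Lemma outer_regular_smooth : finite_set Sigma -> outer_regular f Sigma ->
  smooth_curve (glued_curve f Sigma).
Proof.
move=> fin reg; have [f0 _] := hf; have [s0 cl] := C0_curve_like f0.
apply: (glued_smooth_curve good_atlas fin cl) => -[al|] /=.
- by move=> _; exact: C_chart_affine.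
- by move=> _; exact: C0_affine.
- move=> /index0_Some Sal P.
  exact: C_chart_regular_point (good Sal) hf (reg _ Sal) P.
- by move=> _ P; exact: C0_regular_point.
Qed.

End Glueing.

Theorem theorem5p10 (k : closedFieldType) (f : laurent k 2)
    (hf : smooth_plane_curve f)
    (Sigma : nat -> set (chart k)) (alpha : nat -> chart k)
    (calS : forall n : nat, seq 'rV[k]_(ng (alpha n)).+2)
    (s : forall n : nat, glued_curve f (Sigma n.+1) -> glued_curve f (Sigma n))
    (hres : simple_Baker_resolution calS s)
    (hS : forall n : nat, (0 < n)%N -> ~ outer_regular f (Sigma n) ->
       calS n <> [::]) :
  exists h : nat,
    [/\ (0 < h)%N,
        (forall n : nat, (h <= n)%N ->
           forall ga : chart k, Sigma n ga -> Cbar_regular f ga)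
      & (forall C : kspace k, smooth_completion f C ->
           outer_regular_generalised_Baker_model
             (glued_curve f (Sigma h)) C)].
Proof.
have [h h0 reg] := eventually_outer_regular hf hres hS.
exists h; split=> // C [sC pC bC].
have [fin good _] := resolution_invP hf hres h0.
split=> //; first exact: (outer_regular_smooth hf good fin (reg h (leqnn h))).
(* The given resolution itself exhibits the model, so the isomorphism to be supplied is the
   identity. *)
exists f; split=> //; exists Sigma, alpha, calS, s, h; split=> //; last exact: reg.
exists id; split; last by rewrite image_id.
split=> //.
- exact: openT.
- by move=> V oV; rewrite setTI preimage_id.
- by move=> V oV _; rewrite image_id.
Qed.
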